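(* Let $\lambda\in\mathbb C\setminus(-\infty,-\frac14)$, let $n\ge1$ and let $g_0,\dots,g_{n-1}\in C(\partial\mathbb D)$. Then a solution $f=f_0+\dots+f_{n-1}$ of the Riquier problem at infinity associated with $g_0,\dots,g_{n-1}$ is given by $$ f_k(z)=\boldsymbol\Pi_{k,\lambda}g_k(z),\qquad k=0,\dots,n-1. $$ Moreover, for every $\xi\in\partial\mathbb D$ and every $k\in\{0,\dots,n-1\}$, $$ \lim_{z\to\xi}\frac{f_k(z)}{\Phi_k(z\,|\,\lambda)}=g_k(\xi)\quad\text{and}\quad\lim_{z\to\xi}\frac{f_j(z)}{\Phi_k(z\,|\,\lambda)}=0\ \text{ for }j<k. $$
   Context: $\mathbb D=\{z=x+iy\in\mathbb C:|z|<1\}$ is the open unit disk, $\partial\mathbb D$ the unit circle, $d\xi$ the normalised Lebesgue measure on $\partial\mathbb D$. The hyperbolic Laplacian is $\mathfrak L=\frac{(1-|z|^2)^2}{4}(\partial_x^2+\partial_y^2)$; a function $f:\mathbb D\to\mathbb C$ is $\lambda$-polyharmonic of order $m$ if $(\mathfrak L-\lambda I)^mf=0$. The Poisson kernel is $P(z,\xi)=\frac{1-|z|^2}{|\xi-z|^2}$, and $\mathfrak h(z,\xi)=-\log P(z,\xi)$. For $\lambda\in\mathbb C$, $s(\lambda)=\sqrt{\lambda+\frac14}$, where the square root of $re^{i\phi}$ ($r\ge0$, $\phi\in(-\pi,\pi]$) is $\sqrt r\,e^{i\phi/2}$. For $k\in\mathbb N_0$ define $P_k(z,\xi\,|\,\lambda)=\frac{1}{k!(2s(\lambda))^k}(-\mathfrak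 h(z,\xi))^kP(z,\xi)^{s(\lambda)+1/2}$ if $\lambda\ne-\frac14$, and $P_k(z,\xi\,|-\frac14)=\frac1{(2k)!}\mathfrak h(z,\xi)^{2k}P(z,\xi)^{1/2}$. The polyspherical function is $\Phi_k(z\,|\,\lambda)=\int_{\partial\mathbb D}P_k(z,\xi\,|\,\lambda)\,d\xi$, and $\Phi=\Phi_0$. For $\lambda\in\mathbb C\setminus(-\infty,-\frac14)$, $\Phi_0$ has no zeroes in $\mathbb D$ and $\Phi_k$ has no zeroes for $|z|$ sufficiently close to $1$. For $g\in C(\partial\mathbb D)$, $\boldsymbol\Pi_{k,\lambda}g(z)=\int_{\partial\mathbb D}P_k(z,\xi\,|\,\lambda)\,g(\xi)\,d\xi$. Riquier problem at infinity: given $\lambda\in\mathbb C\setminus(-\infty,-\frac14)$ and $g_0,\dots,g_{n-1}\in C(\partial\mathbb D)$, a solution is a $\lambda$-polyharmonic function $f=f_0+\dots+f_{n-1}$ of order $n$, where each $f_k$ is $\lambda$-polyharmonic of order $k+1$ and $\lim_{z\to\xi}\frac{(\mathfrak L-\lambda I)^kf_k(z)}{\Phi(z\,|\,\lambda)}=g_k(\xi)$ for every $\xi\in\partial\mathbb D$. *)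

(* Defs.v *)
(* Stdlib reals with Coquelicot's complex numbers. *)
From Stdlib Require Import Reals Lra Factorial.
From Coquelicot Require Import Coquelicot.
Open Scope R_scope.

Definition in_disk (z : C) : Prop := Cmod z < 1.
Definition on_circle (xi : C) : Prop := Cmod xi = 1.

Definition Cexp (z : C) : C := (exp (Re z) * cos (Im z), exp (Re z) * sin (Im z)).

(* [x ^ a] for [0 < x] and a complex exponent [a]. *)
Definition Rcpow (x : R) (a : C) : C := Cexp (a * RtoC (ln x)).

(* Argument in (-PI, PI] of a nonzero complex number. *)
Definition Carg (z : C) : R :=
  if Rle_dec 0 (Im z) then acos (Re z / Cmod z) else - acos (Re z / Cmod z).

Definition Csqrt (z : C) : C :=
  (RtoC (sqrt (Cmod z)) * Cexp (0, Carg z / 2)%R)%C.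

(* The branch of the square root: r e^(i phi) |-> sqrt r e^(i phi / 2)
   for r >= 0 and phi in (-PI, PI]. *)
Lemma Csqrt_polar (r phi : R) :
  0 <= r -> - PI < phi <= PI ->
  Csqrt (RtoC r * Cexp (0, phi))%C = (RtoC (sqrt r) * Cexp (0, phi / 2)%R)%C.
Proof.
  intros Hr Hphi.
  assert (Hmod : Cmod (RtoC r * Cexp (0, phi))%C = r).
  { rewrite Cmod_mult, Cmod_R, (Rabs_pos_eq r Hr).
    replace (Cmod (Cexp (0, phi))) with 1; [ring|].
    unfold Cmod, Cexp; simpl. rewrite exp_0.
    replace (_ + _) with (Rsqr (sin phi) + Rsqr (cos phi)) by (unfold Rsqr; ring).
    now rewrite sin2_cos2, sqrt_1. }
  unfold Csqrt. rewrite Hmod.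
  destruct (Req_dec r 0) as [->|Hr0].
  { rewrite sqrt_0, !Cmult_0_l. reflexivity. }
  assert (Harg : Carg (RtoC r * Cexp (0, phi))%C = phi).
  { unfold Carg. rewrite Hmod.
    assert (HRe : Re (RtoC r * Cexp (0, phi))%C / r = cos phi).
    { unfold Cexp; simpl. rewrite exp_0. field. exact Hr0. }
    assert (HIm : Im (RtoC r * Cexp (0, phi))%C = r * sin phi).
    { unfold Cexp; simpl. rewrite exp_0. ring. }
    rewrite HRe, HIm.
    destruct (Rle_lt_dec 0 phi) as [Hp|Hp].
    - destruct (Rle_dec 0 (r * sin phi)) as [_|Hn].
      + apply acos_cos; lra.
      + exfalso. apply Hn, Rmult_le_pos; [lra | apply sin_ge_0; lra].
    - destruct (Rle_dec 0 (r * sin phi)) as [Hn|_].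
      + exfalso. assert (Hs : sin phi < 0) by (apply sin_lt_0_var; lra). nra.
      + rewrite <- cos_neg, acos_cos; lra. }
  rewrite Harg. reflexivity.
Qed.

(* Partial derivatives in x and y of a complex-valued function of z = x + iy.
   [Derive] is total: these are meaningful where the partials exist, which
   [C_on_disk] below requires. *)
Definition dx (f : C -> C) (z : C) : C :=
  (Derive (fun t => Re (f (t, Im z))) (Re z),
   Derive (fun t => Im (f (t, Im z))) (Re z)).
Definition dy (f : C -> C) (z : C) : C :=
  (Derive (fun t => Re (f (Re z, t))) (Im z),
   Derive (fun t => Im (f (Re z, t))) (Im z)).

Definition has_partials (f : C -> C) (z : C) : Prop :=
  ex_derive (V := C_R_NormedModule) (fun t : R => f (t, Im z)) (Re z) /\
  ex_derive (V := C_R_NormedModule) (fun t : R => f (Re z, t)) (Im z).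

(* [f] is of class C^m, in the real sense, on the open unit disk. *)
Fixpoint C_on_disk (m : nat) (f : C -> C) : Prop :=
  match m with
  | O => forall z, in_disk z -> continuous f z
  | S m' => (forall z, in_disk z -> has_partials f z) /\
            C_on_disk m' (dx f) /\ C_on_disk m' (dy f)
  end.

Definition hyp_laplacian (f : C -> C) (z : C) : C :=
  (RtoC ((1 - Cmod z ^ 2) ^ 2 / 4) * (dx (dx f) z + dy (dy f) z))%C.

Definition shifted_laplacian (lam : C) (f : C -> C) (z : C) : C :=
  (hyp_laplacian f z - lam * f z)%C.

Definition polyharmonic (lam : C) (m : nat) (f : C -> C) : Prop :=
  C_on_disk (2 * m) f /\
  forall z, in_disk z -> Nat.iter m (shifted_laplacian lam) f z = RtoC 0.

Definition poisson (z xi : C) : R := (1 - Cmod z ^ 2) / Cmod (xi - z) ^ 2.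
Definition horo (z xi : C) : R := - ln (poisson z xi).

Definition s_of (lam : C) : C := Csqrt (lam + RtoC (1 / 4)).

Definition poly_poisson (k : nat) (lam z xi : C) : C :=
  if Ceq_dec lam (RtoC (- 1 / 4)) then
    RtoC (/ INR (fact (2 * k)) * horo z xi ^ (2 * k) * Rpower (poisson z xi) (1 / 2))
  else
    (/ (RtoC (INR (fact k)) * (2 * s_of lam) ^ k) * RtoC (- horo z xi) ^ k
     * Rcpow (poisson z xi) (s_of lam + RtoC (1 / 2)))%C.

(* Integral over the unit circle against normalised Lebesgue measure; only used
   for continuous integrands, so the Riemann integral suffices. *)
Definition circle_int (F : C -> C) : C :=
  (RtoC (/ (2 * PI))
   * RInt (V := C_R_CompleteNormedModule) (fun t : R => F (cos t, sin t)) 0 (2 * PI))%C.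

Definition Phi (k : nat) (lam z : C) : C :=
  circle_int (fun xi => poly_poisson k lam z xi).

Definition Pi_op (k : nat) (lam : C) (g : C -> C) (z : C) : C :=
  circle_int (fun xi => (poly_poisson k lam z xi * g xi)%C).

(* Unrestricted limit as z tends to the boundary point [xi] within the disk. *)
Definition boundary_lim (F : C -> C) (xi l : C) : Prop :=
  filterlim F (within in_disk (locally xi)) (locally l).

(* [f 0 + ... + f (n - 1)] solves the Riquier problem at infinity with data
   [g 0, ..., g (n - 1)], for [1 <= n] ([sum_n] includes its upper index). *)
Definition riquier_solution (lam : C) (n : nat) (g f : nat -> C -> C) : Prop :=
  polyharmonic lam n (fun z => sum_n (fun k => f k z) (n - 1)) /\
  forall k : nat, (k < n)%nat ->
    polyharmonic lam (k + 1) (f k) /\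
    forall xi, on_circle xi ->
      boundary_lim
        (fun z => (Nat.iter k (shifted_laplacian lam) (f k) z / Phi 0 lam z)%C)
        xi (g k xi).

(* Main.v *)
(** Write [D = |xi - z|^2], [eps = 1 - |z|^2] and [P = eps / D].

    Algebra. Since [(eps^2/4) |grad log P|^2 = 1] and
    [(eps^2/4) Lap (log P) = -1], the shifted Laplacian maps [(log P)^m P^a] to
    [(a(a-1) - lam) (log P)^m P^a + m(2a-1) (log P)^(m-1) P^a
    + m(m-1) (log P)^(m-2) P^a]. With [a = s + 1/2] this gives
    [P_k |-> P_(k-1) + (2s)^(-2) P_(k-2)] (and [P_k |-> P_(k-1)] at
    [lam = -1/4]), so the k-th iterate sends [f_k] to the Poisson-type integral
    of [g_k] against [P_0] and the (k+1)-st one kills it.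

    Boundary limits. Let [L] be the maximum of [log P] over the circle and [J_al]
    the integral of [D^(-al)]. As [|g(xi') - g(xi)| <= eta + B |xi' - xi|^2]
    and [|xi' - xi|^2 <= 2 D + 2 |z - xi|^2], everything reduces to
    [J_(al-1) = o(J_al)] and to the lower bound [|Phi_k| >= c eps^al L^m J_al],
    [al = Re a]. Both come from integrating [(D' phi(D))'] over a period, where
    [D'' = A - D] and [D'^2 = - eps^2 + 2 A D - D^2] with [A = 1 + |z|^2]:
    - [phi = D^(-b)] gives the recursion
      [b eps^2 J_(b+1) = (2b-1) A J_b - (b-1) J_(b-1)] for complex [b], which
      propagates [|J_a| >= c J_al] from large [Re a] down to [Re a > 1/2];
    - [phi = log(D/min D) D^(-al)] shows that [log P] differs from [L] by
      [o(L)] on average when [al > 1/2];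
    - [phi = (log P)^(m+1) D^(-1/2)] with [m] even gives the growth [L^(m+1)] in
      the critical case [al = 1/2]. *)

Require Import Defs.
From Stdlib Require Import Reals Lra Lia Psatz Arith Factorial ClassicalEpsilon Classical.
From Coquelicot Require Import Coquelicot.
Open Scope R_scope.

(** * Circle averages of functions of the distance *)

(** For non-real [a] the integrand [D^(-a)] oscillates, and [log P] takes both signs, so positivity
    alone bounds no [Phi_k] from below. No asymptotic expansion is used either: every estimate
    compares an integral with [J_al] or [J_(al-1)], and [c] is never made explicit in the limit.
    That is why the modulus of continuity of [g] is taken quadratic: [D] times [D^(-al)] is again in
    the family, while a localisation to arcs would leave it. Boundary terms never appear, since
    [D' phi(D)] is periodic. In the critical case the exponent is real and only even powers of
    [log P] occur in the kernels, so there positivity is available and oscillation is not an issue.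
    On the algebraic side, polyharmonicity of order [m] asks for class [C^(2m)] and for iterated
    Laplacians under the integral; kernels are therefore written in a syntax closed under
    differentiation, which makes smoothness of every order a single induction. *)

Definition gap (z : C) : R := 1 - Cmod z ^ 2.

(** The square [|xi - z|^2] for [xi = (cos t, sin t)], expanded; see [dist2_Cmod]. *)
Definition dist2 (z : C) (t : R) : R :=
  1 + Cmod z ^ 2 - 2 * (Re z * cos t + Im z * sin t).

(** Not normalised: the factor [1 / (2 PI)] enters only in [kint]. *)
Definition avg (z : C) (psi : R -> R) : R :=
  RInt (fun t => psi (dist2 z t)) 0 (2 * PI).

Definition pos_cont (psi : R -> R) : Prop :=
  forall d, 0 < d -> continuous psi d.

Lemma Cmod_sqr (z : C) : Cmod z ^ 2 = Re z ^ 2 + Im z ^ 2.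
Proof.
  unfold Cmod, Re, Im. rewrite pow2_sqrt; [reflexivity | nra].
Qed.

Lemma cos2_sin2 (t : R) : cos t ^ 2 + sin t ^ 2 = 1.
Proof. generalize (sin2_cos2 t); unfold Rsqr; nra. Qed.

Lemma gap_bounds (z : C) : in_disk z -> 0 < gap z <= 1.
Proof. unfold in_disk, gap; intros Hz. generalize (Cmod_ge_0 z); nra. Qed.

Lemma dist2_bounds (z : C) (t : R) :
  (1 - Cmod z) ^ 2 <= dist2 z t <= (1 + Cmod z) ^ 2.
Proof.
  unfold dist2.
  assert (H := Cmod_ge_0 z). assert (E := Cmod_sqr z).
  assert (F := cos2_sin2 t).
  set (u := Re z * cos t + Im z * sin t).
  assert (Hu : Rabs u <= Rabs (Cmod z)).
  { apply Rsqr_le_abs_0. unfold Rsqr, u.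
    assert (G := pow2_ge_0 (Re z * sin t - Im z * cos t)). nra. }
  rewrite (Rabs_pos_eq (Cmod z)) in Hu by assumption.
  apply Rabs_le_between in Hu. nra.
Qed.

Lemma dist2_pos (z : C) (t : R) : in_disk z -> 0 < dist2 z t.
Proof.
  unfold in_disk; intros Hz. generalize (dist2_bounds z t); nra.
Qed.

Lemma is_derive_dist2 (z : C) (t : R) :
  is_derive (dist2 z) t (2 * (Re z * sin t - Im z * cos t)).
Proof. unfold dist2. auto_derive; [exact I | ring]. Qed.

Lemma ex_avg (z : C) (psi : R -> R) :
  in_disk z -> pos_cont psi -> ex_RInt (fun t => psi (dist2 z t)) 0 (2 * PI).
Proof.
  intros Hz Hp. apply (ex_RInt_continuous (V := R_CompleteNormedModule)).
  intros t _. apply (continuous_comp (dist2 z) psi).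
  - apply (ex_derive_continuous (V := R_NormedModule)). eexists; apply is_derive_dist2.
  - apply Hp, dist2_pos, Hz.
Qed.

Lemma two_pi_pos : 0 < 2 * PI.
Proof. generalize PI_RGT_0; lra. Qed.

Lemma avg_le (z : C) (f g : R -> R) :
  in_disk z -> pos_cont f -> pos_cont g ->
  (forall d, (1 - Cmod z) ^ 2 <= d <= (1 + Cmod z) ^ 2 -> 0 < d -> f d <= g d) ->
  avg z f <= avg z g.
Proof.
  intros Hz Hf Hg H. apply RInt_le.
  - generalize two_pi_pos; lra.
  - now apply ex_avg.
  - now apply ex_avg.
  - intros t _. apply H; [apply dist2_bounds | now apply dist2_pos].
Qed.

Lemma avg_ext (z : C) (f g : R -> R) :
  in_disk z -> (forall d, 0 < d -> f d = g d) -> avg z f = avg z g.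
Proof.
  intros Hz H. apply RInt_ext. intros t _. now apply H, dist2_pos.
Qed.

Lemma avg_lin (z : C) (a b : R) (f g : R -> R) :
  in_disk z -> pos_cont f -> pos_cont g ->
  avg z (fun d => a * f d + b * g d) = a * avg z f + b * avg z g.
Proof.
  intros Hz Hf Hg. unfold avg.
  apply is_RInt_unique.
  apply (is_RInt_plus (V := R_NormedModule)
           (fun t => a * f (dist2 z t)) (fun t => b * g (dist2 z t)));
    apply (is_RInt_scal (V := R_NormedModule)), (RInt_correct (V := R_CompleteNormedModule));
    now apply ex_avg.
Qed.

Lemma avg_scal (z : C) (a : R) (f : R -> R) :
  in_disk z -> pos_cont f -> avg z (fun d => a * f d) = a * avg z f.
Proof.
  intros Hz Hf. rewrite <- (Rplus_0_r (a * avg z f)), <- (Rmult_0_l (avg z f)).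
  rewrite <- avg_lin by assumption. apply avg_ext; [assumption | intros; ring].
Qed.

Lemma avg_const (z : C) (a : R) : avg z (fun _ => a) = 2 * PI * a.
Proof.
  unfold avg. rewrite (RInt_const (V := R_CompleteNormedModule)).
  unfold scal; simpl; unfold mult; simpl. ring.
Qed.

Lemma pos_cont_derivable (f df : R -> R) :
  (forall d, 0 < d -> is_derive f d (df d)) -> pos_cont f.
Proof.
  intros H d Hd. apply (ex_derive_continuous (V := R_NormedModule)).
  exists (df d). now apply H.
Qed.

Lemma avg_id (z : C) : avg z (fun d => d) = 2 * PI * (2 - gap z).
Proof.
  unfold avg, gap. apply is_RInt_unique.
  set (F := fun t => (1 + Cmod z ^ 2) * t - 2 * (Re z * sin t - Im z * cos t)).
  replace (2 * PI * (2 - (1 - Cmod z ^ 2))) with (minus (F (2 * PI)) (F 0)).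
  2:{ unfold F, minus, plus, opp; simpl. rewrite sin_2PI, cos_2PI, sin_0, cos_0. ring. }
  apply (is_RInt_derive (V := R_CompleteNormedModule) F).
  - intros t _. unfold F, dist2. auto_derive; [exact I | ring].
  - intros t _. apply (ex_derive_continuous (V := R_NormedModule)).
    eexists; apply is_derive_dist2.
Qed.

(* With [D = dist2 z t], [eps = gap z] and [A = 2 - eps = 1 + |z|^2]:
   [D'' = A - D] and [D' ^ 2 = - eps ^ 2 + 2 A D - D ^ 2]; integrate
   [(D' f(D))'] over a period. *)
Lemma avg_parts (z : C) (f df : R -> R) :
  in_disk z ->
  (forall d, 0 < d -> is_derive f d (df d)) -> pos_cont df ->
  avg z (fun d => (2 - gap z - d) * f d
                  + (2 * (2 - gap z) * d - d ^ 2 - gap z ^ 2) * df d) = 0.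
Proof.
  intros Hz Hf Hdf. unfold avg. apply is_RInt_unique.
  assert (Cf := pos_cont_derivable f df Hf).
  set (F := fun t => 2 * (Re z * sin t - Im z * cos t) * f (dist2 z t)).
  replace 0 with (minus (F (2 * PI)) (F 0)) at 2.
  2:{ unfold F, dist2, minus, plus, opp; simpl.
      rewrite sin_2PI, cos_2PI, sin_0, cos_0. ring. }
  apply (is_RInt_derive (V := R_CompleteNormedModule) F).
  - intros t _. unfold F.
    evar_last.
    { apply (is_derive_mult (K := R_AbsRing)
        (fun t => 2 * (Re z * sin t - Im z * cos t)) (fun t => f (dist2 z t)) t
        (2 * (Re z * cos t + Im z * sin t))).
      - auto_derive; [exact I | ring].
      - apply (is_derive_comp f (dist2 z)).
        + apply Hf, dist2_pos, Hz.
        + apply is_derive_dist2.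
      - intros; apply Rmult_comm. }
    unfold plus, mult, scal; simpl; unfold mult; simpl.
    generalize (f (dist2 z t)) (df (dist2 z t)); intros p q.
    assert (E := Cmod_sqr z). assert (G := cos2_sin2 t).
    transitivity ((2 - gap z - dist2 z t) * p
                  + (2 * (Re z * sin t - Im z * cos t)) ^ 2 * q);
      [unfold gap, dist2; ring | ].
    f_equal. f_equal. unfold gap, dist2. rewrite E.
    (* Lagrange's identity: the squares of the inner and the cross product of [z] and [xi] add up to
       [|z|^2 |xi|^2]. *)
    transitivity (4 * (Re z ^ 2 + Im z ^ 2) * (cos t ^ 2 + sin t ^ 2)
                  - 4 * (Re z * cos t + Im z * sin t) ^ 2); [ring|].
    rewrite G. ring.
  - intros t _.
    apply (continuous_comp (dist2 z) (fun d => (2 - gap z - d) * f d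
                  + (2 * (2 - gap z) * d - d ^ 2 - gap z ^ 2) * df d)).
    + apply (ex_derive_continuous (V := R_NormedModule)).
      eexists; apply is_derive_dist2.
    + assert (Hd := dist2_pos z t Hz).
      apply (continuous_plus (V := R_NormedModule));
      apply (continuous_mult (K := R_AbsRing)).
      * apply (ex_derive_continuous (V := R_NormedModule)). auto_derive; exact I.
      * now apply Cf.
      * apply (ex_derive_continuous (V := R_NormedModule)). auto_derive; exact I.
      * now apply Hdf.
Qed.
Lemma pos_cont_lin (a b : R) (f g : R -> R) :
  pos_cont f -> pos_cont g -> pos_cont (fun d => a * f d + b * g d).
Proof.
  intros Hf Hg d Hd. apply (continuous_plus (V := R_NormedModule));
    apply (continuous_scal_r (K := R_AbsRing) (V := R_NormedModule)); auto.
Qed.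

Lemma avg_plus (z : C) (f g : R -> R) :
  in_disk z -> pos_cont f -> pos_cont g ->
  avg z (fun d => f d + g d) = avg z f + avg z g.
Proof.
  intros Hz Hf Hg.
  rewrite <- (Rmult_1_l (avg z f)), <- (Rmult_1_l (avg z g)), <- avg_lin by assumption.
  apply avg_ext; [assumption | intros; ring].
Qed.

(* [d ^ (- al)], and the real and imaginary parts of [d ^ (- b)]. *)
Definition negpow (al d : R) : R := exp (- al * ln d).
Definition re_negpow (b : C) (d : R) : R := exp (- Re b * ln d) * cos (Im b * ln d).
Definition im_negpow (b : C) (d : R) : R := - exp (- Re b * ln d) * sin (Im b * ln d).

Lemma pos_cont_negpow (al : R) : pos_cont (negpow al).
Proof.
  intros d Hd. apply (ex_derive_continuous (V := R_NormedModule)).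
  unfold negpow; auto_derive; exact Hd.
Qed.

Lemma pos_cont_re_negpow (b : C) : pos_cont (re_negpow b).
Proof.
  intros d Hd. apply (ex_derive_continuous (V := R_NormedModule)).
  unfold re_negpow; auto_derive; auto.
Qed.

Lemma pos_cont_im_negpow (b : C) : pos_cont (im_negpow b).
Proof.
  intros d Hd. apply (ex_derive_continuous (V := R_NormedModule)).
  unfold im_negpow; auto_derive; auto.
Qed.

Lemma exp_shift (x d : R) : 0 < d -> exp (- (x + 1) * ln d) = exp (- x * ln d) / d.
Proof.
  intros Hd. replace (- (x + 1) * ln d) with (- x * ln d + - ln d) by ring.
  rewrite exp_plus, exp_Ropp, exp_ln by assumption. reflexivity.
Qed.

Lemma negpow_succ (al d : R) : 0 < d -> negpow (al + 1) d = negpow al d / d.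
Proof. apply exp_shift. Qed.

Lemma negpow_pred (al d : R) : 0 < d -> negpow (al - 1) d = d * negpow al d.
Proof.
  intros Hd. replace al with (al - 1 + 1) at 2 by ring.
  rewrite negpow_succ by assumption. field. lra.
Qed.

Lemma re_negpow_succ (b : C) (d : R) : 0 < d -> re_negpow (b + 1) d = re_negpow b d / d.
Proof.
  intros Hd. unfold re_negpow, Re, Im. simpl. rewrite exp_shift by assumption.
  rewrite Rplus_0_r. field. lra.
Qed.

Lemma im_negpow_succ (b : C) (d : R) : 0 < d -> im_negpow (b + 1) d = im_negpow b d / d.
Proof.
  intros Hd. unfold im_negpow, Re, Im. simpl. rewrite exp_shift by assumption.
  rewrite Rplus_0_r. field. lra.
Qed.

Lemma re_negpow_pred (b : C) (d : R) : 0 < d -> re_negpow (b - 1) d = d * re_negpow b d.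
Proof.
  intros Hd. replace b with (b - 1 + 1)%C at 2 by ring.
  rewrite re_negpow_succ by assumption. field. lra.
Qed.

Lemma im_negpow_pred (b : C) (d : R) : 0 < d -> im_negpow (b - 1) d = d * im_negpow b d.
Proof.
  intros Hd. replace b with (b - 1 + 1)%C at 2 by ring.
  rewrite im_negpow_succ by assumption. field. lra.
Qed.

Definition pow_avg (al : R) (z : C) : R := avg z (negpow al).
Definition cpow_avg (b z : C) : C := (avg z (re_negpow b), avg z (im_negpow b)).

Lemma is_derive_re_negpow (b : C) (d : R) :
  0 < d -> is_derive (re_negpow b) d ((- Re b * re_negpow b d + Im b * im_negpow b d) / d).
Proof.
  intros Hd. unfold re_negpow, im_negpow. auto_derive; [auto | ]. field. lra.
Qed.

Lemma is_derive_im_negpow (b : C) (d : R) :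
  0 < d -> is_derive (im_negpow b) d ((- Re b * im_negpow b d - Im b * re_negpow b d) / d).
Proof.
  intros Hd. unfold re_negpow, im_negpow. auto_derive; [auto | ]. field. lra.
Qed.

Lemma pos_cont_div (f : R -> R) : pos_cont f -> pos_cont (fun d => f d / d).
Proof.
  intros Hf d Hd. apply (continuous_mult (K := R_AbsRing) f Rinv).
  - now apply Hf.
  - apply (ex_derive_continuous (V := R_NormedModule)). auto_derive; lra.
Qed.

(** [avg_parts] is real, so it is applied to both components of [D^(-b)]. The integrand is [A (1 - 2
    b) D^(-b) + (b - 1) D^(1-b) + b gap^2 D^(-b-1)]; the complex factor [b] mixes the components,
    which is why the two identities are recombined only at the end. *)
Lemma cpow_avg_rec (b z : C) :
  in_disk z ->
  (b * RtoC (gap z ^ 2) * cpow_avg (b + 1) z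
   = (2 * b - 1) * RtoC (2 - gap z) * cpow_avg b z - (b - 1) * cpow_avg (b - 1) z)%C.
Proof.
  intros Hz.
  assert (PR := pos_cont_re_negpow). assert (PI := pos_cont_im_negpow).
  assert (R1 := avg_parts z (re_negpow b) (fun d => (- Re b * re_negpow b d + Im b *
      im_negpow b d) / d) Hz
    (is_derive_re_negpow b) (pos_cont_div _ (pos_cont_lin _ _ _ _ (PR b) (PI b)))).
  assert (CI : pos_cont (fun d => (- Re b * im_negpow b d - Im b * re_negpow b d) / d)).
  { apply (pos_cont_div (fun d => - Re b * im_negpow b d - Im b * re_negpow b d)).
    intros d Hd. apply (ex_derive_continuous (V := R_NormedModule)).
    unfold im_negpow, re_negpow; auto_derive; auto. }
  assert (R2 := avg_parts z (im_negpow b) (fun d => (- Re b * im_negpow b d - Im b *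
      re_negpow b d) / d) Hz
    (is_derive_im_negpow b) CI).
  clear CI.
  set (A := 2 - gap z) in *. set (e := gap z ^ 2) in *.
  assert (E1 : avg z (fun d => (1 * ((Re b - 1) * re_negpow (b - 1) d + - Im b * im_negpow (b
      - 1) d)
     + 1 * (1 * (A * (1 - 2 * Re b) * re_negpow b d + 2 * A * Im b * im_negpow b d)
     + e * (Re b * re_negpow (b + 1) d + - Im b * im_negpow (b + 1) d)))) = 0).
  { rewrite <- R1. apply avg_ext; [assumption|]. intros d Hd.
    rewrite re_negpow_succ, im_negpow_succ, re_negpow_pred, im_negpow_pred by assumption.
    field; lra. }
  assert (E2 : avg z (fun d => (1 * ((Re b - 1) * im_negpow (b - 1) d + Im b * re_negpow (b -
      1) d)
     + 1 * (1 * (A * (1 - 2 * Re b) * im_negpow b d + - 2 * A * Im b * re_negpow b d)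
     + e * (Re b * im_negpow (b + 1) d + Im b * re_negpow (b + 1) d)))) = 0).
  { rewrite <- R2. apply avg_ext; [assumption|]. intros d Hd.
    rewrite re_negpow_succ, im_negpow_succ, re_negpow_pred, im_negpow_pred by assumption.
    field; lra. }
  rewrite !avg_lin in E1 by auto using pos_cont_lin.
  rewrite !avg_lin in E2 by auto using pos_cont_lin.
  unfold cpow_avg. unfold Re, Im in E1, E2.
  apply injective_projections; simpl; lra.
Qed.

Lemma cpow_avg_real (al : R) (z : C) : in_disk z -> cpow_avg (RtoC al) z = RtoC (pow_avg al z).
Proof.
  intros Hz. unfold cpow_avg, pow_avg, RtoC. f_equal.
  - apply avg_ext; [assumption|]. intros d Hd. unfold re_negpow, negpow; simpl.
    rewrite Rmult_0_l, cos_0. ring.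
  - transitivity (avg z (fun _ => 0)).
    + apply avg_ext; [assumption|]. intros d Hd. unfold im_negpow; simpl.
      rewrite Rmult_0_l, sin_0. ring.
    + rewrite avg_const. ring.
Qed.

Lemma pow_avg_rec (al : R) (z : C) :
  in_disk z ->
  al * gap z ^ 2 * pow_avg (al + 1) z
  = (2 * al - 1) * (2 - gap z) * pow_avg al z - (al - 1) * pow_avg (al - 1) z.
Proof.
  intros Hz. assert (H := cpow_avg_rec (RtoC al) z Hz).
  rewrite <- RtoC_plus, <- RtoC_minus, !cpow_avg_real in H by assumption.
  rewrite <- ?RtoC_mult, <- ?RtoC_minus, <- ?RtoC_mult, <- ?RtoC_minus, <- ?RtoC_mult in H.
  now apply RtoC_inj in H.
Qed.

Lemma negpow_pos (al d : R) : 0 < negpow al d.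
Proof. apply exp_pos. Qed.

Lemma avg_pos (z : C) (f : R -> R) :
  in_disk z -> pos_cont f -> (forall d, 0 < d -> 0 <= f d) -> 0 <= avg z f.
Proof.
  intros Hz Hf H. replace 0 with (avg z (fun _ => 0)).
  - apply avg_le; auto. intros d _. apply continuous_const.
  - rewrite avg_const. ring.
Qed.

Lemma pow_avg_pos (al : R) (z : C) : in_disk z -> 0 <= pow_avg al z.
Proof.
  intros Hz. apply avg_pos; [assumption | apply pos_cont_negpow |].
  intros; left; apply negpow_pos.
Qed.
Lemma pos_cont_ext (f g : R -> R) :
  (forall d, f d = g d) -> pos_cont f -> pos_cont g.
Proof.
  intros H Hf d Hd. apply (continuous_ext f); [exact H | now apply Hf].
Qed.

(** * Growth near the circle *)

(** Uniform in the direction of [z]: the growth estimates depend on [|z|] only, and [boundary_near]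
    specialises them to one boundary point. *)
Definition near_circle (Q : C -> Prop) : Prop :=
  exists delta, 0 < delta /\ forall z, in_disk z -> gap z < delta -> Q z.

Lemma near_and (Q1 Q2 : C -> Prop) :
  near_circle Q1 -> near_circle Q2 -> near_circle (fun z => Q1 z /\ Q2 z).
Proof.
  intros [d1 [H1 K1]] [d2 [H2 K2]]. exists (Rmin d1 d2). split.
  - now apply Rmin_glb_lt.
  - intros z Hz Hg. split; [apply K1 | apply K2]; try assumption;
      eapply Rlt_le_trans; try exact Hg; [apply Rmin_l | apply Rmin_r].
Qed.

Lemma near_imp (Q1 Q2 : C -> Prop) :
  (forall z, in_disk z -> Q1 z -> Q2 z) -> near_circle Q1 -> near_circle Q2.
Proof.
  intros H [d [Hd K]]. exists d. split; auto.
Qed.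

(** The value of [log P] where [D = (1 - |z|)^2]. The minimum of [P] is the reciprocal of its
    maximum, so [lmax] bounds [|log P|] as well. *)
Definition lmax (z : C) : R := ln ((1 + Cmod z) / (1 - Cmod z)).

Lemma gap_factor (z : C) : gap z = (1 - Cmod z) * (1 + Cmod z).
Proof. unfold gap; ring. Qed.

Lemma lmax_bounds (z : C) : in_disk z -> - ln (gap z) <= lmax z <= ln 4 - ln (gap z).
Proof.
  intros Hz. assert (H := Cmod_ge_0 z). assert (G := gap_bounds z Hz).
  unfold in_disk in Hz.
  assert (E : lmax z = 2 * ln (1 + Cmod z) - ln (gap z)).
  { unfold lmax. rewrite gap_factor, ln_div, ln_mult by lra. ring. }
  rewrite E. replace 4 with (2 * 2) by ring. rewrite (ln_mult 2 2) by lra.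
  assert (ln (1 + Cmod z) <= ln 2) by (apply ln_le; lra).
  assert (ln 1 <= ln (1 + Cmod z)) by (apply ln_le; lra).
  rewrite ln_1 in *. lra.
Qed.

Lemma near_gap_lt (e : R) : 0 < e -> near_circle (fun z => gap z < e).
Proof. intros He. exists e. split; auto. Qed.

Lemma near_neg_ln_gap (M : R) : near_circle (fun z => M < - ln (gap z)).
Proof.
  apply (near_imp (fun z => gap z < exp (- M))).
  - intros z Hz H. assert (G := gap_bounds z Hz).
    assert (ln (gap z) < ln (exp (- M))) by (apply ln_increasing; lra).
    rewrite ln_exp in *. lra.
  - apply near_gap_lt, exp_pos.
Qed.

Lemma near_lmax (M : R) : near_circle (fun z => M < lmax z).
Proof.
  apply (near_imp (fun z => M < - ln (gap z))); [| apply near_neg_ln_gap].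
  intros z Hz H. generalize (lmax_bounds z Hz). lra.
Qed.

Lemma ln_quot_le_lmax (z : C) (d : R) :
  in_disk z -> (1 - Cmod z) ^ 2 <= d <= (1 + Cmod z) ^ 2 ->
  - lmax z <= ln (gap z / d) <= lmax z.
Proof.
  intros Hz Hd. assert (H := Cmod_ge_0 z). assert (G := gap_bounds z Hz).
  unfold in_disk in Hz. assert (0 < d) by nra.
  unfold lmax. rewrite !ln_div, gap_factor, ln_mult by lra.
  assert (A1 : ln ((1 - Cmod z) ^ 2) <= ln d) by (apply ln_le; nra).
  assert (A2 : ln d <= ln ((1 + Cmod z) ^ 2)) by (apply ln_le; nra).
  rewrite !ln_pow in * by lra. simpl in *. lra.
Qed.

Lemma range_le_4 (z : C) (d : R) : in_disk z -> d <= (1 + Cmod z) ^ 2 -> d <= 4.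
Proof. unfold in_disk. intros Hz. generalize (Cmod_ge_0 z). nra. Qed.

Definition moment (m : nat) (al : R) (z : C) : R :=
  avg z (fun d => ln (gap z / d) ^ m * negpow al d).

Lemma pos_cont_lnpow (m : nat) (z : C) (f : R -> R) :
  in_disk z -> pos_cont f -> pos_cont (fun d => ln (gap z / d) ^ m * f d).
Proof.
  intros Hz Hf d Hd. assert (G := gap_bounds z Hz).
  apply (continuous_mult (K := R_AbsRing)); [| now apply Hf].
  apply (ex_derive_continuous (V := R_NormedModule)). auto_derive.
  repeat split; [lra | apply Rmult_lt_0_compat; [lra | now apply Rinv_0_lt_compat]].
Qed.

Lemma is_derive_lnpow_negpow (m : nat) (al e d : R) :
  0 < e -> 0 < d ->
  is_derive (fun d => ln (e / d) ^ S m * negpow al d) d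
    (- (INR (S m) * ln (e / d) ^ m + al * ln (e / d) ^ S m) * negpow al d / d).
Proof.
  intros He Hd. unfold negpow. auto_derive.
  - repeat split; try lra. apply Rmult_lt_0_compat; [lra | now apply Rinv_0_lt_compat].
  - rewrite S_INR. destruct m; simpl pow; unfold Rdiv; [simpl INR | rewrite S_INR]; field; lra.
Qed.

(* Integration by parts against [ln (eps / D) ^ (m + 1) * D ^ (- 1 / 2)]. At
   the exponent 1/2 the leading factors cancel, and for even [m] the second
   term is nonnegative since [ln (eps / D)] and [eps ^ 2 / D - D] have the same
   sign. *)
Lemma half_parts (m : nat) (z : C) :
  in_disk z ->
  avg z (fun d =>
    - (INR (S m) * (2 * (2 - gap z) - d - gap z ^ 2 / d)) * (ln (gap z / d) ^ m * negpow
        (1/2) d)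
    + 1 / 2 * ln (gap z / d) ^ S m * negpow (1/2) d * (gap z ^ 2 / d - d)) = 0.
Proof.
  intros Hz. assert (G := gap_bounds z Hz).
  rewrite <- (avg_parts z (fun d => ln (gap z / d) ^ S m * negpow (1/2) d)
    (fun d => - (INR (S m) * ln (gap z / d) ^ m + 1/2 * ln (gap z / d) ^ S m) * negpow (1/2)
        d / d) Hz).
  - apply avg_ext; [assumption|]. intros d Hd. field. lra.
  - intros d Hd. apply is_derive_lnpow_negpow; lra.
  - apply (pos_cont_div (fun d => - (INR (S m) * ln (gap z / d) ^ m + 1/2 * ln (gap z / d) ^
      S m) * negpow (1/2) d)).
    assert (A1 := pos_cont_lnpow m z _ Hz (pos_cont_negpow (1/2))).
    assert (A2 := pos_cont_lnpow (S m) z _ Hz (pos_cont_negpow (1/2))).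
    apply (pos_cont_ext (fun d => - INR (S m) * (ln (gap z / d) ^ m * negpow (1/2) d)
      + - (1/2) * (ln (gap z / d) ^ S m * negpow (1/2) d))); [intros; ring|].
    now apply pos_cont_lin.
Qed.

Lemma pow_even_nonneg (x : R) (k : nat) : 0 <= x ^ (2 * k).
Proof. rewrite pow_mult. apply pow_le, pow2_ge_0. Qed.

Lemma exp_le_compat (x y : R) : x <= y -> exp x <= exp y.
Proof.
  intros [H | ->]; [left; now apply exp_increasing | apply Rle_refl].
Qed.

Lemma negpow_le (al d e : R) : 0 <= al -> 0 < d <= e -> negpow al e <= negpow al d.
Proof.
  intros Ha Hd. apply exp_le_compat. assert (ln d <= ln e) by (apply ln_le; lra). nra.
Qed.

Lemma negpow_half_4 : negpow (1/2) 4 = / 2.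
Proof.
  unfold negpow. replace 4 with (2 * 2) by ring. rewrite ln_mult by lra.
  replace (- (1/2) * (ln 2 + ln 2)) with (- ln 2) by field.
  rewrite exp_Ropp, exp_ln; lra.
Qed.

(** The right side is nonnegative, which settles [d <= 1]. For [d > 1] one has
    [- ln (eps / d) >= l / 2], [d^(-1/2) >= 1/2] because [d <= 4], and [d - eps^2 / d >= d - 1]; the
    powers of two collect to [2k + 3]. The comparison function [d - 1] is chosen because its average
    is known exactly from [avg_id]. *)
Lemma moment_half_pointwise (k : nat) (eps l d : R) :
  0 < eps <= 1 -> 0 < d <= 4 -> 0 <= l -> 2 * - ln eps >= l ->
  (/ 2) ^ (2 * k + 3) * l ^ S (2 * k) * (d - 1)
  <= 1 / 2 * ln (eps / d) ^ S (2 * k) * negpow (1/2) d * (eps ^ 2 / d - d).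
Proof.
  intros He Hd Hl Hle.
  assert (Hp := negpow_pos (1/2) d).
  assert (HQ : 0 < eps / d) by (apply Rdiv_lt_0_compat; lra).
  assert (Ed : eps ^ 2 / d - d = d * ((eps / d) ^ 2 - 1)) by (field; lra).
  rewrite Ed. rewrite <- !(fun x => tech_pow_Rmult x (2 * k)).
  assert (Hy := pow_even_nonneg (ln (eps / d)) k).
  destruct (Rle_dec d 1) as [D1 | D1].
  - apply Rle_trans with 0.
    + assert (0 <= (/ 2) ^ (2 * k + 3)) by (apply pow_le; lra).
      assert (0 <= l * l ^ (2 * k)) by (apply Rmult_le_pos; [lra | now apply pow_le]).
      assert (0 <= (/ 2) ^ (2 * k + 3) * (l * l ^ (2 * k)) * (1 - d)) by
        (apply Rmult_le_pos; [now apply Rmult_le_pos | lra]).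
      lra.
    + assert (0 <= ln (eps / d) * ((eps / d) ^ 2 - 1)).
      { destruct (Rle_dec (eps / d) 1) as [H1|H1].
        - assert (ln (eps / d) <= ln 1) by (apply ln_le; lra). rewrite ln_1 in *.
          replace (_ * _) with (- ln (eps / d) * (1 - (eps / d) ^ 2)) by ring.
          apply Rmult_le_pos; nra.
        - assert (ln 1 <= ln (eps / d)) by (apply ln_le; lra). rewrite ln_1 in *.
          apply Rmult_le_pos; nra. }
      replace (1 / 2 * (ln (eps / d) * ln (eps / d) ^ (2 * k)) * negpow (1 / 2) d * (d *
          ((eps / d) ^ 2 - 1)))
        with (1 / 2 * (ln (eps / d) ^ (2 * k) * (negpow (1 / 2) d * d)) * (ln (eps / d) *
            ((eps / d) ^ 2 - 1))) by ring.
      apply Rmult_le_pos; [|assumption].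
      apply Rmult_le_pos; [lra|]. apply Rmult_le_pos; [assumption|].
      apply Rmult_le_pos; lra.
  - assert (Hln : l / 2 <= - ln (eps / d)).
    { rewrite ln_div by lra. assert (ln 1 <= ln d) by (apply ln_le; lra).
      rewrite ln_1 in *. lra. }
    assert (P1 : (l / 2) ^ S (2 * k) <= (- ln (eps / d)) ^ S (2 * k)) by (apply pow_incr; lra).
    assert (E1 : (- ln (eps / d)) ^ S (2 * k) = - (ln (eps / d) * ln (eps / d) ^ (2 * k))).
    { rewrite <- !(fun x => tech_pow_Rmult x (2 * k)). rewrite !pow_mult. replace ((- ln (eps
        / d)) ^ 2) with (ln (eps / d) ^ 2) by ring. ring. }
    rewrite E1 in P1. rewrite <- !(fun x => tech_pow_Rmult x (2 * k)) in P1.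
    assert (P2 : / 2 <= negpow (1/2) d) by (rewrite <- negpow_half_4; apply negpow_le; lra).
    assert (P3 : d - 1 <= - (d * ((eps / d) ^ 2 - 1))).
    { rewrite <- Ed. assert (eps ^ 2 / d <= 1); [|lra].
      apply Rmult_le_reg_r with d; [lra|]. unfold Rdiv. rewrite Rmult_assoc, Rinv_l by lra.
          nra. }
    assert (P0 : 0 <= l / 2 * (l / 2) ^ (2 * k)).
    { apply Rmult_le_pos; [lra | apply pow_le; lra]. }
    replace ((/ 2) ^ (2 * k + 3) * (l * l ^ (2 * k)) * (d - 1))
      with (1 / 2 * (l / 2 * (l / 2) ^ (2 * k)) * (/ 2) * (d - 1)).
    2:{ unfold Rdiv. rewrite pow_add, Rpow_mult_distr. ring. }
    replace (1 / 2 * (ln (eps / d) * ln (eps / d) ^ (2 * k)) * negpow (1 / 2) d * (d * ((eps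
        / d) ^ 2 - 1)))
      with (1 / 2 * - (ln (eps / d) * ln (eps / d) ^ (2 * k)) * negpow (1 / 2) d * - (d *
          ((eps / d) ^ 2 - 1))) by ring.
    apply Rmult_le_compat; try lra.
    apply Rmult_le_compat; lra.
Qed.

Lemma moment_half_lower (k : nat) :
  exists c, 0 < c /\ near_circle (fun z => c * lmax z ^ S (2 * k) <= moment (2 * k) (1/2) z).
Proof.
  set (m := (2 * k)%nat).
  (* The first term of [half_parts] is at least [- 4 (m + 1)] times the moment integrand. Below,
     [ln 4 < - ln (gap z)] gives [lmax z <= - 2 ln (gap z)], and [gap z < 1/2] makes the average of
     [d - 1] at least one. *)
  exists ((/ 2) ^ (m + 3) / (4 * INR (S m))). 
  assert (Hm := lt_0_INR (S m) (Nat.lt_0_succ m)).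
  assert (Hc : 0 < (/ 2) ^ (m + 3)) by (apply pow_lt; lra).
  split; [apply Rdiv_lt_0_compat; lra|].
  apply (near_imp (fun z => (ln 4 < - ln (gap z)) /\ gap z < 1 / 2)).
  2:{ apply near_and; [apply near_neg_ln_gap | apply near_gap_lt; lra]. }
  intros z Hz [H1 H2].
  assert (G := gap_bounds z Hz). assert (LB := lmax_bounds z Hz).
  assert (ln4 : 0 < ln 4) by (rewrite <- ln_1; apply ln_increasing; lra).
  assert (E := half_parts m z Hz).
  assert (PC := pos_cont_lnpow m z _ Hz (pos_cont_negpow (1/2))).
  assert (PL : pos_cont (fun d => d + -1)).
  { intros d Hd. apply (ex_derive_continuous (V := R_NormedModule)). auto_derive; exact I. }
  assert (K : - (4 * INR (S m)) * moment m (1/2) z + (/ 2) ^ (m + 3) * lmax z ^ S m * avg z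
      (fun d => d + -1) <= 0).
  { unfold moment. rewrite <- avg_lin by assumption. refine (Rle_trans _ _ _ _ (Req_le _ _ E)).
    apply avg_le; [assumption | now apply pos_cont_lin | |].
    - intros d Hd.
      assert (continuous (fun d => ln (gap z / d)) d).
      { apply (ex_derive_continuous (V := R_NormedModule)). auto_derive.
        repeat split; [lra | apply Rmult_lt_0_compat; [lra | now apply Rinv_0_lt_compat]]. }
      apply (ex_derive_continuous (V := R_NormedModule)). unfold negpow. auto_derive.
      repeat split; try lra; apply Rmult_lt_0_compat; try lra; now apply Rinv_0_lt_compat.
    - intros d Hd Hd0. assert (D4 := range_le_4 z d Hz (proj2 Hd)).
      apply Rplus_le_compat.
      + assert (0 <= ln (gap z / d) ^ m * negpow (1/2) d).
        { apply Rmult_le_pos; [apply pow_even_nonneg | left; apply negpow_pos]. }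
        assert (0 <= gap z ^ 2 / d) by (apply Rmult_le_pos; [nra | left; now apply
            Rinv_0_lt_compat]).
        assert (INR (S m) * (2 * (2 - gap z) - d - gap z ^ 2 / d) <= 4 * INR (S m)) by nra.
        nra.
      + apply (moment_half_pointwise k); lra. }
  rewrite avg_plus, avg_id, avg_const in K.
  2: assumption.
  2:{ intros d Hd. apply continuous_id. }
  2:{ intros d Hd. apply continuous_const. }
  assert (HL : 0 <= lmax z ^ S m) by (apply pow_le; lra).
  assert (HP : 1 <= 2 * PI * (2 - gap z) + 2 * PI * -1).
  { generalize PI2_1; intros; unfold Rdiv in *; nra. }
  set (Lm := lmax z ^ S m) in *. set (M := moment m (1/2) z) in *. set (c := (/ 2) ^ (m + 3))
      in *.
  apply Rmult_le_reg_l with (4 * INR (S m)); [lra|].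
  replace (4 * INR (S m) * (c / (4 * INR (S m)) * Lm)) with (c * Lm) by (field; lra).
  assert (0 <= c * Lm) by nra. nra.
Qed.
Lemma moment_0 (al : R) (z : C) : in_disk z -> moment 0 al z = pow_avg al z.
Proof. intros Hz. apply avg_ext; [assumption | intros; simpl; ring]. Qed.

Lemma pow_avg_half_lower :
  exists c, 0 < c /\ near_circle (fun z => c * lmax z <= pow_avg (1/2) z).
Proof.
  destruct (moment_half_lower 0) as [c [Hc H]]. exists c. split; [assumption|].
  revert H. apply near_imp. intros z Hz H. simpl in H.
  rewrite moment_0, Rmult_1_r in H; assumption.
Qed.

Lemma negpow_add (al be d : R) : negpow (al + be) d = negpow al d * negpow be d.
Proof. unfold negpow. rewrite <- exp_plus. f_equal. ring. Qed.

Lemma negpow_neg_le (al d e : R) : al <= 0 -> 0 < d <= e -> negpow al d <= negpow al e.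
Proof.
  intros Ha Hd. apply exp_le_compat. assert (ln d <= ln e) by (apply ln_le; lra). nra.
Qed.

(** In [half_parts] with [m = 0], [|log P| <= L] bounds [J_(1/2)] by [1 + L/2] times
    [J_(-1/2) + gap^2 J_(3/2)]. The recursion at 1/2 loses its middle term, so both summands equal
    [J_(-1/2)], which is bounded as [D <= 4]. Finally [1 + L/2 <= L] once [L > 2]. *)
Lemma pow_avg_half_upper :
  exists c, 0 < c /\ near_circle (fun z => pow_avg (1/2) z <= c * lmax z).
Proof.
  set (K := negpow (1/2 - 1) 4).
  assert (HK : 0 < K) by apply negpow_pos.
  exists (2 * PI * K * 2). split.
  { apply Rmult_lt_0_compat; [apply Rmult_lt_0_compat; [apply two_pi_pos | assumption] | lra]. }
  apply (near_imp (fun z => 2 < lmax z)); [|apply near_lmax].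
  intros z Hz HL. assert (G := gap_bounds z Hz).
  assert (E := half_parts 0 z Hz).
  assert (B : pow_avg (1/2 - 1) z <= 2 * PI * K).
  { rewrite <- (avg_const z). apply avg_le; [assumption | apply pos_cont_negpow | |].
    - intros d _; apply continuous_const.
    - intros d Hd Hd0. assert (D4 := range_le_4 z d Hz (proj2 Hd)).
      apply negpow_neg_le; lra. }
  assert (R1 := pow_avg_rec (1/2) z Hz).
  replace ((2 * (1 / 2) - 1) * (2 - gap z) * pow_avg (1 / 2) z) with 0 in R1 by field.
  assert (I : 0 <= - (2 * (2 - gap z)) * pow_avg (1/2) z
     + (1 + lmax z / 2) * (1 * pow_avg (1/2 - 1) z + gap z ^ 2 * pow_avg (1/2 + 1) z)).
  { unfold pow_avg. rewrite <- !avg_lin by auto using pos_cont_lin, pos_cont_negpow.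
    refine (Rle_trans _ _ _ (Req_le _ _ (eq_sym E)) _).
    apply avg_le; [assumption | | auto using pos_cont_lin, pos_cont_negpow |].
    - intros d Hd. apply (ex_derive_continuous (V := R_NormedModule)). unfold negpow.
        auto_derive.
      repeat split; try lra; apply Rmult_lt_0_compat; try lra; now apply Rinv_0_lt_compat.
    - intros d Hd Hd0. rewrite negpow_succ, negpow_pred by assumption.
      assert (Hy := ln_quot_le_lmax z d Hz Hd).
      assert (Hp := negpow_pos (1/2) d).
      assert (Hq : 0 < negpow (1/2) d / d) by (apply Rdiv_lt_0_compat; assumption).
      simpl INR. rewrite pow_O, pow_1.
      set (y := ln (gap z / d)) in *. set (p := negpow (1/2) d) in *.
      replace (gap z ^ 2 / d) with (gap z ^ 2 * / d) by reflexivity.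
      replace (p / d) with (p * / d) in * by reflexivity.
      assert (0 <= p * d) by nra.
      assert (0 <= gap z ^ 2 * (p * / d)) by (apply Rmult_le_pos; nra).
      assert (0 <= (lmax z - y) * (gap z ^ 2 * (p * / d))) by (apply Rmult_le_pos; lra).
      assert (0 <= (lmax z + y) * (p * d)) by (apply Rmult_le_pos; lra).
      lra. }
  assert (HJ := pow_avg_pos (1/2) z Hz). assert (HJ' := pow_avg_pos (1/2 - 1) z Hz).
  set (J := pow_avg (1/2) z) in *. set (J1 := pow_avg (1/2 - 1) z) in *.
  replace (gap z ^ 2 * pow_avg (1/2 + 1) z) with J1 in I by lra.
  assert (0 <= (1 - gap z) * J) by (apply Rmult_le_pos; lra).
  assert (2 * J <= (1 + lmax z / 2) * (2 * J1)) by lra.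
  assert ((1 + lmax z / 2) * (2 * J1) <= lmax z * (2 * J1)) by (apply Rmult_le_compat_r; lra).
  assert (lmax z * (2 * J1) <= lmax z * (2 * (2 * PI * K))) by (apply Rmult_le_compat_l; lra).
  lra.
Qed.

(** As [D <= 4], [J_al] is at least [4^(1/2 - al) J_(1/2)], and the latter grows with [lmax]. *)
Lemma near_pow_avg_gt (al M : R) : 1 / 2 <= al -> near_circle (fun z => M < pow_avg al z).
Proof.
  intros Hal. destruct pow_avg_half_lower as [c [Hc H]].
  set (K := negpow (al - 1/2) 4). assert (HK : 0 < K) by apply negpow_pos.
  assert (H2 := near_and _ _ H (near_lmax (M / (K * c)))).
  revert H2. apply near_imp. intros z Hz [H1 H2].
  apply Rlt_le_trans with (K * pow_avg (1/2) z).
  - apply Rlt_le_trans with (K * (c * lmax z)).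
    + apply (Rmult_lt_compat_l (K * c)) in H2; [|now apply Rmult_lt_0_compat].
      replace (K * c * (M / (K * c))) with M in H2 by (field; lra). lra.
    + apply Rmult_le_compat_l; lra.
  - unfold pow_avg. rewrite <- avg_scal by (auto using pos_cont_negpow).
    apply avg_le; [assumption | | apply pos_cont_negpow |].
    + intros d Hd. apply (continuous_scal_r (K := R_AbsRing) (V := R_NormedModule) K).
      now apply pos_cont_negpow.
    + intros d Hd Hd0. assert (D4 := range_le_4 z d Hz (proj2 Hd)).
      replace al with (al - 1/2 + 1/2) at 1 by ring. rewrite negpow_add.
      apply Rmult_le_compat_r; [left; apply negpow_pos | apply negpow_le; lra].
Qed.

(** Write [D^(1-al) = D D^(-al)]. Where [D <= eta / 2] the extra factor is small; elsewhere the
    integrand is at most the constant [K], which is absorbed because [J_al] is unbounded near the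
    circle. *)
Lemma pow_avg_pred_small (al eta : R) :
  1 / 2 <= al -> 0 < eta -> near_circle (fun z => pow_avg (al - 1) z <= eta * pow_avg al z).
Proof.
  intros Hal He. set (K := 4 * negpow al (eta / 2)).
  apply (near_imp (fun z => 2 * PI * K / (eta / 2) < pow_avg al z)); [| now apply
      near_pow_avg_gt].
  intros z Hz H.
  assert (I : pow_avg (al - 1) z <= eta / 2 * pow_avg al z + 1 * avg z (fun _ => K)).
  { unfold pow_avg. rewrite <- avg_lin; auto using pos_cont_negpow.
    2:{ intros d _. apply continuous_const. }
    apply avg_le; [assumption | apply pos_cont_negpow | |].
    - apply pos_cont_lin; [apply pos_cont_negpow | intros d _; apply continuous_const].
    - intros d Hd Hd0. assert (D4 := range_le_4 z d Hz (proj2 Hd)).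
      rewrite negpow_pred by assumption.
      assert (Hp := negpow_pos al d). assert (Hq := negpow_pos al (eta / 2)).
      destruct (Rle_dec d (eta / 2)) as [Hl|Hl].
      + unfold K. nra.
      + assert (negpow al d <= negpow al (eta / 2)) by (apply negpow_le; lra). unfold K. nra. }
  rewrite avg_const in I.
  apply (Rmult_lt_compat_l (eta / 2)) in H; [|lra].
  replace (eta / 2 * (2 * PI * K / (eta / 2))) with (2 * PI * K) in H by (field; lra). lra.
Qed.

(** Equal to [lmax - log P], the nonnegative defect of [log P] from its maximum ([logdist_eq]). *)
Definition logdist (z : C) (d : R) : R := ln (d / (1 - Cmod z) ^ 2).

Lemma logdist_eq (z : C) (d : R) :
  in_disk z -> 0 < d -> logdist z d = lmax z - ln (gap z / d).
Proof.
  unfold in_disk. intros Hz Hd. assert (H := Cmod_ge_0 z).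
  unfold logdist, lmax. rewrite gap_factor.
  assert (0 < (1 - Cmod z) * (1 + Cmod z)) by nra.
  rewrite !ln_div, ln_mult, ln_pow by nra. simpl. ring.
Qed.

Lemma logdist_bounds (z : C) (d : R) :
  in_disk z -> (1 - Cmod z) ^ 2 <= d <= (1 + Cmod z) ^ 2 ->
  0 <= logdist z d <= 2 * lmax z.
Proof.
  intros Hz Hd. assert (0 < d) by (unfold in_disk in Hz; nra).
  rewrite logdist_eq by assumption. generalize (ln_quot_le_lmax z d Hz Hd). lra.
Qed.

Lemma ln_le_self (x : R) : 0 < x -> ln x <= x - 1.
Proof.
  intros Hx. assert (H := exp_ineq1_le (ln x)). rewrite exp_ln in H by assumption. lra.
Qed.

Lemma pos_cont_logdist (z : C) (f : R -> R) :
  in_disk z -> pos_cont f -> pos_cont (fun d => logdist z d * f d).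
Proof.
  unfold in_disk. intros Hz Hf d Hd. assert (0 < (1 - Cmod z) ^ 2) by nra.
  apply (continuous_mult (K := R_AbsRing)); [| now apply Hf].
  apply (ex_derive_continuous (V := R_NormedModule)). unfold logdist. auto_derive.
  apply Rmult_lt_0_compat; [lra | apply Rinv_0_lt_compat; simpl in *; lra].
Qed.

Lemma is_derive_ln_negpow (al q d : R) :
  0 < q -> 0 < d ->
  is_derive (fun d => ln (d / q) * negpow al d) d
    ((negpow al d + - al * (ln (d / q) * negpow al d)) / d).
Proof.
  intros Hq Hd. unfold negpow. auto_derive.
  - repeat split; try lra. apply Rmult_lt_0_compat; [lra | now apply Rinv_0_lt_compat].
  - unfold Rdiv. field. lra.
Qed.

(** Integration by parts yields [(2 al - 1) X <= (4 + 4 al) J_al + 2 b L J_(al-1)]. The first term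
    is small against [L J_al] for large [L], the second because [J_(al-1) = o(J_al)]. At [al = 1/2]
    the coefficient of [X] vanishes, hence the separate treatment of that exponent. *)
Lemma avg_logdist_small (al eta : R) :
  1 / 2 < al -> 0 < eta ->
  near_circle (fun z => avg z (fun d => logdist z d * negpow al d) <= eta * lmax z * pow_avg
      al z).
Proof.
  intros Hal He. set (b := Rabs (1 - al)). assert (Hb : 0 <= b) by apply Rabs_pos.
  (* Gives each of the two terms half of [eta (2 al - 1) L J_al]; [b + 1] replaces [b], which is
     zero at [al = 1]. *)
  set (e2 := eta * (2 * al - 1) / (4 * (b + 1))).
  assert (He2 : 0 < e2). { unfold e2. apply Rdiv_lt_0_compat; nra. }
  assert (H := near_and _ _ (pow_avg_pred_small al e2 (Rlt_le _ _ Hal) He2)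
    (near_lmax (2 * (4 + 4 * al) / (eta * (2 * al - 1))))).
  revert H. apply near_imp. intros z Hz [H1 H2].
  assert (G := gap_bounds z Hz).
  assert (E := avg_parts z (fun d => logdist z d * negpow al d)
    (fun d => (negpow al d + - al * (logdist z d * negpow al d)) / d) Hz).
  set (X := avg z (fun d => logdist z d * negpow al d)) in *.
  assert (PCL := pos_cont_logdist z _ Hz (pos_cont_negpow al)).
  assert (PL : pos_cont (fun d => (negpow al d + - al * (logdist z d * negpow al d)) / d)).
  { apply (pos_cont_div (fun d => negpow al d + - al * (logdist z d * negpow al d))).
    apply (pos_cont_ext (fun d => 1 * negpow al d + - al * (logdist z d * negpow al d)));
        [intros; ring|].
    apply pos_cont_lin; [apply pos_cont_negpow | exact PCL]. }
  lapply E; clear E; [intros E; specialize (E PL) |].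
  2:{ intros d Hd. apply is_derive_ln_negpow; [unfold in_disk in Hz; nra | assumption]. }
  assert (PD : pos_cont (fun d => d)) by (intros d _; apply continuous_id).
  assert (I : 0 <= - (2 * al - 1) * X
    + 1 * ((4 + 4 * al) * pow_avg al z + (2 * b * lmax z) * pow_avg (al - 1) z)).
  { unfold X, pow_avg. rewrite <- !avg_lin by auto using pos_cont_negpow, pos_cont_lin.
    refine (Rle_trans _ _ _ (Req_le _ _ (eq_sym E)) _).
    apply avg_le; [assumption | | auto using pos_cont_negpow, pos_cont_lin |].
    - intros d Hd. assert (0 < (1 - Cmod z) ^ 2) by (unfold in_disk in Hz; nra).
      apply (continuous_plus (V := R_NormedModule));
      apply (continuous_mult (K := R_AbsRing)); try (now apply PCL); try (now apply PL);
      apply (ex_derive_continuous (V := R_NormedModule)); auto_derive; exact I.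
    - intros d Hd Hd0. rewrite negpow_pred by assumption.
      assert (Hx := logdist_bounds z d Hz Hd).
      assert (Hp := negpow_pos al d).
      (* By [ln y <= y] with [y = d / (1 - |z|)^2], the product is at most
         [gap^2 / (1 - |z|)^2 = (1 + |z|)^2]. *)
      assert (HQ : logdist z d * (gap z ^ 2 / d) <= 4).
      { unfold in_disk in Hz. assert (H := Cmod_ge_0 z).
        assert (Q0 : 0 < (1 - Cmod z) ^ 2) by nra.
        assert (Q1 : 0 < d / (1 - Cmod z) ^ 2) by (now apply Rdiv_lt_0_compat).
        assert (Q2 := ln_le_self _ Q1). fold (logdist z d) in Q2.
        apply Rle_trans with (d / (1 - Cmod z) ^ 2 * (gap z ^ 2 / d)).
        - apply Rmult_le_compat_r; [|lra].
          apply Rmult_le_pos; [nra | left; now apply Rinv_0_lt_compat].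
        - rewrite gap_factor.
          replace (d / (1 - Cmod z) ^ 2 * (((1 - Cmod z) * (1 + Cmod z)) ^ 2 / d))
            with ((1 + Cmod z) ^ 2); [nra|]. field. split; lra. }
      assert (HG : 0 <= gap z ^ 2 / d).
      { apply Rmult_le_pos; [nra | left; now apply Rinv_0_lt_compat]. }
      set (x := logdist z d) in *. set (p := negpow al d) in *.
      assert (Hbb : x * ((al - 1) * d) <= 2 * lmax z * (b * d)).
      { assert ((al - 1) * d <= b * d).
        { apply Rmult_le_compat_r; [lra|]. unfold b. generalize (Rle_abs (-(1 - al))).
          rewrite Rabs_Ropp. lra. }
        apply Rle_trans with (x * (b * d)); [apply Rmult_le_compat_l; lra|].
        apply Rmult_le_compat_r; [apply Rmult_le_pos|]; lra. }
      replace ((2 - gap z - d) * (x * p) + (2 * (2 - gap z) * d - d ^ 2 - gap z ^ 2) * ((p +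
          - al * (x * p)) / d))
        with (p * ((2 - gap z) * (2 * al - 1) * (- x) + x * ((al - 1) * d) + al * (x * (gap z
            ^ 2 / d)) + (2 * (2 - gap z) - d - gap z ^ 2 / d)))
        by (field; lra).
      replace (- (2 * al - 1) * (x * p) + 1 * ((4 + 4 * al) * p + 2 * b * lmax z * (d * p)))
        with (p * (- (2 * al - 1) * x + 4 + 4 * al + 2 * lmax z * (b * d))) by ring.
      apply Rmult_le_compat_l; [lra|].
      assert (al * (x * (gap z ^ 2 / d)) <= al * 4) by (apply Rmult_le_compat_l; lra).
      assert (0 <= (1 - gap z) * ((2 * al - 1) * x)) by (apply Rmult_le_pos; [|apply
          Rmult_le_pos]; lra).
      lra. }
  assert (HJ := pow_avg_pos al z Hz). set (J := pow_avg al z) in *.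
  set (M := 2 * (4 + 4 * al) / (eta * (2 * al - 1))) in *.
  assert (HM : 4 + 4 * al = eta * (2 * al - 1) / 2 * M) by (unfold M; field; lra).
  assert (M1 : (4 + 4 * al) * J <= eta * (2 * al - 1) / 2 * lmax z * J).
  { apply Rmult_le_compat_r; [assumption|]. rewrite HM. apply Rmult_le_compat_l; [|lra].
    apply Rmult_le_pos; [apply Rmult_le_pos|]; lra. }
  assert (HL : 0 <= lmax z).
  { left; apply Rle_lt_trans with M; [|assumption]. unfold M.
    apply Rmult_le_pos; [lra | left; apply Rinv_0_lt_compat, Rmult_lt_0_compat; lra]. }
  assert (M2 : 2 * b * lmax z * pow_avg (al - 1) z <= eta * (2 * al - 1) / 2 * lmax z * J).
  { apply Rle_trans with (2 * b * lmax z * (e2 * J)).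
    - apply Rmult_le_compat_l; [|assumption]. apply Rmult_le_pos; lra.
    - replace (2 * b * lmax z * (e2 * J)) with (2 * b * e2 * (lmax z * J)) by ring.
      replace (eta * (2 * al - 1) / 2 * lmax z * J) with (2 * (b + 1) * e2 * (lmax z * J))
        by (unfold e2; field; lra).
      apply Rmult_le_compat_r; [now apply Rmult_le_pos|]. nra. }
  apply Rmult_le_reg_l with (2 * al - 1); [lra|]. lra.
Qed.
(** * Lower bounds for complex exponents *)

(** Testing all unit directions reduces a bound on the modulus of a complex integral to a real
    inequality between integrands. *)
Lemma Cmod_le_dir (w : C) (M : R) :
  (forall c s, c ^ 2 + s ^ 2 = 1 -> c * Re w + s * Im w <= M) -> Cmod w <= M.
Proof.
  intros H. assert (E := Cmod_sqr w).
  destruct (Req_dec (Cmod w) 0) as [H0 | H0].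
  - assert (Z : Re w = 0 /\ Im w = 0) by (rewrite H0 in E; split; nra).
    specialize (H 1 0). rewrite (proj1 Z), (proj2 Z) in H. rewrite H0. lra.
  - specialize (H (Re w / Cmod w) (Im w / Cmod w)).
    replace (Re w / Cmod w * Re w + Im w / Cmod w * Im w) with (Cmod w) in H.
    + apply H. apply Rmult_eq_reg_r with (Cmod w ^ 2); [|nra].
      transitivity (Re w ^ 2 + Im w ^ 2); [field; assumption | lra].
    + apply Rmult_eq_reg_r with (Cmod w); [|assumption].
      transitivity (Cmod w ^ 2); [ring|]. rewrite E. field. assumption.
Qed.

Lemma Cmod_ge_dir (w : C) (c s : R) :
  c ^ 2 + s ^ 2 = 1 -> c * Re w + s * Im w <= Cmod w.
Proof.
  intros H. assert (E := Cmod_sqr w). assert (Hp := Cmod_ge_0 w).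
  apply Rle_trans with (Rabs (c * Re w + s * Im w)); [apply Rle_abs|].
  rewrite <- (Rabs_pos_eq (Cmod w)) by assumption. apply Rsqr_le_abs_0.
  unfold Rsqr. assert (G := pow2_ge_0 (c * Im w - s * Re w)). 
  replace (Cmod w * Cmod w) with (Cmod w ^ 2 * (c ^ 2 + s ^ 2)) by (rewrite H; ring).
  rewrite E. nra.
Qed.

Lemma negpow_dir_le (b : C) (d c s : R) :
  c ^ 2 + s ^ 2 = 1 -> Rabs (c * re_negpow b d + s * im_negpow b d) <= negpow (Re b) d.
Proof.
  intros H. assert (Hp := negpow_pos (Re b) d).
  rewrite <- (Rabs_pos_eq (negpow (Re b) d)) by lra. apply Rsqr_le_abs_0.
  unfold re_negpow, im_negpow. fold (negpow (Re b) d). set (p := negpow (Re b) d) in *.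
  set (u := Im b * ln d). assert (F := cos2_sin2 u).
  replace (c * (p * cos u) + s * (- p * sin u)) with (p * (c * cos u - s * sin u)) by ring.
  rewrite Rsqr_mult. rewrite <- (Rmult_1_r (Rsqr p)) at 2.
  apply Rmult_le_compat_l; [apply Rle_0_sqr|]. unfold Rsqr.
  assert (G := pow2_ge_0 (c * sin u + s * cos u)).
  replace 1 with ((c ^ 2 + s ^ 2) * (cos u ^ 2 + sin u ^ 2)) by (rewrite H, F; ring).
  nra.
Qed.

Lemma Cmod_cpow_avg_le (b z : C) : in_disk z -> Cmod (cpow_avg b z) <= pow_avg (Re b) z.
Proof.
  intros Hz. apply Cmod_le_dir. intros c s H. unfold cpow_avg; simpl.
  rewrite <- avg_lin by auto using pos_cont_re_negpow, pos_cont_im_negpow.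
  apply avg_le; auto using pos_cont_lin, pos_cont_re_negpow, pos_cont_im_negpow,
      pos_cont_negpow.
  intros d _ _. eapply Rle_trans; [apply Rle_abs | now apply negpow_dir_le].
Qed.

(** Concentration: with respect to the weight [D^(-al)], the mean of [D / min D] is at most
    [(al - 1) / (al - 2)], which is close to one for large [al]. It follows from the recursion at
    [al - 1], whose last term costs at most [J_(al-1) / 2], and from
    [(1 + r)^2 = 2 (1 + r^2) - (1 - r)^2] with [r = |z|]. *)
Lemma pow_avg_pred_le (al : R) :
  2 < al ->
  near_circle (fun z => (al - 2) * pow_avg (al - 1) z <= (al - 1) * (1 - Cmod z) ^ 2 *
      pow_avg al z).
Proof.
  intros Hal.
  assert (H := pow_avg_pred_small (al - 1) (/ (2 * (al - 2)))).
  lapply H; [clear H; intros H | lra].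
  lapply H; [clear H; intros H | apply Rinv_0_lt_compat; lra].
  revert H. apply near_imp. intros z Hz H.
  assert (R := pow_avg_rec (al - 1) z Hz). replace (al - 1 + 1) with al in R by ring.
  assert (H0 := Cmod_ge_0 z). unfold in_disk in Hz.
  assert (J1 := pow_avg_pos (al - 1) z Hz). assert (J0 := pow_avg_pos al z Hz).
  apply (Rmult_le_compat_l (al - 2)) in H; [|lra].
  replace ((al - 2) * (/ (2 * (al - 2)) * pow_avg (al - 1) z)) with (pow_avg (al - 1) z / 2)
      in H by (field; lra).
  rewrite gap_factor in R. set (r := Cmod z) in *.
  apply Rmult_le_reg_r with ((1 + r) ^ 2); [nra|].
  replace ((al - 1) * (1 - r) ^ 2 * pow_avg al z * (1 + r) ^ 2)
    with ((al - 1) * ((1 - r) * (1 + r)) ^ 2 * pow_avg al z) by ring.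
  rewrite R. set (J := pow_avg (al - 1) z) in *.
  replace (2 * (al - 1) - 1) with (2 * al - 3) by ring.
  replace (al - 1 - 1) with (al - 2) in * by ring.
  replace (2 - (1 - r) * (1 + r)) with (1 + r ^ 2) by ring.
  assert (0 <= (al - 2) * ((1 - r) ^ 2 * J)).
  { apply Rmult_le_pos; [lra|]. apply Rmult_le_pos; [apply pow2_ge_0 | assumption]. }
  assert (0 <= r ^ 2 * J) by (apply Rmult_le_pos; [apply pow2_ge_0 | assumption]).
  nra.
Qed.

Lemma cos_ge_quad (u : R) : 1 - u ^ 2 / 2 <= cos u.
Proof.
  replace u with (2 * (u / 2)) at 2 by field. rewrite cos_2a_sin.
  assert (H : Rabs (sin (u / 2)) <= Rabs (u / 2)).
  { destruct (Rle_dec 0 (u / 2)) as [Hp | Hn].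
    - destruct (Req_dec (u / 2) 0) as [E|E]; [rewrite E, sin_0; apply Rle_refl|].
      destruct (Rle_dec (u / 2) 1) as [H1|H1].
      + rewrite !Rabs_pos_eq; [left; apply sin_lt_x; lra | lra |].
        apply sin_ge_0; [lra|]. generalize PI2_1. intros; unfold Rdiv in *; lra.
      + rewrite (Rabs_pos_eq (u / 2)) by lra. apply Rle_trans with 1; [|lra].
        apply Rabs_le. apply SIN_bound.
    - rewrite <- (Rabs_Ropp (u / 2)), <- Rabs_Ropp, <- sin_neg.
      destruct (Rle_dec (- (u / 2)) 1) as [H1|H1].
      + rewrite !Rabs_pos_eq; [left; apply sin_lt_x; lra | lra |].
        apply sin_ge_0; [lra|]. generalize PI2_1. intros; unfold Rdiv in *; lra.
      + rewrite (Rabs_pos_eq (- (u / 2))) by lra. apply Rle_trans with 1; [|lra].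
        apply Rabs_le. apply SIN_bound. }
  apply Rsqr_le_abs_1 in H. unfold Rsqr in H. nra.
Qed.

(** Square [sqrt x >= 1 + ln x / 2]. With [x = D / min D] this makes the quadratic bound on the
    cosine linear in [D], so that it integrates to [J_al] and [J_(al-1)]. *)
Lemma ln_sqr_le (x : R) : 1 <= x -> ln x ^ 2 <= 4 * (x - 1).
Proof.
  intros Hx. assert (H := exp_ineq1_le (ln x / 2)).
  assert (H0 : 0 <= ln x) by (rewrite <- ln_1; apply ln_le; lra).
  assert (E : exp (ln x / 2) * exp (ln x / 2) = x).
  { rewrite <- exp_plus. replace (ln x / 2 + ln x / 2) with (ln x) by field. apply exp_ln;
      lra. }
  nra.
Qed.

Definition nondegenerate (a : C) : Prop :=
  exists c, 0 < c /\ near_circle (fun z => c * pow_avg (Re a) z <= Cmod (cpow_avg a z)).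

(* [D ^ (- a)] is rotated so as to be positive where [D] is smallest; for large
   [Re a] the integral is concentrated there. *)
Lemma nondegenerate_large (a : C) : 3 + 4 * Im a ^ 2 <= Re a -> nondegenerate a.
Proof.
  intros Ha. set (al := Re a) in *. set (tau := Im a) in *.
  assert (Ht := pow2_ge_0 tau).
  exists (1/2). split; [lra|].
  assert (H := pow_avg_pred_le al). lapply H; [clear H; intros H | lra].
  revert H. apply near_imp. intros z Hz H.
  assert (Hr := Cmod_ge_0 z). assert (Q0 : 0 < (1 - Cmod z) ^ 2) by (unfold in_disk in Hz; nra).
  set (D0 := (1 - Cmod z) ^ 2) in *.
  set (c := cos (tau * ln D0)). set (s := - sin (tau * ln D0)).
  assert (E1 : c ^ 2 + s ^ 2 = 1) by (generalize (cos2_sin2 (tau * ln D0)); unfold c, s; nra).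
  apply Rle_trans with (2 := Cmod_ge_dir (cpow_avg a z) c s E1).
  unfold cpow_avg; simpl.
  rewrite <- avg_lin by auto using pos_cont_re_negpow, pos_cont_im_negpow.
  (* Pointwise, [cos (tau log (D / D0)) >= 1 - 2 tau^2 (D / D0 - 1)] by [cos_ge_quad] and
     [ln_sqr_le]. *)
  apply Rle_trans with (avg z (fun d => (1 + 2 * tau ^ 2) * negpow al d + - (2 * tau ^ 2 /
      D0) * negpow (al - 1) d)).
  - rewrite avg_lin by auto using pos_cont_negpow. fold (pow_avg al z) (pow_avg (al - 1) z).
    assert (J0 := pow_avg_pos al z Hz). assert (J1 := pow_avg_pos (al - 1) z Hz).
    set (J := pow_avg al z) in *. set (J' := pow_avg (al - 1) z) in *.
    assert (K : 2 * tau ^ 2 / D0 * J' <= 2 * tau ^ 2 * ((al - 1) / (al - 2)) * J).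
    { apply Rmult_le_reg_r with (D0 * (al - 2)); [apply Rmult_lt_0_compat; lra|].
      replace (2 * tau ^ 2 / D0 * J' * (D0 * (al - 2))) with (2 * tau ^ 2 * ((al - 2) * J'))
          by (field; lra).
      replace (2 * tau ^ 2 * ((al - 1) / (al - 2)) * J * (D0 * (al - 2)))
        with (2 * tau ^ 2 * ((al - 1) * D0 * J)) by (field; lra).
      apply Rmult_le_compat_l; lra. }
    (* Equivalent to [4 tau^2 <= al - 2]: this is where the threshold on [Re a] comes from. *)
    assert (K2 : 2 * tau ^ 2 * ((al - 1) / (al - 2)) <= 2 * tau ^ 2 + 1/2).
    { apply Rmult_le_reg_r with (al - 2); [lra|].
      replace (2 * tau ^ 2 * ((al - 1) / (al - 2)) * (al - 2)) with (2 * tau ^ 2 * (al - 1))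
          by (field; lra).
      lra. }
    apply (Rmult_le_compat_r J) in K2; [|assumption]. fold al; fold J. lra.
  - apply avg_le; auto using pos_cont_lin, pos_cont_re_negpow, pos_cont_im_negpow,
      pos_cont_negpow.
    intros d Hd Hd0. fold D0 in Hd. rewrite negpow_pred by assumption.
    unfold re_negpow, im_negpow. fold al tau (negpow al d). assert (Hp := negpow_pos al d).
    set (p := negpow al d) in *.
    transitivity (p * (1 - (2 * tau ^ 2) * (d / D0 - 1))); [right; field; lra|].
    replace (c * (p * cos (tau * ln d)) + s * (- p * sin (tau * ln d)))
      with (p * cos (tau * logdist z d)).
    + apply Rmult_le_compat_l; [lra|].
      refine (Rle_trans _ _ _ _ (cos_ge_quad _)).
      assert (1 <= d / D0).
      { apply Rmult_le_reg_r with D0; [assumption|]. unfold Rdiv.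
        rewrite Rmult_assoc, Rinv_l by lra. lra. }
      assert (L2 := ln_sqr_le (d / D0) ltac:(assumption)).
      fold D0 (logdist z d) in L2. rewrite Rpow_mult_distr.
      apply (Rmult_le_compat_l (tau ^ 2)) in L2; [|assumption]. unfold logdist; fold D0. lra.
    + unfold logdist. fold D0. rewrite ln_div by assumption.
      rewrite Rmult_minus_distr_l, cos_minus. unfold c, s. ring.
Qed.

(** The complex recursion bounds [|2a - 1| (2 - gap) |J_a|] below by [|a| gap^2 |J_(a+1)|] minus a
    term in [J_(a-1)]. After the hypothesis on [a + 1] and [|a| >= al], the real recursion turns
    [al gap^2 J_(al+1)] back into [(2 al - 1) (2 - gap) J_al], positive since [al > 1/2]. All terms
    of exponent [al - 1] are negligible. *)
Lemma nondegenerate_pred (a : C) : 1 / 2 < Re a -> nondegenerate (a + 1) -> nondegenerate a.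
Proof.
  intros Ha [c [Hc H]]. set (al := Re a) in *.
  replace (Re (a + 1)) with (al + 1) in H by reflexivity.
  set (b := Rabs (al - 1)). assert (Hb : 0 <= b) by apply Rabs_pos.
  set (q := Cmod (a - 1)). assert (Hq : 0 <= q) by apply Cmod_ge_0.
  (* Makes the error terms at most half of the main term [c (2 al - 1) J_al]; the [+ 1] keeps the
     denominator positive when [a = 1]. The witness below loses another factor 2 to
     [2 - gap z <= 2]. *)
  set (eta := c * (2 * al - 1) / 2 / (c * b + q + 1)).
  assert (H0 : 0 < c * b + q + 1) by nra.
  assert (He : 0 < eta) by (unfold eta; apply Rdiv_lt_0_compat; nra).
  set (N := Cmod (2 * a - 1)).
  assert (HN : 0 < N).
  { apply Cmod_gt_0. intros E. apply (f_equal Re) in E. unfold Re in *. simpl in E. unfold al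
      in Ha. lra. }
  exists (c * (2 * al - 1) / (4 * N)). split.
  { apply Rdiv_lt_0_compat; nra. }
  assert (H2 := near_and _ _ H (pow_avg_pred_small al eta (Rlt_le _ _ Ha) He)).
  revert H2. apply near_imp. intros z Hz [H1 H2]. fold al.
  assert (G := gap_bounds z Hz).
  assert (RC := cpow_avg_rec a z Hz). assert (RR := pow_avg_rec al z Hz).
  assert (T : Cmod (a * RtoC (gap z ^ 2) * cpow_avg (a + 1) z)
    <= Cmod ((2 * a - 1) * RtoC (2 - gap z) * cpow_avg a z) + Cmod ((a - 1) * cpow_avg (a -
        1) z)).
  { rewrite RC. unfold Cminus at 1. rewrite <- (Cmod_opp ((a - 1) * cpow_avg (a - 1) z)).
      apply Cmod_triangle. }
  rewrite !Cmod_mult, !Cmod_R in T. fold N q in T.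
  rewrite (Rabs_pos_eq (gap z ^ 2)), (Rabs_pos_eq (2 - gap z)) in T by nra.
  assert (T2 := Cmod_cpow_avg_le (a - 1) z Hz).
  replace (Re (a - 1)) with (al - 1) in T2 by reflexivity.
  assert (J0 := pow_avg_pos al z Hz). assert (J1 := pow_avg_pos (al - 1) z Hz). assert (J2 :=
      pow_avg_pos (al + 1) z Hz).
  assert (HA : al <= Cmod a) by (eapply Rle_trans; [apply Rle_abs | apply re_le_Cmod]).
  set (X := Cmod (cpow_avg a z)) in *. assert (HX : 0 <= X) by apply Cmod_ge_0.
  set (Y := Cmod (cpow_avg (a - 1) z)) in *. set (W := Cmod (cpow_avg (a + 1) z)) in *.
  set (J := pow_avg al z) in *. set (Jm := pow_avg (al - 1) z) in *. set (Jp := pow_avg (al +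
      1) z) in *.
  assert (T3 : c * (al * gap z ^ 2 * Jp) <= Cmod a * gap z ^ 2 * W).
  { apply Rle_trans with (al * gap z ^ 2 * (c * Jp)); [right; ring|].
    assert (0 <= gap z ^ 2) by nra.
    apply Rmult_le_compat; [apply Rmult_le_pos; lra | apply Rmult_le_pos; lra | apply
        Rmult_le_compat_r; lra | lra]. }
  rewrite RR in T3.
  assert (T4 : (al - 1) * Jm <= b * (eta * J)).
  { apply Rle_trans with (b * Jm).
    - apply Rmult_le_compat_r; [assumption | apply Rle_abs].
    - now apply Rmult_le_compat_l. }
  assert (T5 : q * Y <= q * (eta * J)) by (apply Rmult_le_compat_l; lra).
  assert (T6 : (2 * al - 1) * J <= (2 * al - 1) * (2 - gap z) * J).
  { apply Rmult_le_compat_r; [assumption|]. nra. }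
  assert (T7 : N * (2 - gap z) * X <= N * 2 * X).
  { apply Rmult_le_compat_r; [assumption|]. nra. }
  assert (T8 : c * ((2 * al - 1) * J - b * (eta * J))
     <= c * ((2 * al - 1) * (2 - gap z) * J - (al - 1) * Jm)).
  { apply Rmult_le_compat_l; lra. }
  assert (T9 : c * (b * (eta * J)) + q * (eta * J) <= c * (2 * al - 1) / 2 * J).
  { apply Rle_trans with (((c * b + q + 1) * eta) * J).
    - assert (0 <= eta * J) by (apply Rmult_le_pos; lra). lra.
    - apply Req_le. unfold eta. field. lra. }
  apply Rmult_le_reg_l with (2 * N); [lra|].
  replace (2 * N * (c * (2 * al - 1) / (4 * N) * J)) with (c * (2 * al - 1) / 2 * J) by
      (field; lra).
  lra.
Qed.

(** Adding one to [a] does not change [Im a], so the threshold of [nondegenerate_large] is reached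
    after finitely many unit shifts. *)
Lemma nondegenerate_all (a : C) : 1 / 2 < Re a -> nondegenerate a.
Proof.
  intros Ha. destruct (INR_unbounded (3 + 4 * Im a ^ 2)) as [n Hn].
  assert (H : 3 + 4 * Im a ^ 2 <= Re a + INR n) by lra. clear Hn.
  revert a Ha H. induction n as [|n IH]; intros a Ha H.
  - apply nondegenerate_large. simpl in H. lra.
  - apply nondegenerate_pred; [assumption|]. apply IH; unfold Re, Im in *; simpl.
    + lra.
    + rewrite Rplus_0_r. rewrite S_INR in H. lra.
Qed.

Definition cmoment (m : nat) (a z : C) : C :=
  (avg z (fun d => ln (gap z / d) ^ m * re_negpow a d),
   avg z (fun d => ln (gap z / d) ^ m * im_negpow a d)).

(** The mean value estimate for the power [m], multiplied by [l] so that no exponent [m - 1]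
    occurs. *)
Lemma pow_diff_le (m : nat) (y l : R) :
  Rabs y <= l -> Rabs (y ^ m - l ^ m) * l <= INR m * l ^ m * (l - y).
Proof.
  intros H. assert (Hl : 0 <= l) by (generalize (Rabs_pos y); lra).
  assert (Hy := Rle_abs y).
  induction m as [|m IH].
  - simpl. rewrite Rminus_diag, Rabs_R0. lra.
  - replace (y ^ S m - l ^ S m) with (y * (y ^ m - l ^ m) + - (l ^ m * (l - y))) by (simpl;
      ring).
    assert (P := pow_le l m Hl).
    apply Rle_trans with ((Rabs y * Rabs (y ^ m - l ^ m) + l ^ m * (l - y)) * l).
    + apply Rmult_le_compat_r; [assumption|].
      eapply Rle_trans; [apply Rabs_triang|]. rewrite Rabs_mult, Rabs_Ropp.
      rewrite (Rabs_pos_eq (l ^ m * (l - y))); [lra|]. apply Rmult_le_pos; lra.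
    + assert (Q := Rabs_pos (y ^ m - l ^ m)).
      assert (Rabs y * (Rabs (y ^ m - l ^ m) * l) <= l * (INR m * l ^ m * (l - y))).
      { apply Rmult_le_compat; [apply Rabs_pos | nra | lra | lra]. }
      rewrite S_INR. simpl. lra.
Qed.

(** The moment has the order of its trivial upper bound: neither the oscillation nor the signs of
    [log P] cause cancellation. *)
Definition moment_nondegenerate (m : nat) (a : C) : Prop :=
  exists c, 0 < c /\
    near_circle (fun z => c * lmax z ^ m * pow_avg (Re a) z <= Cmod (cmoment m a z)).

(* Here [pow_avg (1/2)] is itself of order [lmax], so that the extra factor [lmax]
   in [moment_half_lower] is absorbed. *)
Lemma moment_nondegenerate_half (k : nat) :
  moment_nondegenerate (2 * k) (RtoC (1/2)).
Proof.
  destruct (moment_half_lower k) as [c [Hc H]].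
  destruct pow_avg_half_upper as [u [Hu H']].
  exists (c / u). split; [now apply Rdiv_lt_0_compat|].
  assert (H2 := near_and _ _ H (near_and _ _ H' (near_lmax 0))).
  revert H2. apply near_imp. intros z Hz [H1 [H2 H3]].
  replace (Re (RtoC (1/2))) with (1/2) by reflexivity.
  apply Rle_trans with (moment (2 * k) (1/2) z).
  - apply Rle_trans with (2 := H1). rewrite <- tech_pow_Rmult.
    apply Rle_trans with (c / u * lmax z ^ (2 * k) * (u * lmax z)).
    + apply Rmult_le_compat_l; [|assumption]. apply Rmult_le_pos; [|apply pow_le; lra].
      left; now apply Rdiv_lt_0_compat.
    + apply Req_le. field. lra.
  - assert (D := Cmod_ge_dir (cmoment (2 * k) (RtoC (1/2)) z) 1 0 ltac:(ring)).
    apply Rle_trans with (2 := D). rewrite Rmult_0_l, Rplus_0_r, Rmult_1_l.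
    apply Req_le. unfold cmoment; simpl Re. apply avg_ext; [assumption|]. intros d Hd.
    unfold re_negpow, negpow. simpl. rewrite Rmult_0_l, cos_0. ring.
Qed.

(** Replacing [(log P)^m] by [L^m] costs at most [m L^(m-1)] times the average of
    [(L - log P) D^(-al)], that is [m eta L^m J_al]. The choice of [eta] keeps this below half of
    the lower bound for [L^m J_a]. *)
Lemma moment_nondegenerate_gt (m : nat) (a : C) :
  1 / 2 < Re a -> moment_nondegenerate m a.
Proof.
  intros Ha. destruct (nondegenerate_all a Ha) as [c [Hc H]].
  exists (c / 2). split; [lra|].
  set (eta := c / 2 / (INR m + 1)). assert (Hm := pos_INR m).
  assert (He : 0 < eta) by (unfold eta; apply Rdiv_lt_0_compat; lra).
  assert (H2 := near_and _ _ H (near_and _ _ (avg_logdist_small (Re a) eta Ha He) (near_lmax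
      0))).
  revert H2. apply near_imp. intros z Hz [H1 [H2 H3]].
  set (l := lmax z) in *. set (J := pow_avg (Re a) z) in *.
  assert (J0 : 0 <= J) by now apply pow_avg_pos.
  assert (P := pow_lt l m H3).
  assert (T : Cmod (RtoC (l ^ m) * cpow_avg a z) <= Cmod (cmoment m a z) + Cmod (RtoC (l ^ m)
      * cpow_avg a z - cmoment m a z)).
  { replace (RtoC (l ^ m) * cpow_avg a z)%C with (cmoment m a z + (RtoC (l ^ m) * cpow_avg a
      z - cmoment m a z))%C at 1 by ring.
    apply Cmod_triangle. }
  rewrite Cmod_mult, Cmod_R, (Rabs_pos_eq (l ^ m)) in T by lra.
  assert (K : Cmod (RtoC (l ^ m) * cpow_avg a z - cmoment m a z) <= INR m * l ^ m / l * avg z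
      (fun d => logdist z d * negpow (Re a) d)).
  { assert (PL := pos_cont_logdist z _ Hz (pos_cont_negpow (Re a))).
    assert (C1 := pos_cont_lnpow m z _ Hz (pos_cont_re_negpow a)).
    assert (C2 := pos_cont_lnpow m z _ Hz (pos_cont_im_negpow a)).
    assert (C3 := pos_cont_re_negpow a). assert (C4 := pos_cont_im_negpow a).
    apply Cmod_le_dir. intros p q Hpq. unfold cpow_avg, cmoment; simpl.
    (* The zero summand only gives the expression the shape that [avg_lin] rewrites. *)
    transitivity (1 * (l ^ m * (p * avg z (re_negpow a) + q * avg z (im_negpow a)) + 0 * avg
        z (re_negpow a)) +
      -1 * (p * avg z (fun d => ln (gap z / d) ^ m * re_negpow a d) + q * avg z (fun d => ln
          (gap z / d) ^ m * im_negpow a d))).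
    { right; ring. }
    rewrite <- !avg_lin, <- avg_scal by auto using pos_cont_lin.
    apply avg_le; [assumption | auto using pos_cont_lin | | ].
    { intros d Hd. apply (continuous_scal_r (K := R_AbsRing) (V := R_NormedModule)). now
        apply PL. }
    intros d Hd Hd0.
    assert (Hy := ln_quot_le_lmax z d Hz Hd). fold l in Hy.
    assert (Hdir := negpow_dir_le a d p q Hpq).
    rewrite logdist_eq by assumption. fold l. set (y := ln (gap z / d)) in *.
    assert (D := pow_diff_le m y l ltac:(apply Rabs_le; lra)).
    transitivity ((l ^ m - y ^ m) * (p * re_negpow a d + q * im_negpow a d)); [right; ring|].
    eapply Rle_trans; [apply Rle_abs|]. rewrite Rabs_mult, Rabs_minus_sym.
    replace (INR m * l ^ m / l * ((l - y) * negpow (Re a) d))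
      with (INR m * l ^ m * (l - y) / l * negpow (Re a) d) by (field; lra).
    apply Rmult_le_compat; try apply Rabs_pos; [|assumption].
    apply Rmult_le_reg_r with l; [assumption|].
    replace (INR m * l ^ m * (l - y) / l * l) with (INR m * l ^ m * (l - y)) by (field; lra).
    exact D. }
  assert (K2 : INR m * l ^ m / l * avg z (fun d => logdist z d * negpow (Re a) d) <= c / 2 *
      (l ^ m * J)).
  { apply Rle_trans with (INR m * l ^ m / l * (eta * l * J)).
    - apply Rmult_le_compat_l; [|assumption].
      apply Rmult_le_pos; [apply Rmult_le_pos; lra | left; now apply Rinv_0_lt_compat].
    - replace (INR m * l ^ m / l * (eta * l * J)) with (INR m * eta * (l ^ m * J)) by (field;
        lra).
      apply Rmult_le_compat_r; [apply Rmult_le_pos; lra|].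
      replace (c / 2) with ((INR m + 1) * eta) by (unfold eta; field; lra). nra. }
  assert (K3 : l ^ m * (c * J) <= l ^ m * Cmod (cpow_avg a z)) by (apply Rmult_le_compat_l;
      lra).
  lra.
Qed.
(** * Kernels and their derivatives *)

(** Components are kept apart so that the real calculus rules and [auto_derive] apply to each;
    [continuous_of_components] and [ex_derive_of_pair] lead back to complex-valued maps. *)
Definition cont_pair {T : UniformSpace} (f : T -> C) (x : T) : Prop :=
  continuous (fun y => fst (f y)) x /\ continuous (fun y => snd (f y)) x.

Definition derive_pair (f : R -> C) (s : R) (l : C) : Prop :=
  is_derive (fun u => fst (f u)) s (fst l) /\ is_derive (fun u => snd (f u)) s (snd l).

(* Syntax for integral kernels, closed under differentiation in [z]: [KK m] stands
   for [(log P)^m P^a], [KT h] for a function of the boundary angle alone, [KinvD]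
   for [1 / |xi - z|^2] and [KinvE] for [1 / (1 - |z|^2)]. *)
Inductive kexpr : Type :=
| KX | KY | KinvD | KinvE
| KT (h : R -> C) (hc : forall t, cont_pair h t)
| KK (m : nat)
| KAdd (e1 e2 : kexpr)
| KMul (e1 e2 : kexpr).

Fixpoint keval (a : C) (e : kexpr) (z : C) (t : R) : C :=
  match e with
  | KX => RtoC (Re z)
  | KY => RtoC (Im z)
  | KinvD => RtoC (/ dist2 z t)
  | KinvE => RtoC (/ gap z)
  | KT h _ => h t
  | KK m => (RtoC (ln (gap z / dist2 z t) ^ m) * Rcpow (gap z / dist2 z t) a)%C
  | KAdd e1 e2 => (keval a e1 z t + keval a e2 z t)%C
  | KMul e1 e2 => (keval a e1 z t * keval a e2 z t)%C
  end.

Lemma cont_const (c : C) (t : R) : cont_pair (fun _ : R => c) t.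
Proof. split; apply continuous_const. Qed.

Lemma cont_RtoC {T : UniformSpace} (f : T -> R) (x : T) :
  continuous f x -> cont_pair (fun y => RtoC (f y)) x.
Proof. intros H; split; [exact H | apply continuous_const]. Qed.

Lemma cont_cos (t : R) : cont_pair (fun t => RtoC (cos t)) t.
Proof.
  apply cont_RtoC, (ex_derive_continuous (V := R_NormedModule)). auto_derive; exact I.
Qed.

Lemma cont_sin (t : R) : cont_pair (fun t => RtoC (sin t)) t.
Proof.
  apply cont_RtoC, (ex_derive_continuous (V := R_NormedModule)). auto_derive; exact I.
Qed.

Definition Kcst (c : C) : kexpr := KT (fun _ => c) (cont_const c).
Definition Kcos : kexpr := KT (fun t => RtoC (cos t)) cont_cos.
Definition Ksin : kexpr := KT (fun t => RtoC (sin t)) cont_sin.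

(* Directional derivatives along [(p, q)] of [|z|^2], of [dist2] and of [log P]. *)
Definition Knorm2' (p q : R) : kexpr :=
  KAdd (KMul (Kcst (RtoC (2 * p))) KX) (KMul (Kcst (RtoC (2 * q))) KY).
Definition KD' (p q : R) : kexpr :=
  KAdd (Knorm2' p q)
    (KAdd (KMul (Kcst (RtoC (- 2 * p))) Kcos) (KMul (Kcst (RtoC (- 2 * q))) Ksin)).
Definition Klog' (p q : R) : kexpr :=
  KMul (Kcst (RtoC (-1))) (KAdd (KMul (Knorm2' p q) KinvE) (KMul (KD' p q) KinvD)).

(** In the case [KK 0] the truncated [m - 1] is harmless, its coefficient [INR m] being zero. *)
Fixpoint kder (a : C) (p q : R) (e : kexpr) : kexpr :=
  match e with
  | KX => Kcst (RtoC p)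
  | KY => Kcst (RtoC q)
  | KinvD => KMul (Kcst (RtoC (-1))) (KMul (KMul KinvD KinvD) (KD' p q))
  | KinvE => KMul (KMul KinvE KinvE) (Knorm2' p q)
  | KT _ _ => Kcst (RtoC 0)
  | KK m => KMul (Klog' p q) (KAdd (KMul (Kcst (RtoC (INR m))) (KK (m - 1))) (KMul (Kcst a)
      (KK m)))
  | KAdd e1 e2 => KAdd (kder a p q e1) (kder a p q e2)
  | KMul e1 e2 => KAdd (KMul (kder a p q e1) e2) (KMul e1 (kder a p q e2))
  end.

Lemma cont_plus {T : UniformSpace} (f g : T -> C) (x : T) :
  cont_pair f x -> cont_pair g x -> cont_pair (fun y => f y + g y)%C x.
Proof.
  intros [F1 F2] [G1 G2]; split; simpl; apply (continuous_plus (V := R_NormedModule));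
      assumption.
Qed.

Lemma cont_mult {T : UniformSpace} (f g : T -> C) (x : T) :
  cont_pair f x -> cont_pair g x -> cont_pair (fun y => f y * g y)%C x.
Proof.
  intros [F1 F2] [G1 G2]; split; simpl.
  - apply (continuous_minus (V := R_NormedModule)); apply (continuous_mult (K := R_AbsRing));
      assumption.
  - apply (continuous_plus (V := R_NormedModule)); apply (continuous_mult (K := R_AbsRing));
      assumption.
Qed.

Lemma derive_plus (f g : R -> C) (s : R) (lf lg : C) :
  derive_pair f s lf -> derive_pair g s lg -> derive_pair (fun u => f u + g u)%C s (lf + lg)%C.
Proof.
  intros [F1 F2] [G1 G2]; split; simpl; apply (is_derive_plus (V := R_NormedModule));
      assumption.
Qed.

Lemma derive_mult (f g : R -> C) (s : R) (lf lg : C) :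
  derive_pair f s lf -> derive_pair g s lg ->
  derive_pair (fun u => f u * g u)%C s (lf * g s + f s * lg)%C.
Proof.
  assert (M : forall (u v : R -> R) du dv, is_derive u s du -> is_derive v s dv ->
    is_derive (fun x => u x * v x) s (du * v s + u s * dv)).
  { intros u v du dv Hu Hv. apply (is_derive_mult (K := R_AbsRing) u v); auto. intros; apply
      Rmult_comm. }
  intros [F1 F2] [G1 G2]; split; simpl.
  - evar_last; [apply (is_derive_minus (V := R_NormedModule)); apply M; eassumption |].
    unfold minus, plus, opp; simpl. ring.
  - evar_last; [apply (is_derive_plus (V := R_NormedModule)); apply M; eassumption |].
    unfold plus; simpl. ring.
Qed.

Lemma derive_RtoC (f : R -> R) (s l : R) :
  is_derive f s l -> derive_pair (fun u => RtoC (f u)) s (RtoC l).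
Proof. intros H; split; [exact H | simpl; apply (is_derive_const (V := R_NormedModule))]. Qed.

Lemma derive_cst (c : C) (s : R) : derive_pair (fun _ => c) s (RtoC 0).
Proof. split; simpl; apply (is_derive_const (V := R_NormedModule)). Qed.

Lemma in_disk_gap (z : C) : in_disk z <-> 0 < gap z.
Proof.
  split; [intros H; now apply gap_bounds |].
  unfold in_disk, gap. generalize (Cmod_ge_0 z). nra.
Qed.

(** The components of [y^m e^(a y)]; at [y = log P] this is the kernel [KK m]. *)
Definition powlog (m : nat) (a : C) (y : R) : C :=
  (y ^ m * (exp (Re a * y) * cos (Im a * y)), y ^ m * (exp (Re a * y) * sin (Im a * y))).

Lemma powlog_spec (m : nat) (a : C) (x : R) :
  (RtoC (ln x ^ m) * Rcpow x a)%C = powlog m a (ln x).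
Proof.
  unfold powlog, Rcpow, Cexp, Re, Im. apply injective_projections; simpl.
  - rewrite !Rmult_0_r, Rminus_0_r, Rplus_0_l. ring.
  - rewrite !Rmult_0_r, Rminus_0_r, Rplus_0_l. ring.
Qed.

Lemma is_derive_powlog (m : nat) (a : C) (y : R) :
  derive_pair (powlog m a) y (RtoC (INR m) * powlog (m - 1) a y + a * powlog m a y)%C.
Proof.
  assert (E : Nat.pred m = (m - 1)%nat) by lia.
  split; unfold powlog; simpl.
  - auto_derive; [exact I|]. rewrite E. unfold Re, Im. ring.
  - auto_derive; [exact I|]. rewrite E. unfold Re, Im. ring.
Qed.

(** Stated along a curve with velocity [(p, q)], so that both partial derivatives are instances. *)
Lemma keval_derive (a : C) (e : kexpr) (t : R) (X Y : R -> R) (p q s : R) :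
  is_derive X s p -> is_derive Y s q -> in_disk (X s, Y s) ->
  derive_pair (fun u => keval a e (X u, Y u) t) s (keval a (kder a p q e) (X s, Y s) t).
Proof.
  intros HX HY Hz.
  assert (G : 0 < gap (X s, Y s)) by now apply in_disk_gap.
  assert (D : 0 < dist2 (X s, Y s) t) by now apply dist2_pos.
  assert (EX : ex_derive X s) by now exists p.
  assert (EY : ex_derive Y s) by now exists q.
  assert (DX : Derive (fun u => X u) s = p) by now apply is_derive_unique.
  assert (DY : Derive (fun u => Y u) s = q) by now apply is_derive_unique.
  assert (dG : is_derive (fun u => gap (X u, Y u)) s (- (2 * p * X s + 2 * q * Y s))).
  { apply (is_derive_ext (fun u => 1 - (X u ^ 2 + Y u ^ 2))).
    { intros u. unfold gap. rewrite Cmod_sqr. reflexivity. }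
    auto_derive; [auto | rewrite DX, DY; ring]. }
  assert (dD : is_derive (fun u => dist2 (X u, Y u) t) s
    (2 * p * X s + 2 * q * Y s + (-2 * p * cos t + -2 * q * sin t))).
  { apply (is_derive_ext (fun u => 1 + (X u ^ 2 + Y u ^ 2) - 2 * (X u * cos t + Y u * sin t))).
    { intros u. unfold dist2. rewrite Cmod_sqr. reflexivity. }
    auto_derive; [auto | rewrite DX, DY; ring]. }
  induction e as [ | | | | h hc | m | e1 IH1 e2 IH2 | e1 IH1 e2 IH2]; simpl.
  - now apply derive_RtoC.
  - now apply derive_RtoC.
  - replace (_ * _)%C with (RtoC (- (2 * p * X s + 2 * q * Y s + (-2 * p * cos t + -2 * q *
      sin t)) / dist2 (X s, Y s) t ^ 2)).
    + apply derive_RtoC. apply (is_derive_inv (fun u => dist2 (X u, Y u) t)); [exact dD | lra].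
    + rewrite <- ?RtoC_mult, <- ?RtoC_plus, <- ?RtoC_mult, <- ?RtoC_plus, <- ?RtoC_mult.
        f_equal. field. lra.
  - replace (_ * _)%C with (RtoC (- - (2 * p * X s + 2 * q * Y s) / gap (X s, Y s) ^ 2)).
    + apply derive_RtoC. apply (is_derive_inv (fun u => gap (X u, Y u))); [exact dG | lra].
    + rewrite <- ?RtoC_mult, <- ?RtoC_plus, <- ?RtoC_mult, <- ?RtoC_plus, <- ?RtoC_mult.
        f_equal. field. lra.
  - apply derive_cst.
  - set (U := (-1) * ((2 * p * X s + 2 * q * Y s) * / gap (X s, Y s)
       + (2 * p * X s + 2 * q * Y s + (-2 * p * cos t + -2 * q * sin t)) * / dist2 (X s, Y s)
           t)).
    assert (dL : is_derive (fun u => ln (gap (X u, Y u) / dist2 (X u, Y u) t)) s U).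
    { set (gu := fun u => gap (X u, Y u)) in *. set (du := fun u => dist2 (X u, Y u) t) in *.
      change (gap (X s, Y s)) with (gu s) in *. change (dist2 (X s, Y s) t) with (du s) in *.
      change (is_derive (fun u => ln (gu u / du u)) s U).
      assert (Eg : ex_derive gu s) by (eexists; exact dG).
      assert (Ed : ex_derive du s) by (eexists; exact dD).
      assert (dG' : Derive (fun u : R => gu u) s = - (2 * p * X s + 2 * q * Y s))
        by (apply is_derive_unique; exact dG).
      assert (dD' : Derive (fun u : R => du u) s
          = 2 * p * X s + 2 * q * Y s + (-2 * p * cos t + -2 * q * sin t))
        by (apply is_derive_unique; exact dD).
      auto_derive.
      - repeat split; auto; [lra | apply Rmult_lt_0_compat; [lra | now apply Rinv_0_lt_compat]].
      - rewrite dG', dD'. unfold U. field. lra. }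
    rewrite !powlog_spec.
    match goal with |- derive_pair _ _ (?A * ?B) => replace A with (RtoC U) end.
    2:{ unfold U. rewrite <- ?RtoC_mult, <- ?RtoC_plus, <- ?RtoC_mult, <- ?RtoC_plus, <-
        ?RtoC_mult, <- ?RtoC_plus, <- ?RtoC_mult. reflexivity. }
    destruct (is_derive_powlog m a (ln (gap (X s, Y s) / dist2 (X s, Y s) t))) as [P1 P2].
    split.
    + apply (is_derive_ext (fun u => fst (powlog m a (ln (gap (X u, Y u) / dist2 (X u, Y u)
        t))))).
      { intros u. now rewrite powlog_spec. }
      evar_last; [apply (is_derive_comp (fun y => fst (powlog m a y))); [exact P1 | exact dL]
          |].
      unfold scal; simpl; unfold mult; simpl. ring.
    + apply (is_derive_ext (fun u => snd (powlog m a (ln (gap (X u, Y u) / dist2 (X u, Y u)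
        t))))).
      { intros u. now rewrite powlog_spec. }
      evar_last; [apply (is_derive_comp (fun y => snd (powlog m a y))); [exact P2 | exact dL]
          |].
      unfold scal; simpl; unfold mult; simpl. ring.
  - now apply derive_plus.
  - now apply (derive_mult (fun u => keval a e1 (X u, Y u) t) (fun u => keval a e2 (X u, Y u)
      t)).
Qed.

Lemma continuous_gap (z : C) : continuous gap z.
Proof.
  apply (continuous_ext (fun w : C => 1 - (fst w * fst w + snd w * snd w))).
  { intros w. unfold gap. rewrite Cmod_sqr. unfold Re, Im. simpl. ring. }
  apply (continuous_minus (V := R_NormedModule)); [apply continuous_const|].
  apply (continuous_plus (V := R_NormedModule)); apply (continuous_mult (K := R_AbsRing));
    first [apply continuous_fst | apply continuous_snd].
Qed.

Lemma continuous_dist2 (z : C) (t : R) :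
  continuous (fun w : C * R => dist2 (fst w) (snd w)) (z, t).
Proof.
  assert (C1 : continuous (fun w : C * R => fst (fst w)) (z, t)).
  { apply (continuous_comp (fun w : C * R => fst w) fst); [apply continuous_fst | apply
      continuous_fst]. }
  assert (C2 : continuous (fun w : C * R => snd (fst w)) (z, t)).
  { apply (continuous_comp (fun w : C * R => fst w) snd); [apply continuous_fst | apply
      continuous_snd]. }
  assert (C3 : continuous (fun w : C * R => snd w) (z, t)) by apply continuous_snd.
  apply (continuous_ext (fun w : C * R => (1 + (fst (fst w) * fst (fst w) + snd (fst w) * snd
      (fst w)))
     - 2 * (fst (fst w) * cos (snd w) + snd (fst w) * sin (snd w)))).
  { intros w. unfold dist2. rewrite Cmod_sqr. unfold Re, Im. simpl. ring. }
  assert (C4 : continuous (fun w : C * R => cos (snd w)) (z, t)).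
  { apply (continuous_comp (fun w : C * R => snd w) cos); [exact C3 |].
    apply (ex_derive_continuous (V := R_NormedModule)). auto_derive; exact I. }
  assert (C5 : continuous (fun w : C * R => sin (snd w)) (z, t)).
  { apply (continuous_comp (fun w : C * R => snd w) sin); [exact C3 |].
    apply (ex_derive_continuous (V := R_NormedModule)). auto_derive; exact I. }
  apply (continuous_minus (V := R_NormedModule)).
  - apply (continuous_plus (V := R_NormedModule)); [apply continuous_const|].
    apply (continuous_plus (V := R_NormedModule)); apply (continuous_mult (K := R_AbsRing));
        assumption.
  - apply (continuous_mult (K := R_AbsRing)); [apply continuous_const|].
    apply (continuous_plus (V := R_NormedModule)); apply (continuous_mult (K := R_AbsRing));
        assumption.
Qed.

Lemma keval_cont (a : C) (e : kexpr) (z : C) (t : R) :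
  in_disk z -> cont_pair (fun w : C * R => keval a e (fst w) (snd w)) (z, t).
Proof.
  intros Hz.
  assert (G : 0 < gap z) by now apply in_disk_gap.
  assert (D : 0 < dist2 z t) by now apply dist2_pos.
  assert (cG : continuous (fun w : C * R => gap (fst w)) (z, t)).
  { apply (continuous_comp (fun w : C * R => fst w) gap); [apply continuous_fst | apply
      continuous_gap]. }
  assert (cD := continuous_dist2 z t).
  assert (cI : forall x, 0 < x -> continuous Rinv x).
  { intros x Hx. apply (ex_derive_continuous (V := R_NormedModule)). auto_derive; lra. }
  assert (cID : continuous (fun w : C * R => / dist2 (fst w) (snd w)) (z, t)).
  { apply (continuous_comp (fun w : C * R => dist2 (fst w) (snd w)) Rinv); auto. }
  induction e as [ | | | | h hc | m | e1 IH1 e2 IH2 | e1 IH1 e2 IH2]; simpl.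
  - apply cont_RtoC. apply (continuous_comp (fun w : C * R => fst w) fst); [apply
      continuous_fst | apply continuous_fst].
  - apply cont_RtoC. apply (continuous_comp (fun w : C * R => fst w) snd); [apply
      continuous_fst | apply continuous_snd].
  - now apply cont_RtoC.
  - apply cont_RtoC. apply (continuous_comp (fun w : C * R => gap (fst w)) Rinv); auto.
  - destruct (hc t) as [h1 h2]. split.
    + apply (continuous_comp (fun w : C * R => snd w) (fun t => fst (h t))); [apply
        continuous_snd | exact h1].
    + apply (continuous_comp (fun w : C * R => snd w) (fun t => snd (h t))); [apply
        continuous_snd | exact h2].
  - assert (cL : continuous (fun w : C * R => ln (gap (fst w) / dist2 (fst w) (snd w))) (z, t)).
    { apply (continuous_comp (fun w : C * R => gap (fst w) / dist2 (fst w) (snd w)) ln).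
      - apply (continuous_mult (K := R_AbsRing)); assumption.
      - apply (ex_derive_continuous (V := R_NormedModule)). auto_derive. apply
          Rdiv_lt_0_compat; assumption. }
    destruct (is_derive_powlog m a (ln (gap z / dist2 z t))) as [P1 P2].
    split.
    + apply (continuous_ext (fun w : C * R => fst (powlog m a (ln (gap (fst w) / dist2 (fst
        w) (snd w)))))).
      { intros w. now rewrite powlog_spec. }
      apply (continuous_comp (fun w : C * R => ln (gap (fst w) / dist2 (fst w) (snd w))) (fun
          y => fst (powlog m a y))); [exact cL|].
      apply (ex_derive_continuous (V := R_NormedModule)). eexists; exact P1.
    + apply (continuous_ext (fun w : C * R => snd (powlog m a (ln (gap (fst w) / dist2 (fst
        w) (snd w)))))).
      { intros w. now rewrite powlog_spec. }
      apply (continuous_comp (fun w : C * R => ln (gap (fst w) / dist2 (fst w) (snd w))) (fun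
          y => snd (powlog m a y))); [exact cL|].
      apply (ex_derive_continuous (V := R_NormedModule)). eexists; exact P2.
  - now apply cont_plus.
  - now apply cont_mult.
Qed.
(** * Differentiation under the integral sign *)

Lemma locally_in_disk (z : C) : in_disk z -> locally z in_disk.
Proof.
  intros Hz. apply in_disk_gap in Hz.
  assert (H : locally z (fun w => 0 < gap w)).
  { apply (continuous_gap z). apply (open_gt 0). exact Hz. }
  revert H. apply filter_imp. intros w. apply in_disk_gap.
Qed.

Lemma continuous_section (k : C -> R -> R) (z : C) (t : R) :
  continuous (fun w : C * R => k (fst w) (snd w)) (z, t) -> continuous (k z) t.
Proof.
  intros H. apply (continuous_comp_2 (fun _ : R => z) (fun t => t) k);
    [apply continuous_const | apply continuous_id | exact H].
Qed.

(** The tube lemma: compactness of [[0, b]] turns joint continuity at each [(z, t)] into a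
    neighbourhood of [z] that serves all [t]. *)
Lemma uniform_on_interval (k : C -> R -> R) (z : C) (b eps : R) :
  (forall t, continuous (fun w : C * R => k (fst w) (snd w)) (z, t)) ->
  0 < eps ->
  locally z (fun w => forall t, 0 <= t <= b -> Rabs (k w t - k z t) < eps).
Proof.
  intros H He.
  assert (N : forall t, exists delta : posreal, forall w s,
    ball z delta w -> Rabs (s - t) < delta -> Rabs (k w s - k z t) < eps / 2).
  { intros t.
    assert (L := H t (fun y => Rabs (y - k z t) < eps / 2)).
    lapply L; [clear L; intros [delta Hd] | exists (mkposreal (eps / 2) ltac:(lra)); intros y
        Hy; exact Hy].
    exists delta. intros w s Hw Hs. apply (Hd (w, s)). split; [exact Hw | exact Hs]. }
  set (delta := fun t => proj1_sig (constructive_indefinite_description _ (N t))).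
  assert (Hdelta : forall t w s, ball z (delta t) w -> Rabs (s - t) < delta t -> Rabs (k w s
      - k z t) < eps / 2).
  { intros t. exact (proj2_sig (constructive_indefinite_description _ (N t))). }
  (* Every [t] is within [delta u] of some [u] with [d <= delta u], but this [u] is given under a
     double negation only; hence the argument by contradiction. *)
  destruct (compactness_value_1d 0 b delta) as [d Hd].
  exists d. intros w Hw t Ht. apply NNPP. intros Hn. apply (Hd t Ht).
  intros [u [Hu [Htu Hdu]]]. apply Hn.
  replace (k w t - k z t) with ((k w t - k z u) + - (k z t - k z u)) by ring.
  eapply Rle_lt_trans; [apply Rabs_triang|]. rewrite Rabs_Ropp.
  assert (Rabs (k w t - k z u) < eps / 2).
  { apply Hdelta; [now apply ball_le with d | assumption]. }
  assert (Rabs (k z t - k z u) < eps / 2).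
  { apply Hdelta; [apply ball_center | assumption]. }
  lra.
Qed.

Definition jointly_cont (k : C -> R -> R) : Prop :=
  forall z t, in_disk z -> continuous (fun w : C * R => k (fst w) (snd w)) (z, t).

Lemma jointly_cont_ex (k : C -> R -> R) (z : C) (a b : R) :
  jointly_cont k -> in_disk z -> ex_RInt (k z) a b.
Proof.
  intros Hk Hz. apply (ex_RInt_continuous (V := R_CompleteNormedModule)).
  intros t _. now apply continuous_section, Hk.
Qed.

Lemma continuous_param_RInt (k : C -> R -> R) (b : R) (z : C) :
  0 < b -> jointly_cont k -> in_disk z ->
  continuous (fun w => RInt (k w) 0 b) z.
Proof.
  intros Hb Hk Hz. apply filterlim_locally. intros [eps He].
  assert (U := uniform_on_interval k z b (eps / (2 * b))
    (fun t => Hk z t Hz) ltac:(apply Rdiv_lt_0_compat; lra)).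
  assert (L := filter_and _ _ U (locally_in_disk z Hz)).
  revert L. apply filter_imp. intros w [HU Hw].
  change (Rabs (RInt (k w) 0 b - RInt (k z) 0 b) < eps).
  assert (E1 := jointly_cont_ex k w 0 b Hk Hw). assert (E2 := jointly_cont_ex k z 0 b Hk Hz).
  change (RInt (k w) 0 b - RInt (k z) 0 b) with (minus (RInt (k w) 0 b) (RInt (k z) 0 b)).
  rewrite <- (RInt_minus (V := R_CompleteNormedModule)) by assumption.
  eapply Rle_lt_trans.
  - apply (abs_RInt_le_const (fun t => minus (k w t) (k z t)) 0 b (eps / (2 * b))); [lra | |].
    + now apply (ex_RInt_minus (V := R_NormedModule)).
    + intros t Ht. left. now apply HU.
  - replace ((b - 0) * (eps / (2 * b))) with (eps / 2) by (field; lra). simpl. lra.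
Qed.

(** Leibniz rule along a curve. The kernels are controlled over the open disk only, which [c u] does
    not leave for [u] near [s]. *)
Lemma is_derive_param_RInt (k dk : C -> R -> R) (b : R) (c : R -> C) (s : R) :
  (forall u, continuous c u) ->
  jointly_cont k -> jointly_cont dk ->
  (forall u t, in_disk (c u) -> is_derive (fun v => k (c v) t) u (dk (c u) t)) ->
  in_disk (c s) ->
  is_derive (fun u => RInt (k (c u)) 0 b) s (RInt (dk (c s)) 0 b).
Proof.
  intros Hc Hk Hdk Hd Hs.
  assert (L : locally s (fun u => in_disk (c u))).
  { apply (Hc s). now apply locally_in_disk. }
  evar_last.
  - apply (is_derive_RInt_param (fun u t => k (c u) t)).
    + revert L. apply filter_imp. intros u Hu t _. exists (dk (c u) t). now apply Hd.
    + intros t _.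
      apply (continuity_2d_pt_ext_loc (fun u v => dk (c u) v)).
      * destruct L as [d L]. exists d. intros u v Hu Hv.
        symmetry. apply is_derive_unique, Hd, L, Hu.
      * apply continuity_2d_pt_filterlim.
        apply (continuous_comp_2 (fun w : R * R => c (fst w)) (fun w : R * R => snd w) dk (s,
            t)).
        -- apply (continuous_comp (fun w : R * R => fst w) c); [apply continuous_fst | apply
            Hc].
        -- apply continuous_snd.
        -- now apply Hdk.
    + revert L. apply filter_imp. intros u Hu. now apply jointly_cont_ex.
  - apply RInt_ext. intros t _. now apply is_derive_unique, Hd.
Qed.

Definition kint (a : C) (e : kexpr) (z : C) : C :=
  (/ (2 * PI) * RInt (fun t => fst (keval a e z t)) 0 (2 * PI),
   / (2 * PI) * RInt (fun t => snd (keval a e z t)) 0 (2 * PI)).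

Lemma good_fst (a : C) (e : kexpr) : jointly_cont (fun z t => fst (keval a e z t)).
Proof. intros z t Hz. now apply (keval_cont a e z t). Qed.

Lemma good_snd (a : C) (e : kexpr) : jointly_cont (fun z t => snd (keval a e z t)).
Proof. intros z t Hz. now apply (keval_cont a e z t). Qed.

Lemma continuous_of_components {T : UniformSpace} (f : T -> C) (x : T) :
  cont_pair f x -> continuous f x.
Proof.
  intros [H1 H2]. apply filterlim_locally. intros eps.
  apply (proj1 (filterlim_locally _ _)) with (eps := eps) in H1.
  apply (proj1 (filterlim_locally _ _)) with (eps := eps) in H2.
  assert (H := filter_and _ _ H1 H2). revert H. apply filter_imp.
  intros y [A B]. now split.
Qed.

Lemma kint_continuous (a : C) (e : kexpr) (z : C) : in_disk z -> continuous (kint a e) z.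
Proof.
  intros Hz. apply continuous_of_components. split; unfold kint; simpl.
  - apply (continuous_scal_r (K := R_AbsRing) (V := R_NormedModule)).
    apply (continuous_param_RInt (fun z t => fst (keval a e z t))); [apply two_pi_pos | apply
        good_fst | exact Hz].
  - apply (continuous_scal_r (K := R_AbsRing) (V := R_NormedModule)).
    apply (continuous_param_RInt (fun z t => snd (keval a e z t))); [apply two_pi_pos | apply
        good_snd | exact Hz].
Qed.

Lemma kint_derive (a : C) (e : kexpr) (X Y : R -> R) (p q s : R) :
  (forall u, is_derive X u p) -> (forall u, is_derive Y u q) -> in_disk (X s, Y s) ->
  derive_pair (fun u => kint a e (X u, Y u)) s (kint a (kder a p q e) (X s, Y s)).
Proof.
  intros HX HY Hs.
  assert (Hc : forall u, continuous (fun u => (X u, Y u) : C) u).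
  { intros u. apply continuous_of_components.
    split; simpl; apply (ex_derive_continuous (V := R_NormedModule)); eexists; [apply HX |
        apply HY]. }
  split; unfold kint; simpl.
  - apply (is_derive_scal (fun u => RInt (fun t => fst (keval a e (X u, Y u) t)) 0 (2 * PI))).
    apply (is_derive_param_RInt (fun z t => fst (keval a e z t)) (fun z t => fst (keval a
        (kder a p q e) z t))
      (2 * PI) (fun u => (X u, Y u))); auto using good_fst.
    intros u t Hu. now apply (keval_derive a e t X Y p q u).
  - apply (is_derive_scal (fun u => RInt (fun t => snd (keval a e (X u, Y u) t)) 0 (2 * PI))).
    apply (is_derive_param_RInt (fun z t => snd (keval a e z t)) (fun z t => snd (keval a
        (kder a p q e) z t))
      (2 * PI) (fun u => (X u, Y u))); auto using good_snd.
    intros u t Hu. now apply (keval_derive a e t X Y p q u).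
Qed.

Lemma kint_derive_x (a : C) (e : kexpr) (z : C) :
  in_disk z -> derive_pair (fun u => kint a e (u, Im z)) (Re z) (kint a (kder a 1 0 e) z).
Proof.
  destruct z as [x y]. intros Hz.
  apply (kint_derive a e (fun u => u) (fun _ => y) 1 0 x).
  - intros u. apply (is_derive_id (K := R_AbsRing)).
  - intros u. apply (is_derive_const (V := R_NormedModule)).
  - exact Hz.
Qed.

Lemma kint_derive_y (a : C) (e : kexpr) (z : C) :
  in_disk z -> derive_pair (fun u => kint a e (Re z, u)) (Im z) (kint a (kder a 0 1 e) z).
Proof.
  destruct z as [x y]. intros Hz.
  apply (kint_derive a e (fun _ => x) (fun u => u) 0 1 y).
  - intros u. apply (is_derive_const (V := R_NormedModule)).
  - intros u. apply (is_derive_id (K := R_AbsRing)).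
  - exact Hz.
Qed.

Definition eq_on_disk (f g : C -> C) : Prop := forall z, in_disk z -> f z = g z.

Lemma locally_disk_x (z : C) : in_disk z -> locally (Re z) (fun u => in_disk (u, Im z)).
Proof.
  intros Hz. assert (H : continuous (fun u : R => (u, Im z) : C) (Re z)).
  { apply continuous_of_components. split; simpl; [apply continuous_id | apply
      continuous_const]. }
  apply H. destruct z. now apply locally_in_disk.
Qed.

Lemma locally_disk_y (z : C) : in_disk z -> locally (Im z) (fun u => in_disk (Re z, u)).
Proof.
  intros Hz. assert (H : continuous (fun u : R => (Re z, u) : C) (Im z)).
  { apply continuous_of_components. split; simpl; [apply continuous_const | apply
      continuous_id]. }
  apply H. destruct z. now apply locally_in_disk.
Qed.

Lemma dx_ext (f g : C -> C) : eq_on_disk f g -> eq_on_disk (dx f) (dx g).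
Proof.
  intros H z Hz. assert (L := locally_disk_x z Hz).
  unfold dx. f_equal; apply Derive_ext_loc; revert L; apply filter_imp; intros u Hu; now
      rewrite H.
Qed.

Lemma dy_ext (f g : C -> C) : eq_on_disk f g -> eq_on_disk (dy f) (dy g).
Proof.
  intros H z Hz. assert (L := locally_disk_y z Hz).
  unfold dy. f_equal; apply Derive_ext_loc; revert L; apply filter_imp; intros u Hu; now
      rewrite H.
Qed.

Lemma has_partials_ext (f g : C -> C) (z : C) :
  eq_on_disk f g -> in_disk z -> has_partials f z -> has_partials g z.
Proof.
  intros H Hz [H1 H2]. split; revert H1 H2; intros H1 H2.
  - revert H1. apply ex_derive_ext_loc.
    generalize (locally_disk_x z Hz). apply filter_imp. intros u Hu; now apply H.
  - revert H2. apply ex_derive_ext_loc.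
    generalize (locally_disk_y z Hz). apply filter_imp. intros u Hu; now apply H.
Qed.

Lemma C_on_disk_ext (m : nat) : forall f g, eq_on_disk f g -> C_on_disk m f -> C_on_disk m g.
Proof.
  induction m as [|m IH]; intros f g H; simpl.
  - intros Hf z Hz. apply (continuous_ext_loc g f z).
    + generalize (locally_in_disk z Hz). apply filter_imp. intros w Hw. now apply H.
    + now apply Hf.
  - intros [H1 [H2 H3]]. split; [|split].
    + intros z Hz. apply (has_partials_ext f); auto.
    + apply (IH (dx f)); [now apply dx_ext | assumption].
    + apply (IH (dy f)); [now apply dy_ext | assumption].
Qed.

Lemma ex_derive_of_pair (f : R -> C) (s : R) (l : C) :
  derive_pair f s l -> ex_derive (V := C_R_NormedModule) f s.
Proof.
  intros [H1 H2]. exists l. unfold is_derive in *.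
  apply (filterdiff_ext (V := C_R_NormedModule) (fun u => (fst (f u), snd (f u)) : C)).
  { intros u. symmetry. apply surjective_pairing. }
  apply (filterdiff_ext_lin (V := C_R_NormedModule) _
    (fun y : R => (scal y (fst l), scal y (snd l)) : C)).
  - apply (filterdiff_comp'_2 (K := R_AbsRing) (W := C_R_NormedModule)
      (fun u => fst (f u)) (fun u => snd (f u)) (fun x y => (x, y) : C)
      s (fun y => scal y (fst l)) (fun y => scal y (snd l)) (fun x y => (x, y) : C) H1 H2).
    apply (filterdiff_ext (V := C_R_NormedModule) (fun w : C => w)).
    { intros w. apply surjective_pairing. }
    apply (filterdiff_ext_lin (V := C_R_NormedModule) _ (fun w : C => w)).
    + apply (@filterdiff_id R_AbsRing C_R_NormedModule).
    + intros w. apply surjective_pairing.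
  - intros y. reflexivity.
Qed.

Lemma dx_kint (a : C) (e : kexpr) : eq_on_disk (dx (kint a e)) (kint a (kder a 1 0 e)).
Proof.
  intros z Hz. destruct (kint_derive_x a e z Hz) as [H1 H2].
  unfold dx. apply injective_projections; simpl fst; simpl snd; now apply is_derive_unique.
Qed.

Lemma dy_kint (a : C) (e : kexpr) : eq_on_disk (dy (kint a e)) (kint a (kder a 0 1 e)).
Proof.
  intros z Hz. destruct (kint_derive_y a e z Hz) as [H1 H2].
  unfold dy. apply injective_projections; simpl fst; simpl snd; now apply is_derive_unique.
Qed.

Lemma eq_on_disk_sym (f g : C -> C) : eq_on_disk f g -> eq_on_disk g f.
Proof. intros H z Hz. symmetry. now apply H. Qed.

(** The partial derivatives of a kernel integral are kernel integrals again, so the induction on [m]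
    is over all [e] at once. *)
Lemma C_on_disk_kint (a : C) (m : nat) : forall e, C_on_disk m (kint a e).
Proof.
  induction m as [|m IH]; intros e; simpl.
  - intros z Hz. now apply kint_continuous.
  - split; [|split].
    + intros z Hz. split; eapply ex_derive_of_pair; [now apply kint_derive_x | now apply
        kint_derive_y].
    + apply (C_on_disk_ext m (kint a (kder a 1 0 e))); [apply eq_on_disk_sym, dx_kint | apply
        IH].
    + apply (C_on_disk_ext m (kint a (kder a 0 1 e))); [apply eq_on_disk_sym, dy_kint | apply
        IH].
Qed.
(** * The shifted Laplacian on kernels *)

Definition keq (a : C) (e1 e2 : kexpr) : Prop :=
  forall z t, in_disk z -> keval a e1 z t = keval a e2 z t.

Lemma kint_ext (a : C) (e1 e2 : kexpr) : keq a e1 e2 -> eq_on_disk (kint a e1) (kint a e2).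
Proof.
  intros H z Hz. unfold kint. f_equal; f_equal; apply RInt_ext; intros t _; now rewrite H.
Qed.

Lemma RInt_lin (f g : R -> R) (a b x y : R) :
  ex_RInt f a b -> ex_RInt g a b ->
  RInt (fun t => x * f t + y * g t) a b = x * RInt f a b + y * RInt g a b.
Proof.
  intros Hf Hg. apply is_RInt_unique.
  apply (is_RInt_plus (V := R_NormedModule) (fun t => x * f t) (fun t => y * g t));
    apply (is_RInt_scal (V := R_NormedModule)), (RInt_correct (V := R_CompleteNormedModule));
        assumption.
Qed.

Lemma kint_add (a : C) (e1 e2 : kexpr) (z : C) :
  in_disk z -> kint a (KAdd e1 e2) z = (kint a e1 z + kint a e2 z)%C.
Proof.
  intros Hz.
  assert (A1 := jointly_cont_ex _ z 0 (2 * PI) (good_fst a e1) Hz).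
  assert (A2 := jointly_cont_ex _ z 0 (2 * PI) (good_fst a e2) Hz).
  assert (B1 := jointly_cont_ex _ z 0 (2 * PI) (good_snd a e1) Hz).
  assert (B2 := jointly_cont_ex _ z 0 (2 * PI) (good_snd a e2) Hz).
  unfold kint. apply injective_projections; simpl.
  - rewrite <- Rmult_plus_distr_l. f_equal.
    rewrite <- (Rmult_1_l (RInt (fun t => fst (keval a e1 z t)) _ _)), <- (Rmult_1_l (RInt
        (fun t => fst (keval a e2 z t)) _ _)).
    rewrite <- RInt_lin by assumption. apply RInt_ext. intros; simpl; ring.
  - rewrite <- Rmult_plus_distr_l. f_equal.
    rewrite <- (Rmult_1_l (RInt (fun t => snd (keval a e1 z t)) _ _)), <- (Rmult_1_l (RInt
        (fun t => snd (keval a e2 z t)) _ _)).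
    rewrite <- RInt_lin by assumption. apply RInt_ext. intros; simpl; ring.
Qed.

Lemma kint_scal (a : C) (e' e : kexpr) (z c : C) :
  in_disk z -> (forall t, keval a e' z t = c * keval a e z t)%C -> kint a e' z = (c * kint a
      e z)%C.
Proof.
  intros Hz H.
  assert (A1 := jointly_cont_ex _ z 0 (2 * PI) (good_fst a e) Hz).
  assert (B1 := jointly_cont_ex _ z 0 (2 * PI) (good_snd a e) Hz).
  unfold kint. apply injective_projections; simpl.
  - transitivity (/ (2 * PI) * (fst c * RInt (fun t => fst (keval a e z t)) 0 (2 * PI) + -
      snd c * RInt (fun t => snd (keval a e z t)) 0 (2 * PI))); [|ring].
    rewrite <- RInt_lin by assumption. f_equal. apply RInt_ext. intros t _. rewrite H. simpl.
        ring.
  - transitivity (/ (2 * PI) * (fst c * RInt (fun t => snd (keval a e z t)) 0 (2 * PI) + snd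
      c * RInt (fun t => fst (keval a e z t)) 0 (2 * PI))); [|ring].
    rewrite <- RInt_lin by assumption. f_equal. apply RInt_ext. intros t _. rewrite H. simpl.
        ring.
Qed.

Definition Klap (a : C) (e : kexpr) : kexpr :=
  KAdd (kder a 1 0 (kder a 1 0 e)) (kder a 0 1 (kder a 0 1 e)).

(** Built as [1 - x^2 - y^2] from the generators, so that [Kshift] returns a kernel expression and
    can be iterated. *)
Definition Kgap : kexpr :=
  KAdd (Kcst (RtoC 1)) (KMul (Kcst (RtoC (-1))) (KAdd (KMul KX KX) (KMul KY KY))).

Definition Kshift (a lam : C) (e : kexpr) : kexpr :=
  KAdd (KMul (KMul (Kcst (RtoC (1/4))) (KMul Kgap Kgap)) (Klap a e)) (KMul (Kcst (- lam)%C) e).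

Lemma keval_Kgap (a : C) (z : C) (t : R) : keval a Kgap z t = RtoC (gap z).
Proof.
  simpl. unfold gap. rewrite Cmod_sqr.
  rewrite <- ?RtoC_mult, <- ?RtoC_plus, <- ?RtoC_mult, <- ?RtoC_plus. f_equal. ring.
Qed.

Lemma shifted_laplacian_ext (lam : C) (f g : C -> C) :
  eq_on_disk f g -> eq_on_disk (shifted_laplacian lam f) (shifted_laplacian lam g).
Proof.
  intros H z Hz. unfold shifted_laplacian, hyp_laplacian.
  rewrite (dx_ext _ _ (dx_ext _ _ H) z Hz), (dy_ext _ _ (dy_ext _ _ H) z Hz), (H z Hz).
  reflexivity.
Qed.

Lemma shifted_laplacian_kint (a lam : C) (e : kexpr) :
  eq_on_disk (shifted_laplacian lam (kint a e)) (kint a (Kshift a lam e)).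
Proof.
  intros z Hz. unfold shifted_laplacian, hyp_laplacian.
  rewrite (dx_ext _ _ (dx_kint a e) z Hz), (dy_ext _ _ (dy_kint a e) z Hz).
  rewrite (dx_kint a _ z Hz), (dy_kint a _ z Hz).
  unfold Kshift. rewrite kint_add by assumption.
  rewrite (kint_scal a (KMul (Kcst (- lam)%C) e) e z (- lam)%C Hz) by reflexivity.
  rewrite (kint_scal a (KMul _ (Klap a e)) (Klap a e) z (RtoC ((1 - Cmod z ^ 2) ^ 2 / 4)) Hz).
  - unfold Klap. rewrite kint_add by assumption. ring.
  - intros t. change (keval a (KMul ?x ?y) z t) with (keval a x z t * keval a y z t)%C. 
    cbn [keval]. f_equal. rewrite keval_Kgap. simpl.
    rewrite <- ?RtoC_mult. f_equal. unfold gap. field.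
Qed.

Lemma iter_laplacian_kint (a lam : C) (f : C -> C) (e : kexpr) (n : nat) :
  eq_on_disk f (kint a e) ->
  eq_on_disk (Nat.iter n (shifted_laplacian lam) f) (kint a (Nat.iter n (Kshift a lam) e)).
Proof.
  intros H. induction n as [|n IH]; [exact H|]. simpl.
  intros z Hz. rewrite (shifted_laplacian_ext lam _ _ IH z Hz).
  now apply shifted_laplacian_kint.
Qed.

Lemma derive_pair_unique (f : R -> C) (s : R) (l1 l2 : C) :
  derive_pair f s l1 -> derive_pair f s l2 -> l1 = l2.
Proof.
  intros [A1 A2] [B1 B2]. apply is_derive_unique in A1, A2, B1, B2.
  apply injective_projections; congruence.
Qed.

(** [kder] acts on syntax, but its value depends only on the values of the kernel: both sides are
    derivatives of the same function. Hence kernels may be simplified between two applications of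
    [Kshift]. *)
Lemma kder_keq_x (a : C) (e1 e2 : kexpr) : keq a e1 e2 -> keq a (kder a 1 0 e1) (kder a 1 0 e2).
Proof.
  intros H [x y] t Hz.
  assert (L := locally_disk_x (x, y) Hz). simpl in L.
  assert (dX : is_derive (fun u : R => u) x 1) by apply (is_derive_id (K := R_AbsRing)).
  assert (dY : is_derive (fun u : R => y) x 0) by apply (is_derive_const (V := R_NormedModule)).
  apply (derive_pair_unique (fun u => keval a e1 (u, y) t) x).
  - now apply (keval_derive a e1 t (fun u => u) (fun _ => y)).
  - destruct (keval_derive a e2 t (fun u => u) (fun _ => y) 1 0 x dX dY Hz) as [D1 D2].
    split; [apply (is_derive_ext_loc (fun u => fst (keval a e2 (u, y) t))) | apply
        (is_derive_ext_loc (fun u => snd (keval a e2 (u, y) t)))];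
      try assumption; revert L; apply filter_imp; intros u Hu; now rewrite H.
Qed.

Lemma kder_keq_y (a : C) (e1 e2 : kexpr) : keq a e1 e2 -> keq a (kder a 0 1 e1) (kder a 0 1 e2).
Proof.
  intros H [x y] t Hz.
  assert (L := locally_disk_y (x, y) Hz). simpl in L.
  assert (dX : is_derive (fun u : R => x) y 0) by apply (is_derive_const (V := R_NormedModule)).
  assert (dY : is_derive (fun u : R => u) y 1) by apply (is_derive_id (K := R_AbsRing)).
  apply (derive_pair_unique (fun u => keval a e1 (x, u) t) y).
  - now apply (keval_derive a e1 t (fun _ => x) (fun u => u)).
  - destruct (keval_derive a e2 t (fun _ => x) (fun u => u) 0 1 y dX dY Hz) as [D1 D2].
    split; [apply (is_derive_ext_loc (fun u => fst (keval a e2 (x, u) t))) | apply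
        (is_derive_ext_loc (fun u => snd (keval a e2 (x, u) t)))];
      try assumption; revert L; apply filter_imp; intros u Hu; now rewrite H.
Qed.

Lemma Kshift_keq (a lam : C) (e1 e2 : kexpr) : keq a e1 e2 -> keq a (Kshift a lam e1) (Kshift
    a lam e2).
Proof.
  intros H z t Hz. unfold Kshift, Klap. cbn [keval].
  rewrite (kder_keq_x _ _ _ (kder_keq_x _ _ _ H) z t Hz), (kder_keq_y _ _ _ (kder_keq_y _ _ _
      H) z t Hz), (H z t Hz).
  reflexivity.
Qed.

Lemma iter_Kshift_keq (a lam : C) (n : nat) (e1 e2 : kexpr) :
  keq a e1 e2 -> keq a (Nat.iter n (Kshift a lam) e1) (Nat.iter n (Kshift a lam) e2).
Proof. intros H. induction n as [|n IH]; [exact H|]. simpl. now apply Kshift_keq. Qed.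

Lemma keq_trans (a : C) (e1 e2 e3 : kexpr) : keq a e1 e2 -> keq a e2 e3 -> keq a e1 e3.
Proof. intros H1 H2 z t Hz. now rewrite H1, H2. Qed.

Lemma Kshift_lin (a lam : C) (c : C) (e1 e2 : kexpr) :
  keq a (Kshift a lam (KAdd e1 (KMul (Kcst c) e2))) (KAdd (Kshift a lam e1) (KMul (Kcst c)
      (Kshift a lam e2))).
Proof. intros z t Hz. unfold Kshift, Klap. simpl. ring. Qed.

Lemma iter_Kshift_lin (a lam : C) (c : C) (n : nat) (e1 e2 : kexpr) :
  keq a (Nat.iter n (Kshift a lam) (KAdd e1 (KMul (Kcst c) e2)))
    (KAdd (Nat.iter n (Kshift a lam) e1) (KMul (Kcst c) (Nat.iter n (Kshift a lam) e2))).
Proof.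
  induction n as [|n IH]; [intros z t Hz; reflexivity|]. simpl.
  eapply keq_trans; [apply Kshift_keq, IH | apply Kshift_lin].
Qed.

Definition Kzero : kexpr := Kcst (RtoC 0).

Lemma iter_Kshift_zero (a lam : C) (n : nat) : keq a (Nat.iter n (Kshift a lam) Kzero) Kzero.
Proof.
  induction n as [|n IH]; [intros z t Hz; reflexivity|]. simpl.
  eapply keq_trans; [apply Kshift_keq, IH|]. intros z t Hz. unfold Kshift, Klap. simpl. ring.
Qed.

Lemma keval_Klog' (a : C) (p q : R) (z : C) (t : R) :
  keval a (Klog' p q) z t
  = RtoC (- ((2 * p * Re z + 2 * q * Im z) / gap z
      + (2 * p * (Re z - cos t) + 2 * q * (Im z - sin t)) / dist2 z t)).
Proof.
  simpl. rewrite <- ?RtoC_mult, <- ?RtoC_plus, <- ?RtoC_mult, <- ?RtoC_plus, <- ?RtoC_mult,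
      <- ?RtoC_plus, <- ?RtoC_mult.
  f_equal. unfold Rdiv. ring.
Qed.

(* [gap^2 |grad log P|^2 = 4] *)
Lemma grad_log_sqr (z : C) (t : R) :
  in_disk z ->
  gap z ^ 2 * ((2 * Re z / gap z + 2 * (Re z - cos t) / dist2 z t) ^ 2
    + (2 * Im z / gap z + 2 * (Im z - sin t) / dist2 z t) ^ 2) = 4.
Proof.
  intros Hz. assert (G := proj1 (in_disk_gap z) Hz). assert (D := dist2_pos z t Hz).
  assert (ED : dist2 z t = (Re z - cos t) ^ 2 + (Im z - sin t) ^ 2).
  { unfold dist2. rewrite Cmod_sqr. generalize (cos2_sin2 t). nra. }
  assert (EG : 1 - gap z = Re z ^ 2 + Im z ^ 2) by (unfold gap; rewrite <- Cmod_sqr; ring).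
  assert (EM : 2 * (Re z * (Re z - cos t) + Im z * (Im z - sin t)) = dist2 z t - gap z).
  { unfold dist2, gap. rewrite Cmod_sqr. ring. }
  transitivity (4 * ((Re z ^ 2 + Im z ^ 2) + gap z / dist2 z t * (2 * (Re z * (Re z - cos t)
      + Im z * (Im z - sin t)))
     + gap z ^ 2 / dist2 z t ^ 2 * ((Re z - cos t) ^ 2 + (Im z - sin t) ^ 2))).
  - field. lra.
  - rewrite <- ED, EM, <- EG. field. lra.
Qed.

(** In [log P = log gap - log D] the term [log D] is harmonic off the boundary point, and the
    Laplacian of [log gap] is [- 4 / gap^2]. *)
Lemma lap_log (a : C) (z : C) (t : R) :
  in_disk z ->
  (RtoC (gap z ^ 2 / 4) * (keval a (kder a 1 0 (Klog' 1 0)) z t + keval a (kder a 0 1 (Klog'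
      0 1)) z t) = RtoC (-1))%C.
Proof.
  intros Hz. assert (G := proj1 (in_disk_gap z) Hz). assert (D := dist2_pos z t Hz).
  assert (ED : dist2 z t = (Re z - cos t) ^ 2 + (Im z - sin t) ^ 2).
  { unfold dist2. rewrite Cmod_sqr. generalize (cos2_sin2 t). nra. }
  assert (EG : 1 - gap z = Re z ^ 2 + Im z ^ 2) by (unfold gap; rewrite <- Cmod_sqr; ring).
  transitivity (RtoC (gap z ^ 2 / 4 * (- (4 / gap z + 4 * (Re z ^ 2 + Im z ^ 2) / gap z ^ 2
     + 4 / dist2 z t - 4 * ((Re z - cos t) ^ 2 + (Im z - sin t) ^ 2) / dist2 z t ^ 2)))).
  - simpl. rewrite <- ?RtoC_mult, <- ?RtoC_plus, <- ?RtoC_mult, <- ?RtoC_plus, <- ?RtoC_mult,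
      <- ?RtoC_plus, <- ?RtoC_mult, <- ?RtoC_plus, <- ?RtoC_mult, <- ?RtoC_plus, <- ?RtoC_mult.
    f_equal. field. lra.
  - f_equal. rewrite <- ED, <- EG. field. lra.
Qed.
Lemma grad_log_C (a : C) (z : C) (t : R) :
  in_disk z ->
  (RtoC (gap z ^ 2 / 4) * (keval a (Klog' 1 0) z t * keval a (Klog' 1 0) z t
     + keval a (Klog' 0 1) z t * keval a (Klog' 0 1) z t) = RtoC 1)%C.
Proof.
  intros Hz. rewrite !keval_Klog', <- !RtoC_mult, <- RtoC_plus, <- RtoC_mult. f_equal.
  assert (G := proj1 (in_disk_gap z) Hz). assert (D := dist2_pos z t Hz).
  transitivity (gap z ^ 2 * ((2 * Re z / gap z + 2 * (Re z - cos t) / dist2 z t) ^ 2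
    + (2 * Im z / gap z + 2 * (Im z - sin t) / dist2 z t) ^ 2) / 4).
  - field. lra.
  - rewrite grad_log_sqr by assumption. field.
Qed.

(** For [psi(y) = y^m e^(a y)] the chain rule and the two facts on [log P] give [psi'' - psi'] at
    [y = log P] for the hyperbolic Laplacian. Truncated indices come with a zero coefficient when
    [m <= 1], and [h] is constant in [z]. *)
Lemma Kshift_KK (a lam : C) (h : R -> C) (hc : forall t, cont_pair h t) (m : nat) :
  keq a (Kshift a lam (KMul (KT h hc) (KK m)))
    (KMul (KT h hc)
      (KAdd (KMul (Kcst (a * (a - 1) - lam)%C) (KK m))
      (KAdd (KMul (Kcst (RtoC (INR m) * (2 * a - 1))%C) (KK (m - 1)))
            (KMul (Kcst (RtoC (INR m * INR (m - 1)))) (KK (m - 1 - 1)))))).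
Proof.
  intros z t Hz.
  assert (F1 := grad_log_C a z t Hz). assert (F2 := lap_log a z t Hz).
  assert (EG := keval_Kgap a z t).
  unfold Kshift, Klap. cbn [kder Kcst].
  (* The derivatives of [log P] are made opaque: only [F1] and [F2] matter, and what remains is a
     polynomial identity. *)
  generalize dependent (Klog' 1 0). intros Ux F1. generalize dependent (Klog' 0 1). intros Uy.
  generalize (kder a 1 0 Ux) (kder a 0 1 Uy). intros Uxx Uyy. revert EG.
  generalize Kgap. intros kg EG F1 F2. cbn [keval Kcst]. rewrite EG.

  match goal with |- context [Rcpow ?x a] => generalize (Rcpow x a) end.
  intros P. replace (RtoC (1/4) * (RtoC (gap z) * RtoC (gap z)))%C with (RtoC (gap z ^ 2 / 4)).
  2:{ rewrite <- !RtoC_mult. f_equal. field. }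
  generalize dependent (RtoC (gap z ^ 2 / 4)). intros q F1 F2.
  generalize dependent (keval a Ux z t). generalize dependent (keval a Uy z t).
  generalize dependent (keval a Uxx z t). generalize dependent (keval a Uyy z t).
  intros uyy uxx F2 uy ux F1.
  rewrite RtoC_mult.
  match goal with |- context [RtoC (?x ^ m)] => generalize (RtoC (x ^ m)) (RtoC (x ^ (m -
      1))) (RtoC (x ^ (m - 1 - 1))) end.
  intros k0 k1 k2. generalize (h t) (RtoC (INR m)) (RtoC (INR (m - 1))). intros c n n1.
  transitivity (c * P * ((q * (ux * ux + uy * uy)) * (n * n1 * k2 + 2 * a * n * k1 + a * a * k0)
    + (q * (uxx + uyy)) * (n * k1 + a * k0) - lam * k0))%C; [ring|].
  rewrite F1, F2. ring.
Qed.
(** The [mu] term never reaches the result: one step sends [e (k + 2)] to [e (k + 1) + mu e k], and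
    the [k + 1] steps left take the first summand to [e 0] and annihilate the second. The recurrence
    has two terms, so the induction carries two consecutive indices. *)
Lemma chain_vanish (a lam mu : C) (e : nat -> kexpr) :
  keq a (Kshift a lam (e 0%nat)) Kzero ->
  keq a (Kshift a lam (e 1%nat)) (e 0%nat) ->
  (forall k, keq a (Kshift a lam (e (S (S k)))) (KAdd (e (S k)) (KMul (Kcst mu) (e k)))) ->
  forall k, keq a (Nat.iter k (Kshift a lam) (e k)) (e 0%nat) /\
    forall j, (k < j)%nat -> keq a (Nat.iter j (Kshift a lam) (e k)) Kzero.
Proof.
  intros H0 H1 H2.
  set (Q := fun k => keq a (Nat.iter k (Kshift a lam) (e k)) (e 0%nat) /\
    forall j, (k < j)%nat -> keq a (Nat.iter j (Kshift a lam) (e k)) Kzero).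
  assert (S0 : Q 0%nat).
  { split; [intros z t Hz; reflexivity|]. intros [|j] Hj; [lia|].
    rewrite Nat.iter_succ_r. eapply keq_trans; [apply iter_Kshift_keq, H0 | apply
        iter_Kshift_zero]. }
  enough (W : forall k, Q k /\ Q (S k)) by (intros k; apply W).
  induction k as [|k [[IHa IHb] [IHc IHd]]].
  - split; [exact S0|]. destruct S0 as [_ S0]. split.
    + rewrite Nat.iter_succ_r. exact H1.
    + intros [|j] Hj; [lia|]. rewrite Nat.iter_succ_r.
      eapply keq_trans; [apply iter_Kshift_keq, H1 |]. apply S0. lia.
  - split; [now split|]. split.
    + rewrite Nat.iter_succ_r. eapply keq_trans; [apply iter_Kshift_keq, H2|].
      eapply keq_trans; [apply iter_Kshift_lin|]. intros z t Hz. cbn [keval].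
      rewrite (IHc z t Hz), (IHb (S k) ltac:(lia) z t Hz). simpl. ring.
    + intros [|j] Hj; [lia|]. rewrite Nat.iter_succ_r. eapply keq_trans; [apply
        iter_Kshift_keq, H2|].
      eapply keq_trans; [apply iter_Kshift_lin|]. intros z t Hz. cbn [keval].
      rewrite (IHd j ltac:(lia) z t Hz), (IHb j ltac:(lia) z t Hz). simpl. ring.
Qed.

(** * The square root branch and the two families of kernels *)

Lemma cont_scal (c : C) (h : R -> C) (hc : forall t, cont_pair h t) :
  forall t, cont_pair (fun t => c * h t)%C t.
Proof. intros t. apply cont_mult; [apply cont_const | apply hc]. Qed.

Definition Kpoly (coef : nat -> C) (mseq : nat -> nat) (h : R -> C)
    (hc : forall t, cont_pair h t) (k : nat) : kexpr :=
  KMul (KT (fun t => coef k * h t)%C (cont_scal (coef k) h hc)) (KK (mseq k)).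

Lemma Carg_cos_sin (w : C) :
  Cmod w <> 0 -> cos (Carg w) = Re w / Cmod w /\ sin (Carg w) = Im w / Cmod w.
Proof.
  intros Hw. assert (Hp : 0 < Cmod w) by (generalize (Cmod_ge_0 w); lra).
  assert (E := Cmod_sqr w).
  assert (B : -1 <= Re w / Cmod w <= 1).
  { assert (HR := re_le_Cmod w). apply Rabs_le_between in HR.
    split; apply Rmult_le_reg_r with (Cmod w); try assumption; unfold Rdiv;
      rewrite Rmult_assoc, Rinv_l by assumption; lra. }
  assert (Hs : 1 - (Re w / Cmod w)² = (Im w / Cmod w)²).
  { unfold Rsqr. apply Rmult_eq_reg_r with (Cmod w ^ 2); [|nra].
    transitivity (Cmod w ^ 2 - Re w ^ 2); [field; assumption|].
    transitivity (Im w ^ 2); [lra | field; assumption]. }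
  unfold Carg. destruct (Rle_dec 0 (Im w)) as [H|H].
  - split; [now apply cos_acos|]. rewrite sin_acos, Hs by assumption.
    apply sqrt_Rsqr. apply Rmult_le_pos; [assumption | left; now apply Rinv_0_lt_compat].
  - split; [rewrite cos_neg; now apply cos_acos|]. rewrite sin_neg, sin_acos, Hs by assumption.
    rewrite sqrt_Rsqr_abs, Rabs_left; [ring|].
    assert (0 < / Cmod w) by now apply Rinv_0_lt_compat. unfold Rdiv. nra.
Qed.

Lemma Csqrt_square (w : C) : (Csqrt w * Csqrt w)%C = w.
Proof.
  destruct (Req_dec (Cmod w) 0) as [H0|H0].
  - unfold Csqrt. rewrite H0, sqrt_0. rewrite (Cmod_eq_0 w H0). ring.
  - destruct (Carg_cos_sin w H0) as [Hc Hs].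
    assert (Hp : 0 <= Cmod w) by apply Cmod_ge_0.
    assert (Q := sqrt_sqrt _ Hp).
    replace (Carg w) with (2 * (Carg w / 2)) in Hc, Hs by field.
    rewrite cos_2a in Hc. rewrite sin_2a in Hs.
    unfold Csqrt, Cexp. unfold Re, Im in *. simpl. rewrite exp_0.
    set (c := cos (Carg w / 2)) in *. set (s := sin (Carg w / 2)) in *. set (r := sqrt (Cmod
        w)) in *.
    apply injective_projections; simpl.
    + transitivity (r * r * (c * c - s * s)); [ring|]. rewrite Q, Hc. field. exact H0.
    + transitivity (r * r * (2 * s * c)); [ring|]. rewrite Q, Hs. field. exact H0.
Qed.

(** Off the closed negative axis the argument lies strictly between [- PI] and [PI], so half of it
    has positive cosine. This is what gives [Re a > 1/2] when [lam] is not [-1/4]. *)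
Lemma Csqrt_Re_pos (w : C) : ~ (Re w <= 0 /\ Im w = 0) -> 0 < Re (Csqrt w).
Proof.
  intros Hw.
  assert (H0 : Cmod w <> 0).
  { intros H. apply Hw. rewrite (Cmod_eq_0 w H). simpl. split; [apply Rle_refl | reflexivity]. }
  assert (Hp : 0 < Cmod w) by (generalize (Cmod_ge_0 w); lra).
  destruct (Carg_cos_sin w H0) as [Hc Hs].
  assert (Bd : 0 <= acos (Re w / Cmod w) <= PI) by apply acos_bound.
  assert (Hpi := PI_RGT_0).
  assert (Ca : - PI < Carg w < PI).
  { assert (N : Carg w <> PI /\ Carg w <> - PI).
    { split; intros E; rewrite E in Hc, Hs; apply Hw.
      - rewrite cos_PI in Hc. rewrite sin_PI in Hs. split.
        + replace (Re w) with (Re w / Cmod w * Cmod w) by (field; assumption). rewrite <- Hc.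
            lra.
        + replace (Im w) with (Im w / Cmod w * Cmod w) by (field; assumption). rewrite <- Hs.
            ring.
      - rewrite cos_neg, cos_PI in Hc. rewrite sin_neg, sin_PI in Hs. split.
        + replace (Re w) with (Re w / Cmod w * Cmod w) by (field; assumption). rewrite <- Hc.
            lra.
        + replace (Im w) with (Im w / Cmod w * Cmod w) by (field; assumption). rewrite <- Hs.
            ring. }
    destruct N as [N1 N2]. revert N1 N2. unfold Carg. destruct (Rle_dec 0 (Im w)); intros;
        split; lra. }
  unfold Csqrt, Cexp. unfold Re, Im. simpl. rewrite exp_0, Rmult_0_l, Rminus_0_r, Rmult_1_l.
  apply Rmult_lt_0_compat; [now apply sqrt_lt_R0|]. apply cos_gt_0; lra.
Qed.

Lemma poisson_circle (z : C) (t : R) : poisson z (cos t, sin t) = gap z / dist2 z t.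
Proof.
  unfold poisson, gap. f_equal. rewrite Cmod_sqr. unfold dist2. rewrite Cmod_sqr.
  unfold Re, Im. simpl. generalize (cos2_sin2 t). nra.
Qed.

(* Common description of both branches of [poly_poisson]: up to the constant [coef k]
   it is [(log P)^(mseq k) P^a], and the shifted Laplacian lowers [k] by one up to a
   multiple [mu] of the kernel of index [k - 2]. *)
Definition kernel_data (lam a mu : C) (coef : nat -> C) (mseq : nat -> nat) : Prop :=
  (forall k z t, in_disk z ->
     poly_poisson k lam z (cos t, sin t)
     = coef k * (RtoC (ln (gap z / dist2 z t) ^ mseq k) * Rcpow (gap z / dist2 z t) a))%C /\
  (forall k, coef k <> RtoC 0) /\
  (forall j k, (j < k)%nat -> (mseq j < mseq k)%nat) /\
  1 / 2 <= Re a /\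
  (forall k, moment_nondegenerate (mseq k) a) /\
  (forall h hc, let e := Kpoly coef mseq h hc in
     keq a (Kshift a lam (e 0%nat)) Kzero /\
     keq a (Kshift a lam (e 1%nat)) (e 0%nat) /\
     (forall k, keq a (Kshift a lam (e (S (S k)))) (KAdd (e (S k)) (KMul (Kcst mu) (e k))))).

Lemma Cinv_neq_0 (c : C) : c <> RtoC 0 -> (/ c)%C <> RtoC 0.
Proof.
  intros H E. apply C1_nz. rewrite <- (Cinv_r c H), E. ring.
Qed.

Lemma RtoC_neq_0 (x : R) : x <> 0 -> RtoC x <> RtoC 0.
Proof. intros H E. now apply H, RtoC_inj. Qed.

(** At [a = 1/2] both [a (a - 1) - lam] and [2 a - 1] vanish, so the shift lowers the power of
    [log P] by two. Hence the powers [2 k], the factorials of [2 k], and [mu = 0]. *)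
Lemma kernel_data_half :
  exists coef mseq, kernel_data (RtoC (-1/4)) (RtoC (1/2)) (RtoC 0) coef mseq.
Proof.
  set (coef := fun k => RtoC (/ INR (fact (2 * k)))).
  exists coef, (fun k => (2 * k)%nat).
  assert (F : forall n, INR (fact n) <> 0) by (intros; apply INR_fact_neq_0).
  split; [|split; [|split; [|split; [|split]]]].
  - intros k z t Hz. unfold poly_poisson. destruct (Ceq_dec _ _) as [_|N]; [|now destruct N].
    unfold horo. rewrite poisson_circle. unfold coef.
    replace (Rcpow (gap z / dist2 z t) (RtoC (1/2))) with (RtoC (Rpower (gap z / dist2 z t)
        (1/2))).
    + rewrite <- !RtoC_mult. f_equal.
      replace ((- ln (gap z / dist2 z t)) ^ (2 * k)) with (ln (gap z / dist2 z t) ^ (2 * k));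
          [ring|].
      rewrite !pow_mult. f_equal. ring.
    + unfold Rcpow, Cexp, Rpower, RtoC. unfold Re, Im. simpl.
      rewrite !Rmult_0_l, !Rmult_0_r, Rminus_0_r, Rplus_0_l, cos_0, sin_0.
      apply injective_projections; simpl; ring.
  - intros k. apply RtoC_neq_0. apply Rinv_neq_0_compat, F.
  - intros; lia.
  - simpl. apply Rle_refl.
  - intros k. apply moment_nondegenerate_half.
  - intros h hc e.
    assert (A1 : (RtoC (1/2) * (RtoC (1/2) - 1) - RtoC (-1/4))%C = RtoC 0).
    { rewrite <- RtoC_minus, <- RtoC_mult, <- RtoC_minus. f_equal. field. }
    assert (A2 : (2 * RtoC (1/2) - 1)%C = RtoC 0).
    { rewrite <- RtoC_mult, <- RtoC_minus. f_equal. field. }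
    assert (G : forall k, keq (RtoC (1/2)) (Kshift (RtoC (1/2)) (RtoC (-1/4)) (e (S k))) (e k)).
    { intros k z t Hz. unfold e, Kpoly. rewrite Kshift_KK by assumption. cbn [keval Kcst].
      rewrite A1, A2. replace (2 * S k - 1 - 1)%nat with (2 * k)%nat by lia.
      replace (coef k) with (coef (S k) * RtoC (INR (2 * S k) * INR (2 * S k - 1)))%C; [ring|].
      unfold coef. rewrite <- RtoC_mult. f_equal.
      replace (2 * S k)%nat with (S (S (2 * k))) by lia. rewrite !fact_simpl, !mult_INR.
      replace (S (S (2 * k)) - 1)%nat with (S (2 * k)) by lia.
      assert (N1 := not_0_INR (S (2 * k)) ltac:(lia)).
      assert (N2 := not_0_INR (S (S (2 * k))) ltac:(lia)).
      field. repeat split; auto. }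
    split; [|split].
    + intros z t Hz. unfold e, Kpoly. rewrite Kshift_KK by assumption. cbn [keval Kcst Kzero].
      rewrite A1, A2. simpl. rewrite Rmult_0_l. ring.
    + apply G.
    + intros k. eapply keq_trans; [apply G|]. intros z t Hz. cbn [keval Kcst]. ring.
Qed.

(** With [a = s + 1/2], [s^2 = lam + 1/4] removes the leading coefficient and [2 a - 1 = 2 s]. The
    value of [mu] comes from [coef (k + 2) (k + 2) (k + 1) = coef k / (2 s)^2]. *)
Lemma kernel_data_generic (lam : C) :
  lam <> RtoC (-1/4) -> ~ (Re lam < - 1 / 4 /\ Im lam = 0) ->
  exists a mu coef mseq, kernel_data lam a mu coef mseq.
Proof.
  intros Hne Hlam. remember (s_of lam) as s eqn:Es.
  assert (Hs : 0 < Re s).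
  { rewrite Es. apply Csqrt_Re_pos. intros [H1 H2]. unfold Re, Im in *. simpl in H1, H2.
    rewrite Rplus_0_r in H2. destruct (Rle_lt_or_eq_dec _ _ H1) as [H|H].
    - apply Hlam. split; lra.
    - apply Hne. apply injective_projections; simpl; lra. }
  assert (Hss : (s * s)%C = (lam + RtoC (1/4))%C) by (rewrite Es; apply Csqrt_square).
  assert (H2s : (2 * s)%C <> RtoC 0).
  { intros E. apply (f_equal Re) in E. unfold Re in *. simpl in E. lra. }
  set (coef := fun k => (/ (RtoC (INR (fact k)) * (2 * s) ^ k))%C).
  assert (F : forall k, RtoC (INR (fact k)) <> RtoC 0) by (intros; apply RtoC_neq_0,
      INR_fact_neq_0).
  assert (Fp : forall k, ((2 * s) ^ k)%C <> RtoC 0) by (intros; now apply Cpow_nz).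
  set (a := (s + RtoC (1/2))%C).
  exists a, (/ ((2 * s) * (2 * s)))%C, coef, (fun k => k).
  assert (Ha : Re a = Re s + 1/2) by reflexivity.
  split; [|split; [|split; [|split; [|split]]]].
  - intros k z t Hz. unfold poly_poisson. destruct (Ceq_dec _ _) as [E|_]; [now destruct Hne|].
    rewrite <- Es. fold a. unfold horo. rewrite Ropp_involutive, poisson_circle, RtoC_pow.
        unfold coef. ring.
  - intros k. apply Cinv_neq_0. now apply Cmult_neq_0.
  - auto.
  - lra.
  - intros k. apply moment_nondegenerate_gt. lra.
  - intros h hc e.
    assert (A1 : (a * (a - 1) - lam)%C = RtoC 0).
    { unfold a. transitivity (s * s - RtoC (1/2) * RtoC (1/2) - lam + s * (2 * RtoC (1/2) -
        1) + RtoC (1/2) * (2 * RtoC (1/2) - 1))%C; [ring|].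
      rewrite Hss. replace (2 * RtoC (1/2) - 1)%C with (RtoC 0).
      - rewrite <- RtoC_mult. replace (1/2 * (1/2)) with (1/4) by field. ring.
      - rewrite <- RtoC_mult, <- RtoC_minus. f_equal. field. }
    assert (A2 : (2 * a - 1)%C = (2 * s)%C).
    { unfold a. transitivity (2 * s + (2 * RtoC (1/2) - 1))%C; [ring|].
      replace (2 * RtoC (1/2) - 1)%C with (RtoC 0); [ring|].
      rewrite <- RtoC_mult, <- RtoC_minus. f_equal. field. }
    assert (B1 : forall k, (coef (S k) * (RtoC (INR (S k)) * (2 * s)) = coef k)%C).
    { intros k. unfold coef. rewrite fact_simpl, mult_INR, RtoC_mult, Cpow_S.
      assert (N := RtoC_neq_0 _ (not_0_INR (S k) ltac:(lia))).
      assert (Fk := F k). assert (Fpk := Fp k).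
      field. repeat split; auto. intros E; apply H2s; rewrite E; ring. }
    split; [|split].
    + intros z t Hz. unfold e, Kpoly. rewrite Kshift_KK by assumption. cbn [keval Kcst Kzero].
      rewrite A1, A2. simpl. rewrite Rmult_0_l. ring.
    + intros z t Hz. unfold e, Kpoly. rewrite Kshift_KK by assumption. cbn [keval Kcst].
      rewrite A1, A2, <- (B1 0%nat). simpl INR. rewrite Rmult_0_r. simpl Nat.sub. ring.
    + intros k z t Hz. unfold e, Kpoly. rewrite Kshift_KK by assumption. cbn [keval Kcst].
      rewrite A1, A2. replace (S (S k) - 1)%nat with (S k) by lia. replace (S k - 1)%nat with
          k by lia.
      rewrite <- (B1 (S k)). replace (coef k) with (coef (S (S k)) * (RtoC (INR (S (S k)) *
          INR (S k)) * ((2 * s) * (2 * s))))%C.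
      * rewrite RtoC_mult. assert (N : s <> RtoC 0) by (intros E; apply H2s; rewrite E; ring).
        field. exact N.
      * rewrite <- (B1 k), <- (B1 (S k)), RtoC_mult. ring.
Qed.

Lemma kernel_data_exists (lam : C) :
  ~ (Re lam < - 1 / 4 /\ Im lam = 0) ->
  exists a mu coef mseq, kernel_data lam a mu coef mseq.
Proof.
  intros Hlam. destruct (Ceq_dec lam (RtoC (-1/4))) as [->|N].
  - destruct kernel_data_half as [coef [mseq H]].
    now exists (RtoC (1/2)), (RtoC 0), coef, mseq.
  - now apply kernel_data_generic.
Qed.
(** * Boundary limits *)

Lemma Rcpow_parts (x : R) (a : C) :
  Rcpow x a = (exp (Re a * ln x) * cos (Im a * ln x), exp (Re a * ln x) * sin (Im a * ln x)).
Proof.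
  unfold Rcpow, Cexp, Re, Im. simpl.
  rewrite !Rmult_0_r, Rminus_0_r, Rplus_0_l. reflexivity.
Qed.

(** Splits [P^a] as [gap^a D^(-a)]. The first factor leaves the integral and cancels in every ratio,
    so that only the moments matter. *)
Lemma Rcpow_quot (x d : R) (a : C) :
  0 < x -> 0 < d -> Rcpow (x / d) a = (Rcpow x a * (re_negpow a d, im_negpow a d))%C.
Proof.
  intros Hx Hd. rewrite !Rcpow_parts. rewrite ln_div by assumption. unfold re_negpow, im_negpow.
  rewrite !Rmult_minus_distr_l, cos_minus, sin_minus.
  replace (Re a * ln x - Re a * ln d) with (Re a * ln x + - Re a * ln d) by ring.
  rewrite exp_plus. apply injective_projections; simpl; ring.
Qed.

Lemma Rcpow_neq_0 (x : R) (a : C) : 0 < Cmod (Rcpow x a).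
Proof.
  apply Cmod_gt_0. intros E. rewrite Rcpow_parts in E.
  assert (H := exp_pos (Re a * ln x)). assert (T := cos2_sin2 (Im a * ln x)).
  assert (E1 := f_equal fst E). assert (E2 := f_equal snd E). simpl in E1, E2.
  apply Rmult_integral in E1. apply Rmult_integral in E2.
  destruct E1 as [E1|E1]; [lra|]. destruct E2 as [E2|E2]; [lra|].
  rewrite E1, E2 in T. lra.
Qed.

Lemma Cmod_negpow_le (a : C) (d : R) : Cmod (re_negpow a d, im_negpow a d) <=
    negpow (Re a) d.
Proof.
  apply Cmod_le_dir. intros c s H. simpl.
  eapply Rle_trans; [apply Rle_abs | now apply negpow_dir_le].
Qed.

Lemma kint_one (a : C) (m : nat) (z : C) :
  in_disk z ->
  kint a (KMul (Kcst (RtoC 1)) (KK m)) z = (RtoC (/ (2 * PI)) * Rcpow (gap z) a * cmoment m a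
      z)%C.
Proof.
  intros Hz. assert (G := proj1 (in_disk_gap z) Hz).
  assert (P1 := ex_avg z _ Hz (pos_cont_lnpow m z _ Hz (pos_cont_re_negpow a))).
  assert (P2 := ex_avg z _ Hz (pos_cont_lnpow m z _ Hz (pos_cont_im_negpow a))).
  unfold kint, cmoment, avg. remember (Rcpow (gap z) a) as w eqn:Ew.
  apply injective_projections; cbn [keval Kcst Cmult fst snd RtoC].
  - transitivity (/ (2 * PI) * (fst w * RInt (fun t => ln (gap z / dist2 z t) ^ m * re_negpow
      a (dist2 z t)) 0 (2 * PI)
      + - snd w * RInt (fun t => ln (gap z / dist2 z t) ^ m * im_negpow a (dist2 z t)) 0 (2 *
          PI))); [|ring].
    rewrite <- RInt_lin by assumption. f_equal. apply RInt_ext. intros t _.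
    rewrite Rcpow_quot by (auto using dist2_pos). rewrite <- Ew. cbn [Cmult fst snd].
    match goal with |- @eq _ ?x ?y => change (@eq R x y) end. ring.
  - transitivity (/ (2 * PI) * (snd w * RInt (fun t => ln (gap z / dist2 z t) ^ m * re_negpow
      a (dist2 z t)) 0 (2 * PI)
      + fst w * RInt (fun t => ln (gap z / dist2 z t) ^ m * im_negpow a (dist2 z t)) 0 (2 *
          PI))); [|ring].
    rewrite <- RInt_lin by assumption. f_equal. apply RInt_ext. intros t _.
    rewrite Rcpow_quot by (auto using dist2_pos). rewrite <- Ew. cbn [Cmult fst snd].
    match goal with |- @eq _ ?x ?y => change (@eq R x y) end. ring.
Qed.

(** The part [B D] of the bound lowers the exponent of [D] by one and so meets the smaller average
    [J_(al-1)]. *)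
Lemma kint_bound (a : C) (h : R -> C) (hc : forall t, cont_pair h t) (m : nat) (A B : R) (z :
    C) :
  in_disk z ->
  (forall t, 0 <= t <= 2 * PI -> Cmod (h t) <= A + B * dist2 z t) ->
  Cmod (kint a (KMul (KT h hc) (KK m)) z)
  <= / (2 * PI) * Cmod (Rcpow (gap z) a) * lmax z ^ m
     * (A * pow_avg (Re a) z + B * pow_avg (Re a - 1) z).
Proof.
  intros Hz Hh. assert (G := proj1 (in_disk_gap z) Hz). assert (Hpi := two_pi_pos).
  set (e := KMul (KT h hc) (KK m)).
  assert (A1 := jointly_cont_ex _ z 0 (2 * PI) (good_fst a e) Hz).
  assert (B1 := jointly_cont_ex _ z 0 (2 * PI) (good_snd a e) Hz).
  set (w := Cmod (Rcpow (gap z) a)).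
  assert (Hw : 0 < w) by apply Rcpow_neq_0.
  apply Cmod_le_dir. intros c s Hcs.
  change (c * (/ (2 * PI) * RInt (fun t => fst (keval a e z t)) 0 (2 * PI))
    + s * (/ (2 * PI) * RInt (fun t => snd (keval a e z t)) 0 (2 * PI))
    <= / (2 * PI) * w * lmax z ^ m * (A * pow_avg (Re a) z + B * pow_avg (Re a - 1) z)).
  transitivity (/ (2 * PI) * (c * RInt (fun t => fst (keval a e z t)) 0 (2 * PI) + s * RInt
      (fun t => snd (keval a e z t)) 0 (2 * PI))).
  { right; ring. }
  rewrite !Rmult_assoc. apply Rmult_le_compat_l; [left; now apply Rinv_0_lt_compat|].
  rewrite <- RInt_lin by assumption.
  rewrite <- !Rmult_assoc. unfold pow_avg. rewrite <- avg_lin, <- avg_scal by auto using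
      pos_cont_negpow, pos_cont_lin.
  apply RInt_le; [lra | | |].
  - apply (ex_RInt_plus (V := R_NormedModule)); apply (ex_RInt_scal (V := R_NormedModule));
      assumption.
  - apply (ex_avg z (fun d => w * lmax z ^ m * (A * negpow (Re a) d + B * negpow (Re a - 1)
      d)) Hz).
    intros d Hd. apply (continuous_scal_r (K := R_AbsRing) (V := R_NormedModule)).
    apply pos_cont_lin; auto using pos_cont_negpow.
  - intros t Ht. assert (D := dist2_pos z t Hz).
    refine (Rle_trans _ _ _ (Cmod_ge_dir (keval a e z t) c s Hcs) _).
    unfold e. cbn [keval]. rewrite Rcpow_quot, !Cmod_mult, Cmod_R by assumption. fold w.
    rewrite negpow_pred by assumption.
    assert (Hl := ln_quot_le_lmax z _ Hz (dist2_bounds z t)).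
    assert (Hy : Rabs (ln (gap z / dist2 z t) ^ m) <= lmax z ^ m).
    { rewrite <- RPow_abs. apply pow_incr. split; [apply Rabs_pos | apply Rabs_le; lra]. }
    assert (Hp := Cmod_negpow_le a (dist2 z t)). assert (Hq := negpow_pos (Re a)
        (dist2 z t)).
    assert (Hht := Hh t ltac:(lra)). assert (H0 := Cmod_ge_0 (h t)).
    set (p := negpow (Re a) (dist2 z t)) in *. set (d := dist2 z t) in *.
    transitivity ((A + B * d) * (lmax z ^ m * (w * p))); [|right; ring].
    assert (Hy0 := Rabs_pos (ln (gap z / d) ^ m)). assert (Hp0 := Cmod_ge_0 (re_negpow a d,
        im_negpow a d)).
    apply Rmult_le_compat; [assumption | | assumption |].
    + apply Rmult_le_pos; [assumption | apply Rmult_le_pos; lra].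
    + apply Rmult_le_compat; [assumption | apply Rmult_le_pos; lra | assumption |].
      apply Rmult_le_compat_l; lra.
Qed.

Lemma boundary_near (Q : C -> Prop) (xi : C) :
  on_circle xi -> near_circle Q -> within in_disk (locally xi) Q.
Proof.
  intros Hxi [d [Hd H]]. unfold within.
  assert (L : locally xi (fun w => gap w < d)).
  { apply (continuous_gap xi (fun y => y < d)). apply (open_lt d). unfold gap, on_circle in
      *. rewrite Hxi. lra. }
  revert L. apply filter_imp. intros w Hg Hw. now apply H.
Qed.

Lemma locally_Cmod_sqr (xi : C) (d : R) : 0 < d -> locally xi (fun z => Cmod (z - xi) ^ 2 < d).
Proof.
  intros Hd. set (r := Rmin 1 (d / 2)).
  assert (Hr : 0 < r) by (apply Rmin_glb_lt; lra).
  assert (R1 : r <= 1) by apply Rmin_l. assert (R2 : r <= d / 2) by apply Rmin_r.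
  exists (mkposreal r Hr). intros [x y] [H1 H2]. destruct xi as [x0 y0].
  change (Rabs (x - x0) < r) in H1. change (Rabs (y - y0) < r) in H2.
  rewrite Cmod_sqr. unfold Re, Im. simpl.
  apply Rabs_def2 in H1. apply Rabs_def2 in H2. nra.
Qed.

Lemma boundary_lim_intro (F : C -> C) (xi l : C) :
  (forall eps, 0 < eps -> within in_disk (locally xi) (fun z => Cmod (F z - l) < eps)) ->
  boundary_lim F xi l.
Proof.
  intros H. apply filterlim_locally. intros [eps He].
  generalize (H eps He). apply filter_imp. intros z Hz.
  assert (A1 := re_le_Cmod (F z - l)). assert (A2 := Rle_trans _ _ _ (Rmax_r _ _) (Rmax_Cmod
      (F z - l)%C)).
  split.
  - change (Rabs (fst (F z) - fst l) < eps). unfold Re in A1. simpl in A1.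
    replace (fst (F z) - fst l) with (fst (F z) + - fst l) by ring. lra.
  - change (Rabs (snd (F z) - snd l) < eps). simpl in A2.
    replace (snd (F z) - snd l) with (snd (F z) + - snd l) by ring. lra.
Qed.

Lemma dist2_Cmod (z : C) (t : R) : dist2 z t = Cmod ((cos t, sin t) - z) ^ 2.
Proof.
  rewrite Cmod_sqr. unfold dist2. rewrite Cmod_sqr.
  rewrite <- (cos2_sin2 t). unfold Re, Im. simpl. ring.
Qed.

(** The difference of the two sides is [|u - 2 z + xi|^2]. *)
Lemma Cmod_sqr_triangle (u z xi : C) :
  Cmod (u - xi) ^ 2 <= 2 * Cmod (u - z) ^ 2 + 2 * Cmod (z - xi) ^ 2.
Proof.
  rewrite !Cmod_sqr. unfold Re, Im. simpl.
  assert (H1 := pow2_ge_0 (fst u - 2 * fst z + fst xi)).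
  assert (H2 := pow2_ge_0 (snd u - 2 * snd z + snd xi)). lra.
Qed.

Lemma kint_KT_lin (a c : C) (h1 h2 h3 : R -> C) hc1 hc2 hc3 (m : nat) (z : C) :
  in_disk z -> (forall t, h3 t = h1 t + c * h2 t)%C ->
  kint a (KMul (KT h3 hc3) (KK m)) z
  = (kint a (KMul (KT h1 hc1) (KK m)) z + c * kint a (KMul (KT h2 hc2) (KK m)) z)%C.
Proof.
  intros Hz H.
  rewrite <- (kint_scal a (KMul (Kcst c) (KMul (KT h2 hc2) (KK m)))) by (auto; intros;
      reflexivity).
  rewrite <- kint_add by assumption. apply kint_ext; [|assumption].
  intros w t Hw. cbn [keval Kcst]. rewrite H. ring.
Qed.

Definition Kone (m : nat) : kexpr := KMul (Kcst (RtoC 1)) (KK m).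

Lemma kint_one_lower (a : C) (m : nat) (c : R) (z : C) :
  in_disk z -> c * lmax z ^ m * pow_avg (Re a) z <= Cmod (cmoment m a z) ->
  / (2 * PI) * Cmod (Rcpow (gap z) a) * (c * lmax z ^ m * pow_avg (Re a) z) <= Cmod (kint a
      (Kone m) z).
Proof.
  intros Hz H. unfold Kone. rewrite kint_one, !Cmod_mult, Cmod_R by assumption.
  assert (Hi : 0 < / (2 * PI)) by apply Rinv_0_lt_compat, two_pi_pos.
  rewrite (Rabs_pos_eq (/ (2 * PI))) by lra.
  apply Rmult_le_compat_l; [|assumption].
  apply Rmult_le_pos; [lra | left; apply Rcpow_neq_0].
Qed.

(** Numerator minus [l] times denominator is the kernel integral of [h - l]. It is bounded by
    [kint_bound] with [|xi' - xi|^2 <= 2 D + 2 |z - xi|^2], the denominator from below by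
    nondegeneracy; the powers of [lmax] cancel. *)
Lemma ratio_lim (a : C) (m : nat) (h : R -> C) (hc : forall t, cont_pair h t) (l xi : C) :
  on_circle xi -> 1 / 2 <= Re a -> moment_nondegenerate m a ->
  (forall eta, 0 < eta -> exists B, 0 <= B /\ forall t, 0 <= t <= 2 * PI ->
     Cmod (h t - l) <= eta + B * Cmod ((cos t, sin t) - xi) ^ 2) ->
  boundary_lim (fun z => kint a (KMul (KT h hc) (KK m)) z / kint a (Kone m) z)%C xi l.
Proof.
  intros Hxi Ha [c [Hc Hm]] Hh. apply boundary_lim_intro. intros eps He.
  destruct (Hh (c * eps / 4) ltac:(nra)) as [B [HB Hhb]].
  (* One quarter of [c eps] goes to the modulus, and [2 B eta2] occurs twice, once for [|z - xi|^2]
     and once for [J_(al-1)]: three quarters in all. *)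
  set (eta2 := c * eps / (8 * (B + 1))).
  assert (He2 : 0 < eta2) by (unfold eta2; apply Rdiv_lt_0_compat; nra).
  assert (Hev := boundary_near _ xi Hxi (near_and _ _ Hm (near_and _ _ (near_lmax 0)
    (near_and _ _ (near_pow_avg_gt (Re a) 0 Ha) (pow_avg_pred_small (Re a) eta2 Ha He2))))).
  assert (Hloc := locally_Cmod_sqr xi eta2 He2).
  unfold within in Hev |- *.
  assert (Hcomb := filter_and _ _ Hev Hloc). revert Hcomb. apply filter_imp.
  intros z [H1 H2] Hz. destruct (H1 Hz) as [M1 [M2 [M3 M4]]]. clear H1.
  assert (Hi : 0 < / (2 * PI)) by apply Rinv_0_lt_compat, two_pi_pos.
  assert (Hw := Rcpow_neq_0 (gap z) a).
  assert (HL := pow_lt _ m M2).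
  set (W := / (2 * PI) * Cmod (Rcpow (gap z) a) * lmax z ^ m).
  assert (HW : 0 < W) by (unfold W; apply Rmult_lt_0_compat; [apply Rmult_lt_0_compat|];
      assumption).
  assert (Low := kint_one_lower a m c z Hz M1).
  assert (hd : forall t, cont_pair (fun t => h t + (-1) * (l * 1))%C t).
  { intros t. apply cont_plus; [apply hc | apply cont_const]. }
  assert (Up := kint_bound a (fun t => h t + (-1) * (l * 1))%C hd m
    (c * eps / 4 + 2 * B * eta2) (2 * B) z Hz).
  lapply Up; clear Up; [intros Up|].
  2:{ intros t Ht. replace (h t + (-1) * (l * 1))%C with (h t - l)%C by ring.
      eapply Rle_trans; [now apply Hhb|]. rewrite dist2_Cmod.
      assert (T := Cmod_sqr_triangle (cos t, sin t) z xi).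
      apply (Rmult_le_compat_l B) in T; [|assumption].
      assert (B * Cmod (z - xi) ^ 2 <= B * eta2) by (apply Rmult_le_compat_l; lra). lra. }
  fold W in Up.
  set (N := kint a (KMul (KT h hc) (KK m)) z) in *. set (D := kint a (Kone m) z) in *.
  assert (EN : kint a (KMul (KT (fun t => h t + (-1) * (l * 1))%C hd) (KK m)) z = (N - l *
      D)%C).
  { unfold N, D, Kone, Kcst. rewrite (kint_KT_lin a (- l)%C h (fun _ => RtoC 1) _ hc
      (cont_const (RtoC 1)) hd); [ring | assumption |].
    intros t. ring. }
  rewrite EN in Up. clear EN.
  set (J := pow_avg (Re a) z) in *. set (J' := pow_avg (Re a - 1) z) in *.
  replace (/ (2 * PI) * Cmod (Rcpow (gap z) a) * (c * lmax z ^ m * J)) with (W * (c * J)) in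
      Low by (unfold W; ring).
  assert (HcJ : 0 < W * (c * J)) by (apply Rmult_lt_0_compat; [|apply Rmult_lt_0_compat];
      assumption).
  assert (HD : D <> RtoC 0) by (apply Cmod_gt_0; lra).
  replace (N / D - l)%C with ((N - l * D) / D)%C by (field; assumption).
  rewrite Cmod_div by assumption.
  apply Rmult_lt_reg_r with (Cmod D); [lra|].
  unfold Rdiv. rewrite Rmult_assoc, Rinv_l, Rmult_1_r by lra.
  apply Rle_lt_trans with (W * ((c * eps / 4 + 2 * B * eta2) * J + 2 * B * (eta2 * J))).
  - eapply Rle_trans; [exact Up|]. apply Rmult_le_compat_l; [lra|].
    apply Rplus_le_compat_l. apply Rmult_le_compat_l; lra.
  - apply Rlt_le_trans with (eps * (W * (c * J))); [|apply Rmult_le_compat_l; lra].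
    assert (HE : B * eta2 <= c * eps / 8).
    { replace (c * eps / 8) with ((B + 1) * eta2) by (unfold eta2; field; lra). nra. }
    assert (K : (c * eps / 4 + 2 * B * eta2) + 2 * B * eta2 < eps * c) by nra.
    replace ((c * eps / 4 + 2 * B * eta2) * J + 2 * B * (eta2 * J))
      with (((c * eps / 4 + 2 * B * eta2) + 2 * B * eta2) * J) by ring.
    replace (eps * (W * (c * J))) with (W * ((eps * c) * J)) by ring.
    apply Rmult_lt_compat_l; [assumption|]. now apply Rmult_lt_compat_r.
Qed.

Lemma ratio_lim_0 (a : C) (m m' : nat) (h : R -> C) (hc : forall t, cont_pair h t) (xi : C)
    (M : R) :
  on_circle xi -> 1 / 2 <= Re a -> moment_nondegenerate m a -> (m' < m)%nat ->
  0 <= M -> (forall t, 0 <= t <= 2 * PI -> Cmod (h t) <= M) ->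
  boundary_lim (fun z => kint a (KMul (KT h hc) (KK m')) z / kint a (Kone m) z)%C xi (RtoC 0).
Proof.
  intros Hxi Ha [c [Hc Hm]] Hmm HM Hh. apply boundary_lim_intro. intros eps He.
  (* The ratio is at most [M / c] times [lmax^m' / lmax^m]. Beyond 1, this quotient of powers is at
     most [1 / lmax]; beyond [M / (c * eps)], the product is below [eps]. *)
  assert (Hev := boundary_near _ xi Hxi (near_and _ _ Hm (near_and _ _ (near_lmax (Rmax 1 (M
      / (c * eps))))
    (near_pow_avg_gt (Re a) 0 Ha)))).
  unfold within in Hev |- *. revert Hev. apply filter_imp. intros z H1 Hz. destruct (H1 Hz)
      as [M1 [M2 M3]]. clear H1.
  assert (L1 : 1 < lmax z) by (eapply Rle_lt_trans; [apply Rmax_l | exact M2]).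
  assert (L2 : M / (c * eps) < lmax z) by (eapply Rle_lt_trans; [apply Rmax_r | exact M2]).
  assert (Hi : 0 < / (2 * PI)) by apply Rinv_0_lt_compat, two_pi_pos.
  assert (Hw := Rcpow_neq_0 (gap z) a).
  set (W := / (2 * PI) * Cmod (Rcpow (gap z) a)) in *.
  assert (HW : 0 < W) by now apply Rmult_lt_0_compat.
  assert (Low := kint_one_lower a m c z Hz M1).
  assert (Up := kint_bound a h hc m' M 0 z Hz ltac:(intros; rewrite Rmult_0_l, Rplus_0_r;
      auto)).
  fold W in Low, Up. rewrite Rmult_0_l, Rplus_0_r in Up.
  set (N := kint a (KMul (KT h hc) (KK m')) z) in *. set (D := kint a (Kone m) z) in *.
  set (J := pow_avg (Re a) z) in *. set (l := lmax z) in *.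
  assert (Pm := pow_lt l m ltac:(lra)). assert (Pm' := pow_lt l m' ltac:(lra)).
  assert (HcJ : 0 < W * (c * l ^ m * J)).
  { repeat (apply Rmult_lt_0_compat; try assumption). }
  assert (HD : D <> RtoC 0) by (apply Cmod_gt_0; lra).
  replace (N / D - 0)%C with (N / D)%C by ring.
  rewrite Cmod_div by assumption.
  apply Rmult_lt_reg_r with (Cmod D); [lra|].
  unfold Rdiv. rewrite Rmult_assoc, Rinv_l, Rmult_1_r by lra.
  eapply Rle_lt_trans; [exact Up|].
  apply Rlt_le_trans with (eps * (W * (c * l ^ m * J))); [|apply Rmult_le_compat_l; lra].
  replace (eps * (W * (c * l ^ m * J))) with (W * (l ^ m * (c * eps)) * J) by ring.
  replace (W * l ^ m' * (M * J)) with (W * (l ^ m' * M) * J) by ring.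
  apply Rmult_lt_compat_r; [assumption|]. apply Rmult_lt_compat_l; [assumption|].
  assert (HM2 : M < l * (c * eps)).
  { apply (Rmult_lt_compat_r (c * eps)) in L2; [|nra].
    replace (M / (c * eps) * (c * eps)) with M in L2 by (field; lra). exact L2. }
  apply Rlt_le_trans with (l ^ S m' * (c * eps)).
  - rewrite <- tech_pow_Rmult.
    replace (l * l ^ m' * (c * eps)) with (l ^ m' * (l * (c * eps))) by ring.
    now apply Rmult_lt_compat_l.
  - apply Rmult_le_compat_r; [nra|]. apply Rle_pow; [lra | lia].
Qed.

(** * Continuous boundary data *)

Lemma cont_on_circle (g : C -> C) :
  continuous_on on_circle g -> forall t, cont_pair (fun t => g (cos t, sin t)) t.
Proof.
  intros Hg t.
  assert (On : forall u, on_circle (cos u, sin u)).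
  { intros u. unfold on_circle. generalize (Cmod_sqr (cos u, sin u)) (Cmod_ge_0 (cos u, sin
      u)) (cos2_sin2 u).
    unfold Re, Im. simpl. nra. }
  assert (L : filterlim (fun u : R => (cos u, sin u) : C) (locally t) (within on_circle
      (locally (cos t, sin t)))).
  { intros Q HQ. unfold within in HQ.
    assert (Hc : continuous (fun u : R => (cos u, sin u) : C) t).
    { apply continuous_of_components. split; simpl; apply (ex_derive_continuous (V :=
        R_NormedModule)); auto_derive; exact I. }
    assert (W := Hc _ HQ). revert W. unfold filtermap. apply filter_imp. auto. }
  assert (K := filterlim_comp _ _ _ _ _ _ _ _ L (Hg _ (On t))).
  split.
  - apply (filterlim_comp _ _ _ _ _ _ _ _ K). apply (continuous_fst (U := R_UniformSpace) (V
      := R_UniformSpace)).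
  - apply (filterlim_comp _ _ _ _ _ _ _ _ K). apply (continuous_snd (U := R_UniformSpace) (V
      := R_UniformSpace)).
Qed.

Lemma bounded_on_period (h : R -> C) (l : C) :
  (forall t, cont_pair h t) ->
  exists M, 0 <= M /\ forall t, 0 <= t <= 2 * PI -> Cmod (h t - l) <= M.
Proof.
  intros Hh. set (N := fun t => (fst (h t) - fst l) * (fst (h t) - fst l) + (snd (h t) - snd
      l) * (snd (h t) - snd l)).
  destruct (continuity_ab_maj N 0 (2 * PI)) as [x [Hx _]].
  - generalize two_pi_pos; lra.
  - intros t _. apply continuity_pt_filterlim. destruct (Hh t) as [H1 H2].
    assert (C1 : continuous (fun t => fst (h t) - fst l) t).
    { apply (continuous_minus (V := R_NormedModule)); [exact H1 | apply continuous_const]. }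
    assert (C2 : continuous (fun t => snd (h t) - snd l) t).
    { apply (continuous_minus (V := R_NormedModule)); [exact H2 | apply continuous_const]. }
    apply (continuous_plus (V := R_NormedModule) (fun t => (fst (h t) - fst l) * (fst (h t) -
        fst l)));
      apply (continuous_mult (K := R_AbsRing)); assumption.
  - exists (sqrt (N x)). split; [apply sqrt_pos|]. intros t Ht.
    assert (E : Cmod (h t - l) = sqrt (N t)).
    { unfold Cmod, N. f_equal. simpl. ring. }
    rewrite E. apply sqrt_le_1_alt, Hx, Ht.
Qed.

Lemma circle_modulus (g : C -> C) (xi : C) :
  continuous_on on_circle g -> on_circle xi ->
  forall eta, 0 < eta -> exists B, 0 <= B /\ forall t, 0 <= t <= 2 * PI ->
    Cmod (g (cos t, sin t) - g xi) <= eta + B * Cmod ((cos t, sin t) - xi) ^ 2.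
Proof.
  intros Hg Hxi eta He.
  destruct (bounded_on_period (fun t => g (cos t, sin t)) (g xi) (cont_on_circle g Hg)) as [M
      [HM Hb]].
  assert (L := Hg xi Hxi (fun w => Cmod (w - g xi) ^ 2 < eta ^ 2) (locally_Cmod_sqr (g xi)
      (eta ^ 2) ltac:(nra))).
  destruct L as [[d Hd] L].
  (* Within distance [d] of [xi] continuity gives [eta]; beyond it [|u - xi|^2 / d^2 >= 1], so the
     bound [M] suffices. *)
  exists (M / d ^ 2).
  assert (HMd : 0 <= M / d ^ 2) by (apply Rmult_le_pos; [assumption | left; apply
      Rinv_0_lt_compat; simpl in Hd; nra]).
  split; [assumption|]. intros t Ht.
  set (u := (cos t, sin t) : C).
  assert (On : on_circle u).
  { unfold on_circle, u. generalize (Cmod_sqr (cos t, sin t)) (Cmod_ge_0 (cos t, sin t))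
      (cos2_sin2 t).
    unfold Re, Im. simpl. nra. }
  assert (P := pow2_ge_0 (Cmod (u - xi))).
  destruct (Rlt_dec (Cmod (u - xi)) d) as [H|H].
  - assert (Q : ball xi (mkposreal d Hd) u).
    { assert (A1 := Rle_trans _ _ _ (Rmax_l _ _) (Rmax_Cmod (u - xi)%C)).
      assert (A2 := Rle_trans _ _ _ (Rmax_r _ _) (Rmax_Cmod (u - xi)%C)).
      split.
      - change (Rabs (fst u - fst xi) < d). eapply Rle_lt_trans; [exact A1 | exact H].
      - change (Rabs (snd u - snd xi) < d). eapply Rle_lt_trans; [exact A2 | exact H]. }
    assert (W := L u Q On). simpl in W.
    assert (Cmod (g u - g xi) <= eta).
    { assert (W0 := Cmod_ge_0 (g u - g xi)). change (Cmod (g u - g xi) ^ 2 < eta ^ 2) in W.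
        nra. }
    assert (0 <= M / d ^ 2 * Cmod (u - xi) ^ 2) by (now apply Rmult_le_pos). lra.
  - assert (H1 := Hb t Ht). fold u in H1. simpl in Hd.
    assert (H2 : M <= M / d ^ 2 * Cmod (u - xi) ^ 2).
    { replace M with (M / d ^ 2 * d ^ 2) at 1 by (field; lra).
      apply Rmult_le_compat_l; [assumption|]. nra. }
    lra.
Qed.

(** * [Pi_op] and [Phi] as kernel integrals *)

Lemma circle_int_kint (a : C) (e : kexpr) (z : C) (F : C -> C) :
  in_disk z -> (forall t, F (cos t, sin t) = keval a e z t) -> circle_int F = kint a e z.
Proof.
  intros Hz H.
  assert (A1 := jointly_cont_ex _ z 0 (2 * PI) (good_fst a e) Hz).
  assert (B1 := jointly_cont_ex _ z 0 (2 * PI) (good_snd a e) Hz).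
  unfold circle_int.
  replace (RInt (V := C_R_CompleteNormedModule) (fun t => F (cos t, sin t)) 0 (2 * PI))
    with (RInt (fun t => fst (keval a e z t)) 0 (2 * PI), RInt (fun t => snd (keval a e z t))
        0 (2 * PI)).
  - unfold kint. apply injective_projections; cbn [Cmult fst snd RtoC]; ring.
  - symmetry. apply (is_RInt_unique (V := C_R_CompleteNormedModule)).
    apply (is_RInt_ext (V := C_R_NormedModule) (fun t => keval a e z t)); [intros; now
        rewrite H|].
    apply (is_RInt_fct_extend_pair (U := R_NormedModule) (V := R_NormedModule) (fun t =>
        keval a e z t));
      apply (RInt_correct (V := R_CompleteNormedModule)); assumption.
Qed.

Lemma Cinv_0 : (/ RtoC 0)%C = RtoC 0.
Proof. apply injective_projections; simpl; unfold Rdiv; ring. Qed.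

(** Also covers [y = 0], the inverse of zero being zero: the identity is used on the whole disk,
    where [Phi] may vanish away from the circle. *)
Lemma Cdiv_scal (c x y : C) : c <> RtoC 0 -> (x / (c * y) = (/ c * x) / y)%C.
Proof.
  intros Hc. destruct (Ceq_dec y (RtoC 0)) as [->|Hy].
  - rewrite Cmult_0_r. unfold Cdiv. rewrite Cinv_0. ring.
  - field. split; assumption.
Qed.

Lemma boundary_lim_ext (F G : C -> C) (xi l : C) :
  eq_on_disk F G -> boundary_lim F xi l -> boundary_lim G xi l.
Proof.
  intros H. apply filterlim_ext_loc. unfold within. apply filter_forall. exact H.
Qed.

Lemma Pi_op_kint (lam a mu : C) coef mseq (g : C -> C) hc (k : nat) :
  kernel_data lam a mu coef mseq ->
  eq_on_disk (Pi_op k lam g) (kint a (Kpoly coef mseq (fun t => g (cos t, sin t)) hc k)).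
Proof.
  intros [H _] z Hz. apply circle_int_kint; [assumption|]. intros t.
  rewrite (H k z t Hz). unfold Kpoly. cbn [keval]. ring.
Qed.

Lemma Phi_kint (lam a mu : C) coef mseq (k : nat) (z : C) :
  kernel_data lam a mu coef mseq -> in_disk z ->
  Phi k lam z = (coef k * kint a (Kone (mseq k)) z)%C.
Proof.
  intros [H _] Hz.
  rewrite <- (kint_scal a (KMul (Kcst (coef k)) (Kone (mseq k)))) by (auto; intros;
      reflexivity).
  apply circle_int_kint; [assumption|]. intros t.
  rewrite (H k z t Hz). unfold Kone. cbn [keval Kcst]. ring.
Qed.

(** The constant [coef j / coef k] is moved into the angular function, so that the ratio limits
    apply to the bare kernels. *)
Lemma ratio_eq (lam a mu : C) coef mseq (h : R -> C) hc (j k : nat) :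
  kernel_data lam a mu coef mseq ->
  eq_on_disk
    (fun z => kint a (KMul (KT (fun t => (/ coef k * coef j) * h t)%C (cont_scal _ h hc)) (KK
        (mseq j))) z
              / kint a (Kone (mseq k)) z)%C
    (fun z => kint a (Kpoly coef mseq h hc j) z / Phi k lam z)%C.
Proof.
  intros H z Hz. rewrite (Phi_kint lam a mu coef mseq k z H Hz).
  destruct H as [_ [H _]]. rewrite Cdiv_scal by apply H. f_equal.
  apply kint_scal; [assumption|]. intros t. unfold Kpoly. cbn [keval]. ring.
Qed.

Lemma Kpoly_lim (lam a mu : C) coef mseq (g : C -> C) hc (k : nat) (xi : C) :
  kernel_data lam a mu coef mseq -> continuous_on on_circle g -> on_circle xi ->
  boundary_lim (fun z => kint a (Kpoly coef mseq (fun t => g (cos t, sin t)) hc k) z / Phi k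
      lam z)%C xi (g xi).
Proof.
  intros H Hg Hxi.
  apply (boundary_lim_ext _ _ _ _ (ratio_eq lam a mu coef mseq _ hc k k H)).
  destruct H as [_ [Hcoef [_ [Ha [Hm _]]]]].
  apply ratio_lim; auto.
  intros eta He. destruct (circle_modulus g xi Hg Hxi eta He) as [B [HB Hb]].
  exists B. split; [assumption|]. intros t Ht.
  rewrite Cinv_l, Cmult_1_l by apply Hcoef. now apply Hb.
Qed.

Lemma Kpoly_lim_0 (lam a mu : C) coef mseq (h : R -> C) hc (j k : nat) (xi : C) :
  kernel_data lam a mu coef mseq -> (j < k)%nat -> on_circle xi ->
  boundary_lim (fun z => kint a (Kpoly coef mseq h hc j) z / Phi k lam z)%C xi (RtoC 0).
Proof.
  intros H Hjk Hxi.
  apply (boundary_lim_ext _ _ _ _ (ratio_eq lam a mu coef mseq _ hc j k H)).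
  destruct H as [_ [_ [Hinc [Ha [Hm _]]]]].
  destruct (bounded_on_period (fun t => (/ coef k * coef j) * h t)%C (RtoC 0)) as [M [HM Hb]].
  { now apply cont_scal. }
  apply ratio_lim_0 with M; auto.
  intros t Ht. generalize (Hb t Ht). now replace ((/ coef k * coef j) * h t - 0)%C with ((/
      coef k * coef j) * h t)%C by ring.
Qed.

(** * Polyharmonicity of sums and the conclusion *)

Lemma polyharmonic_kint (lam a : C) (m : nat) (f : C -> C) (e : kexpr) :
  eq_on_disk f (kint a e) -> keq a (Nat.iter m (Kshift a lam) e) Kzero -> polyharmonic lam m f.
Proof.
  intros Hf He. split.
  - apply (C_on_disk_ext _ (kint a e)); [now apply eq_on_disk_sym | apply C_on_disk_kint].
  - intros z Hz. rewrite (iter_laplacian_kint a lam f e m Hf z Hz), (kint_ext _ _ _ He z Hz).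
    rewrite (kint_scal a Kzero Kzero z (RtoC 0) Hz); [ring|]. intros t. simpl. ring.
Qed.

(** The factor [Kcst 1] gives each step the form [e1 + c e2] of [iter_Kshift_lin]. *)
Fixpoint Ksum (E : nat -> kexpr) (n : nat) : kexpr :=
  match n with
  | O => E O
  | S n' => KAdd (Ksum E n') (KMul (Kcst (RtoC 1)) (E (S n')))
  end.

Lemma Ksum_kint (a : C) (E : nat -> kexpr) (f : nat -> C -> C) (n : nat) :
  (forall k, (k <= n)%nat -> eq_on_disk (f k) (kint a (E k))) ->
  eq_on_disk (fun z => sum_n (fun k => f k z) n) (kint a (Ksum E n)).
Proof.
  induction n as [|n IH]; intros H z Hz.
  - rewrite sum_O. now apply H.
  - rewrite sum_Sn, (IH (fun k Hk => H k ltac:(lia)) z Hz), (H (S n) ltac:(lia) z Hz).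
    cbn [Ksum]. rewrite kint_add by assumption.
    rewrite (kint_scal a (KMul (Kcst (RtoC 1)) (E (S n))) (E (S n)) z (RtoC 1) Hz) by
        reflexivity.
    rewrite Cmult_1_l. reflexivity.
Qed.

Lemma Ksum_vanish (a lam : C) (E : nat -> kexpr) (m n : nat) :
  (forall k, (k <= n)%nat -> keq a (Nat.iter m (Kshift a lam) (E k)) Kzero) ->
  keq a (Nat.iter m (Kshift a lam) (Ksum E n)) Kzero.
Proof.
  induction n as [|n IH]; intros H; [now apply H|]. cbn [Ksum].
  eapply keq_trans; [apply iter_Kshift_lin|]. intros z t Hz. cbn [keval].
  rewrite (IH (fun k Hk => H k ltac:(lia)) z t Hz), (H (S n) ltac:(lia) z t Hz). simpl. ring.
Qed.

Theorem corollary5p4 (lam : C) (n : nat) (g : nat -> C -> C)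
  (hlam : ~ (Re lam < - 1 / 4 /\ Im lam = 0))
  (hn : (1 <= n)%nat)
  (hg : forall k : nat, (k < n)%nat -> continuous_on on_circle (g k)) :
  let f := fun k : nat => Pi_op k lam (g k) in
  riquier_solution lam n g f /\
  forall (xi : C) (k : nat), on_circle xi -> (k < n)%nat ->
    boundary_lim (fun z => (f k z / Phi k lam z)%C) xi (g k xi) /\
    forall j : nat, (j < k)%nat ->
      boundary_lim (fun z => (f j z / Phi k lam z)%C) xi (RtoC 0).
Proof.
  intros f.
  destruct (kernel_data_exists lam hlam) as [a [mu [coef [mseq D]]]].
  set (h := fun k t => g k (cos t, sin t)).
  assert (hc : forall k, (k < n)%nat -> forall t, cont_pair (h k) t).
  { intros k Hk. apply cont_on_circle. now apply hg. }
  assert (fI : forall k (Hk : (k < n)%nat), eq_on_disk (f k) (kint a (Kpoly coef mseq (h k)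
      (hc k Hk) k))).
  { intros k Hk. exact (Pi_op_kint lam a mu coef mseq (g k) (hc k Hk) k D). }
  assert (chain : forall k h hc,
    keq a (Nat.iter k (Kshift a lam) (Kpoly coef mseq h hc k)) (Kpoly coef mseq h hc 0) /\
    forall j, (k < j)%nat -> keq a (Nat.iter j (Kshift a lam) (Kpoly coef mseq h hc k)) Kzero).
  { intros k h' hc'. destruct D as [_ [_ [_ [_ [_ D]]]]]. destruct (D h' hc') as [D0 [D1 D2]].
    exact (chain_vanish a lam mu _ D0 D1 D2 k). }
  split; [split|].
  - set (E := fun k => match lt_dec k n with
                       | left Hk => Kpoly coef mseq (h k) (hc k Hk) k
                       | right _ => Kzero end).
    apply (polyharmonic_kint lam a n _ (Ksum E (n - 1))).
    + apply Ksum_kint. intros k Hk. unfold E. destruct (lt_dec k n) as [H|H]; [apply fI | lia].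
    + apply Ksum_vanish. intros k Hk. unfold E. destruct (lt_dec k n) as [H|H]; [now apply
        chain | lia].
  - intros k Hk. split.
    + apply (polyharmonic_kint lam a (k + 1) _ _ (fI k Hk)). apply chain. lia.
    + intros xi Hxi.
      (* After [k] shifts the kernel of [f k] has index 0 with the same data [g k], so the Riquier
         condition is the ratio limit at index 0. *)
      apply (boundary_lim_ext (fun z => kint a (Kpoly coef mseq (h k) (hc k Hk) 0) z / Phi 0
          lam z)%C).
      * intros z Hz. f_equal. rewrite (iter_laplacian_kint a lam _ _ k (fI k Hk) z Hz).
        symmetry. apply kint_ext; [apply chain | assumption].
      * apply (Kpoly_lim lam a mu coef mseq (g k) (hc k Hk) 0 xi D); auto.
  - intros xi k Hxi Hk. split.
    + apply (boundary_lim_ext (fun z => kint a (Kpoly coef mseq (h k) (hc k Hk) k) z / Phi k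
        lam z)%C).
      * intros z Hz. now rewrite (fI k Hk z Hz).
      * apply (Kpoly_lim lam a mu coef mseq (g k) (hc k Hk) k xi D); auto.
    + intros j Hj. assert (Hjn : (j < n)%nat) by lia.
      apply (boundary_lim_ext (fun z => kint a (Kpoly coef mseq (h j) (hc j Hjn) j) z / Phi k
          lam z)%C).
      * intros z Hz. now rewrite (fI j Hjn z Hz).
      * now apply (Kpoly_lim_0 lam a mu coef mseq (h j) (hc j Hjn) j k xi D).
Qed.
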